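(* Let $p$ be a positive even integer. Let $z_1,\ldots,z_N$ be distinct points in $\mathbb{D}$, and consider the zero set consisting of each of these points with (positive integer) multiplicities $d_1,\ldots,d_N$, respectively. Let $G$ be the canonical divisor in $A^p$ for this zero set. Then there are complex constants $c_0$ and $c_{nj}$, for $1\le n\le N$ and $0\le j\le(p/2)d_n-1$, such that $$G(z)^{p/2}=c_0+\sum_{n=1}^N\sum_{j=0}^{(p/2)d_n-1}\frac{c_{nj}}{(1-\overline{z_n}z)^{j+2}}\qquad\text{if } z_n\ne0\text{ for all }n,$$ and $$G(z)^{p/2}=c_0z^{(p/2)d_1}+\sum_{j=0}^{(p/2)d_1-1}c_{1j}z^j+\sum_{n=2}^N\sum_{j=0}^{(p/2)d_n-1}\frac{c_{nj}}{(1-\overline{z_n}z)^{j+2}}\qquad\text{if } z_1=0 .$$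
   Context: $\mathbb{D}$ is the open unit disc in $\mathbb{C}$ and $\sigma$ is area measure normalized so that $\sigma(\mathbb{D})=1$. For $1<p<\infty$, $A^p$ is the Bergman space of analytic functions $f$ on $\mathbb{D}$ with $\|f\|_{A^p}=\left(\int_{\mathbb{D}}|f|^p\,d\sigma\right)^{1/p}<\infty$. Given a zero set (points of $\mathbb{D}$ with multiplicities), $N^p$ is the space of $f\in A^p$ vanishing at every point of the zero set to at least the prescribed multiplicity. Let $m\ge0$ be the multiplicity of $0$ in the zero set ($m=0$ if $0$ is not in it). The canonical divisor is the unique $G\in N^p$ with $\|G\|_{A^p}=1$ such that $G^{(m)}(0)$ is positive and as large as possible. *)

(* Defs.v *)
From HB Require Import structures.
From mathcomp Require Import all_boot all_order all_algebra complex.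
From mathcomp Require Import all_classical all_reals all_analysis.

Set Implicit Arguments.
Unset Strict Implicit.
Unset Printing Implicit Defensive.

Import Order.TTheory GRing.Theory Num.Theory.
Import numFieldNormedType.Exports.

Local Open Scope classical_set_scope.
Local Open Scope ring_scope.
Local Open Scope complex_scope.

(* With R[i] a normed module over itself, [derivable f z 1] is complex
   differentiability at z and [f^`(k)] is the k-th complex derivative. *)
HB.instance Definition _ (R : rcfType) := NormedModule.copy R[i] R[i]^o.

Section Bergman.
Variable R : realType.
Implicit Types (f G : R[i] -> R[i]) (p : R) (mu : R[i] -> nat).

Definition unit_disc : set R[i] := [set z | `|z| < 1].

Fact invpi_ge0 : 0 <= (pi : R)^-1.
Proof. by rewrite invr_ge0 pi_ge0. Qed.

(* Lebesgue measure on the plane R * R, identified with R[i] through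
   (x, y) |-> x + iy, divided by the area pi of the unit disc. *)
Definition sigma :
    {measure set (measurableTypeR R * measurableTypeR R) -> \bar R} :=
  mscale (NngNum invpi_ge0)
    (@lebesgue_measure R \x @lebesgue_measure R)%E.

Definition bergman_norm p f : \bar R :=
  poweR (\int[sigma]_(w in [set w | unit_disc (w.1 +i* w.2)])
           (Normc.normc (f (w.1 +i* w.2)) `^ p)%:E) p^-1.

(* Functions are total on R[i]; only their values on the disc matter. *)
Definition bergman_space p : set (R[i] -> R[i]) :=
  [set f | (forall z, unit_disc z -> derivable f z 1) /\
           (bergman_norm p f < +oo)%E].

(* A zero set is given by its multiplicity function mu, which is 0 at the
   points that are not in the zero set. *)
Definition zero_subspace p mu : set (R[i] -> R[i]) :=
  [set f | bergman_space p f /\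
           forall a, unit_disc a ->
             forall k, (k < mu a)%N -> (f^`(k))%classic a = 0].

(* In R[i], [0 < w] says that w is real and positive, and [v <= w] that
   w - v is real and nonnegative. *)
Definition canonical_divisor p mu G : Prop :=
  [/\ zero_subspace p mu G,
      bergman_norm p G = 1%E,
      0 < (G^`(mu 0))%classic 0 &
      forall f, zero_subspace p mu f -> bergman_norm p f = 1%E ->
        0 < (f^`(mu 0))%classic 0 ->
        (f^`(mu 0))%classic 0 <= (G^`(mu 0))%classic 0].

End Bergman.

Definition multiplicity (R : realType) (N : nat) (z : 'I_N -> R[i])
    (d : 'I_N -> nat) (a : R[i]) : nat :=
  (\sum_(n < N | z n == a) d n)%N.

(* Main.v *)
Require Import Defs.
From mathcomp Require Import all_boot all_order all_algebra complex.
From mathcomp Require Import all_classical all_reals all_analysis.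
From mathcomp Require Import measurable_realfun.
From mathcomp Require Import ring lra zify.

(** Write [p = 2 k], let [s] be the zero list in which every [z n] is repeated
    [k * d n] times, and let [m] be the multiplicity of the origin in [s]. The
    power [G ^+ k] lies in the Hilbert space [A^2] and vanishes on [s], and the
    proof identifies it, up to a positive factor, with the solution [L] of a
    linear problem: [L] is the element of [A^2] vanishing on [s] that
    represents, up to a normalization, the functional sending [h] to its [m]-th
    Taylor coefficient.

    The function [L] is explicit. Evaluation of derivatives on [A^2] is given by
    the kernels [w ^+ j / (1 - b^* w) ^+ (j + 2)] (lemmas [pair_kernel] and
    [psum_kernel]), so vanishing on [s] means being orthogonal to finitely many
    of them, and [L] is [w ^+ m] minus its projection on their span
    ([extremal_sequence]). Expanding the kernels in powers of
    [1 / (1 - b^* w)] gives exactly the two shapes of the theorem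
    ([pole_expansion]).

    The heart of the matter is that [L] has no zeros in the disc besides those
    of [s] ([extremal_zero_free]). A surplus zero at the origin would make the
    [m]-th coefficient of [L], hence the norm of [L], vanish. If there were one at
    [a != 0], write
    [L = (a - z) (2 - x - a^* z) y] with [x = |a|^2] and put
    [u = (1 - a^* z) ^+ 2 y], which still vanishes on [s]. An identity between
    the coefficients shows that [(2 - x) |u|^2 <= |L|^2] in [A^2]
    ([norm_comparison]): the difference is a sum of squares. Together with the
    Cauchy-Schwarz inequality for [u] and [L], whose inner product is known
    because [L] is extremal, this forces [x (2 - x) >= 1], which is false since
    [x < 1].

    Being zero free, the quotient of [L] by the polynomial of [s] has a
    holomorphic [k]-th root, and [L = F1 ^+ k] with [F1] vanishing on the original
    zero list. A multiple of [F1] competes with [G], so that the leading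
    coefficient of [G ^+ k] is at least that of the multiple of [L] with
    the same norm; expanding the squared norm of the difference shows that the
    two functions coincide ([canonical_divisor_power]).

    All functions are handled through their Taylor coefficients, on which the
    norm of [A^2] is the weighted sum of [|a n|^2 / (n + 1)]. This rests on two
    general facts proved in the first half of the file: a function with a
    complex derivative at every point of the disc is the sum of its Taylor
    series ([taylor_series], from Goursat's theorem applied in logarithmic polar
    coordinates), and Parseval's formula for area integrals
    ([integral_energy_le] and [integral_energy_ge], from the moments of the
    disc). *)

Set Implicit Arguments.
Unset Strict Implicit.
Unset Printing Implicit Defensive.

Import Order.TTheory GRing.Theory Num.Theory.
Import numFieldNormedType.Exports.
Import Normc.

Local Open Scope classical_set_scope.
Local Open Scope ring_scope.
Local Open Scope complex_scope.

Arguments Normc.normc {R} x : simpl never.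

(** * The modulus of a complex number *)

Section ComplexTopology.
Variable R : realType.
Local Notation C := R[i].
Local Notation nc := (@normc R).
Implicit Types (z w : C).

Lemma normCE z : `|z| = (nc z)%:C.
Proof. by []. Qed.

Lemma normc_ge0 z : 0 <= nc z.
Proof. by rewrite -ler0c -normCE normr_ge0. Qed.

Lemma normc_eq0 z : (nc z == 0) = (z == 0).
Proof.
apply/eqP/eqP => [/eq0_normc//|->]; exact: normc0.
Qed.

Lemma normc_gt0 z : (0 < nc z) = (z != 0).
Proof. by rewrite lt_neqAle eq_sym normc_eq0 normc_ge0 andbT. Qed.

Lemma normcB z w : nc (z - w) = nc (w - z).
Proof. by rewrite -normcN opprB. Qed.

Lemma le_normcB z w : nc (z - w) <= nc z + nc w.
Proof. by rewrite (le_trans (le_normcD _ _))// normcN. Qed.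

Lemma le_normc_dist z w : nc z - nc w <= nc (z - w).
Proof. by rewrite lerBlDr (le_trans _ (le_normcD _ _))// subrK. Qed.

Lemma ler_normc_dist z w : `|nc z - nc w| <= nc (z - w).
Proof.
rewrite ler_norml le_normc_dist andbT lerNl opprB normcB.
exact: le_normc_dist.
Qed.

Lemma normcX z n : nc (z ^+ n) = nc z ^+ n.
Proof. by elim: n => [|n ih]; rewrite ?expr0 ?normc1// !exprS normcM ih. Qed.

Lemma normc_real (x : R) : nc x%:C = `|x|.
Proof. by rewrite /normc/= expr0n/= addr0 sqrtr_sqr. Qed.

Lemma normcR_ge0 (x : R) : 0 <= x -> nc x%:C = x.
Proof. by move=> x0; rewrite normc_real ger0_norm. Qed.

Lemma normc_conj z : nc z^* = nc z.
Proof. by case: z => x y; rewrite /normc/= sqrrN. Qed.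

Lemma normc_i : nc 'i%C = 1.
Proof. by rewrite /normc/= expr0n/= add0r expr1n sqrtr1. Qed.

Lemma le_Re_normc z : `|complex.Re z| <= nc z.
Proof.
case: z => x y /=; rewrite -sqrtr_sqr ler_wsqrtr// lerDl; exact: sqr_ge0.
Qed.

Lemma le_Im_normc z : `|complex.Im z| <= nc z.
Proof.
case: z => x y /=; rewrite -sqrtr_sqr ler_wsqrtr// lerDr; exact: sqr_ge0.
Qed.

Lemma le_normc_ReIm z : nc z <= `|complex.Re z| + `|complex.Im z|.
Proof.
rewrite {1}(complexE z) (le_trans (le_normcD _ _))// normcM normc_i mul1r.
by rewrite !normc_real.
Qed.

Lemma sqr_normcE z : nc z ^+ 2 = complex.Re z ^+ 2 + complex.Im z ^+ 2.
Proof. by case: z => x y; rewrite /normc sqr_sqrtr// addr_ge0// sqr_ge0. Qed.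

Lemma mulc_conj z : z * z^* = (nc z ^+ 2)%:C.
Proof. by rewrite -sqr_normc normCE rmorphXn. Qed.

Lemma ge0_real (z : C) : 0 <= z -> z = (nc z)%:C.
Proof. by move=> z0; rewrite -normCE ger0_norm. Qed.

Lemma unit_discE z : unit_disc z <-> nc z < 1.
Proof. by rewrite /unit_disc/= normCE ltcR. Qed.

Lemma le_normc_sum (I : Type) (s : seq I) (P : pred I) (F : I -> C) :
  nc (\sum_(i <- s | P i) F i) <= \sum_(i <- s | P i) nc (F i).
Proof.
elim/big_rec2: _ => [|i x y _ h]; first by rewrite normc0.
by rewrite (le_trans (le_normcD _ _))// lerD2l.
Qed.

Lemma nbhs_normcP z (A : set C) :
  nbhs z A <-> exists2 d : R, 0 < d & forall w, nc (w - z) < d -> A w.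
Proof.
split=> [/nbhs_ballP[d /= d0 dA]|[d d0 dA]].
  have dE := ge0_real (ltW d0).
  exists (nc d) => [|w wz]; first by rewrite normc_gt0 gt_eqF.
  by apply: dA; rewrite /ball/= distrC dE normCE ltcR.
apply/nbhs_ballP; exists d%:C => /=; first by rewrite ltcR.
by move=> w; rewrite /ball/= distrC normCE ltcR => /dA.
Qed.

Lemma cvg_normcP (T : Type) (F : set_system T) {FF : Filter F} (f : T -> C) l :
  f @ F --> l <-> forall e : R, 0 < e -> \forall x \near F, nc (f x - l) < e.
Proof.
split=> [/cvgrPdist_lt h e e0|h].
  have /h : 0 < e%:C by rewrite ltcR.
  by apply: filterS => x; rewrite distrC normCE ltcR.
apply/cvgrPdist_lt => e e0; have eE := ge0_real (ltW e0).
have /h : 0 < nc e by rewrite normc_gt0 gt_eqF.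
by apply: filterS => x; rewrite -ltcR -eE distrC.
Qed.

Lemma continuous_normcP (f : C -> C) z : {for z, continuous f} <->
  forall e : R, 0 < e ->
    exists2 d : R, 0 < d & forall w, nc (w - z) < d -> nc (f w - f z) < e.
Proof.
split=> [/cvg_normcP h e /h he|h]; first exact: (nbhs_normcP _ _).1 he.
apply: (cvg_normcP (FF := nbhs_filter z) _ _).2 => e /h he.
exact/nbhs_normcP.
Qed.

End ComplexTopology.

(** * Complex derivatives *)

Section ComplexDerivative.
Variable R : realType.
Local Notation C := R[i].
Local Notation nc := (@normc R).
Implicit Types (f g : C -> C) (z w l : C).

(** Distances are real numbers here, whereas the balls of the normed module [C]
    have their radii in [C]. *)
Definition ccont f z := forall e : R, 0 < e ->
  exists2 d : R, 0 < d & forall w, nc (w - z) < d -> nc (f w - f z) < e.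

(** Caratheodory's form of the derivative: the rules for products, inverses and
    composites become identities between the slope functions. *)
Definition cder f z l := exists phi : C -> C,
  [/\ ccont phi z, phi z = l & forall w, f w - f z = phi w * (w - z)].

Lemma continuous_cstC (c z : C) : ccont (fun _ : C => c) z.
Proof. by move=> e e0; exists 1 => // w _; rewrite subrr normc0. Qed.

Lemma continuous_idC z : ccont (fun x : C => x) z.
Proof. by move=> e e0; exists e. Qed.

Lemma continuousDC f g z : ccont f z -> ccont g z -> ccont (fun x => f x + g x) z.
Proof.
move=> /continuous_normcP hf /continuous_normcP hg; apply/continuous_normcP.
exact: (cvgD (FF := nbhs_filter z) hf hg).
Qed.

Lemma continuousMC f g z : ccont f z -> ccont g z -> ccont (fun x => f x * g x) z.
Proof.
move=> /continuous_normcP hf /continuous_normcP hg; apply/continuous_normcP.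
exact: (cvgM (FF := nbhs_filter z) hf hg).
Qed.

Lemma continuousVC f z : f z != 0 -> ccont f z -> ccont (fun x => (f x)^-1) z.
Proof.
move=> fz /continuous_normcP hf; apply/continuous_normcP.
exact: (cvgV (FF := nbhs_filter z) fz hf).
Qed.

Lemma continuous_compC f g z : ccont f z -> ccont g (f z) ->
  ccont (fun x => g (f x)) z.
Proof.
move=> hf hg e /hg[d d0 hd]; have [d' d'0 hd'] := hf _ d0.
by exists d' => // w /hd' /hd.
Qed.

Lemma cder_difference_quotient f z l : cder f z l <->
  ccont (fun w => if w == z then l else (f w - f z) / (w - z)) z.
Proof.
split=> [[phi [cphi phiz E]]|h].
  suff -> : (fun w => if w == z then l else (f w - f z) / (w - z)) = phi by [].
  apply/funext => w; case: eqVneq => [->//|wz].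
  by rewrite E mulfK// subr_eq0.
exists (fun w => if w == z then l else (f w - f z) / (w - z)).
split => //; first by rewrite eqxx.
move=> w; case: eqVneq => [->|wz]; first by rewrite !subrr mulr0.
by rewrite divfK// subr_eq0.
Qed.

Lemma cder_continuous f z l : cder f z l -> ccont f z.
Proof.
move=> [phi [cphi _ E]].
have -> : f = (fun w => f z + phi w * (w - z)).
  by apply/funext => w; rewrite -E addrC subrK.
apply: continuousDC; first exact: continuous_cstC.
apply: continuousMC => //; apply: continuousDC; first exact: continuous_idC.
exact: continuous_cstC.
Qed.

Lemma cder_near f g z l (d : R) : 0 < d ->
  (forall w, nc (w - z) < d -> f w = g w) -> cder f z l -> cder g z l.
Proof.
move=> d0 fg; rewrite !cder_difference_quotient => h.
move=> e /h[d' d'0 hd'].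
exists (Num.min d d') => [|w]; first by rewrite lt_min d0.
rewrite lt_min => /andP[wd wd']; have := hd' _ wd'.
have <- : f w = g w by exact: fg.
by have <- : f z = g z by apply: fg; rewrite subrr normc0.
Qed.

Lemma cder_cst (c z : C) : cder (fun=> c) z 0.
Proof.
exists (fun=> 0); split => //; first exact: continuous_cstC.
by move=> w; rewrite subrr mul0r.
Qed.

Lemma cder_id z : cder (fun x => x) z 1.
Proof.
exists (fun=> 1); split => //; first exact: continuous_cstC.
by move=> w; rewrite mul1r.
Qed.

Lemma cderD f g z l m : cder f z l -> cder g z m ->
  cder (fun x => f x + g x) z (l + m).
Proof.
move=> [phi [cp <- Ef]] [psi [cq <- Eg]]; exists (fun w => phi w + psi w).
split => //; first exact: continuousDC.
by move=> w; rewrite mulrDl -Ef -Eg; ring.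
Qed.

Lemma cderM f g z l m : cder f z l -> cder g z m ->
  cder (fun x => f x * g x) z (l * g z + f z * m).
Proof.
move=> df dg; have cf := cder_continuous df; have cg := cder_continuous dg.
case: df dg => phi [cp <- Ef] [psi [cq <- Eg]].
exists (fun w => phi w * g z + f w * psi w); split => //.
  apply: continuousDC; apply: continuousMC => //; exact: continuous_cstC.
move=> w; rewrite mulrDl mulrAC -Ef -mulrA -Eg; ring.
Qed.

Lemma cderZ c f z l : cder f z l -> cder (fun x => c * f x) z (c * l).
Proof.
move=> df; have := cderM (cder_cst c z) df.
by rewrite mul0r add0r.
Qed.

Lemma cderN f z l : cder f z l -> cder (fun x => - f x) z (- l).
Proof.
move=> /(cderZ (-1)); rewrite mulN1r; congr cder; apply/funext => x.
by rewrite mulN1r.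
Qed.

Lemma cderB f g z l m : cder f z l -> cder g z m ->
  cder (fun x => f x - g x) z (l - m).
Proof. by move=> df /cderN; exact: cderD. Qed.

Lemma cder_comp f g z l m : cder f z l -> cder g (f z) m ->
  cder (fun x => g (f x)) z (m * l).
Proof.
move=> df; have cf := cder_continuous df.
case: df => phi [cp <- Ef] [psi [cq <- Eg]].
exists (fun w => psi (f w) * phi w); split => //.
  by apply: continuousMC => //; exact: continuous_compC.
by move=> w; rewrite Eg Ef mulrA.
Qed.

Lemma cderV f z l : f z != 0 -> cder f z l ->
  cder (fun x => (f x)^-1) z (- l / f z ^+ 2).
Proof.
move=> fz df; have cf := cder_continuous df.
have [d d0 fd] : exists2 d : R, 0 < d & forall w, nc (w - z) < d -> f w != 0.
  have := cf (nc (f z)).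
  rewrite normc_gt0 => /(_ fz)[d d0 hd]; exists d => // w /hd.
  by apply: contraTneq => ->; rewrite sub0r normcN ltxx.
move: df => /cder_difference_quotient df; apply/cder_difference_quotient.
pose q w := if w == z then l else (f w - f z) / (w - z).
have cq : ccont (fun w => - q w / (f w * f z)) z.
  apply: continuousMC.
    have -> : (fun w => - q w) = (fun w => (-1) * q w).
      by apply/funext => w; rewrite mulN1r.
    by apply: continuousMC => //; exact: continuous_cstC.
  apply: continuousVC; first by rewrite mulf_neq0.
  by apply: continuousMC => //; exact: continuous_cstC.
move: cq => h e /h[d' d'0 hd'].
exists (Num.min d d') => [|w]; first by rewrite lt_min d0.
rewrite lt_min => /andP[wd wd']; have := hd' _ wd'.
rewrite eqxx /q eqxx expr2; case: eqVneq => [->//|wz].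
have wz0 : w - z != 0 by rewrite subr_eq0.
have fw := fd _ wd.
congr (nc (_ - _) < e); field.
by rewrite wz0 fw fz.
Qed.

Lemma cderX f z l n : cder f z l ->
  cder (fun x => f x ^+ n) z (n%:R * f z ^+ n.-1 * l).
Proof.
move=> df; elim: n => [|n ih].
  by rewrite !mul0r; exact: cder_cst.
have := cderM df ih.
have -> : (fun x => f x * f x ^+ n) = (fun x => f x ^+ n.+1).
  by apply/funext => x; rewrite exprS.
congr cder; rewrite -pred_Sn; case: n {ih} => [|n].
  by rewrite !expr0 !mul0r !mulr0 !mulr1 mul1r addr0.
by rewrite -pred_Sn [in RHS]mulrS exprS; ring.
Qed.

Lemma derivable_cderP f z l :
  cder f z l <-> (fun h : C => h^-1 *: (f (h + z) - f z)) @ 0^' --> l.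
Proof.
rewrite cder_difference_quotient; split.
  move=> h.
  apply: (cvg_normcP (FF := dnbhs_filter 0) _ _).2 => e /h[d d0 hd].
  apply/nbhs_normcP; exists d => // w; rewrite subr0 => wd w0.
  have := hd (w + z); rewrite addrK eqxx => /(_ wd).
  by rewrite -[X in _ == X]add0r (inj_eq (addIr _)) (negbTE w0) mulrC.
move=> /(cvg_normcP (FF := dnbhs_filter 0) _ _).1 h.
move=> e e0; have /nbhs_normcP[d d0 hd] := h e e0.
exists d => // w wd; rewrite eqxx; case: eqVneq => [_|wz].
  by rewrite subrr normc0.
have := hd (w - z); rewrite subr0 subrK => /(_ wd).
by rewrite subr_eq0 => /(_ wz); rewrite mulrC.
Qed.

Lemma derivable_cder f z : derivable f z 1 <-> exists l, cder f z l.
Proof.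
rewrite /derivable; under eq_fun do rewrite /= [_ *: 1]mulr1.
split=> [h|[l /derivable_cderP h]]; last by apply/cvg_ex; exists l.
by have /cvg_ex[l /derivable_cderP] := h; exists l.
Qed.

Lemma cder_derive1 f z l : cder f z l -> (f^`())%classic z = l.
Proof.
by move=> /derivable_cderP h; exact: (cvg_lim (@norm_hausdorff _ _) h).
Qed.

End ComplexDerivative.

(** * Series of complex numbers *)

Section Sums.
Variable R : realType.
Local Notation C := R[i].
Local Notation nc := (@normc R).
Implicit Types (u v : nat -> C) (l m : C).

Definition has_sum u l := forall e : R, 0 < e ->
  exists N, forall n, (N <= n)%N -> nc (\sum_(k < n) u k - l) < e.

Definition csum u : C := xget 0 [set l | has_sum u l].

(** For Taylor coefficients: the sequences of the functions that are holomorphic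
    in a neighbourhood of the closed disc. *)
Definition geometric_bounded u := exists (M q : R),
  [/\ 0 <= M, 0 <= q, q < 1 & forall n, nc (u n) <= M * q ^+ n].

Lemma has_sum_unique u l m : has_sum u l -> has_sum u m -> l = m.
Proof.
move=> hl hm; apply/eqP; rewrite -subr_eq0 -normc_eq0; apply/negP => /negP lm.
have e0 : 0 < nc (l - m) / 2.
  by rewrite divr_gt0// lt_neqAle eq_sym lm normc_ge0.
have [N hN] := hl _ e0; have [N' hN'] := hm _ e0.
have := ltrD (hN _ (leq_maxl N N')) (hN' _ (leq_maxr N N')).
rewrite -splitr; set s := \sum_(_ < _) _ => h.
suff : nc (l - m) < nc (l - m) by rewrite ltxx.
apply: le_lt_trans h; apply: le_trans (le_normcB _ _).
by rewrite normcB (_ : m - l = s - l - (s - m)) //; ring.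
Qed.

Lemma has_sum_csum u l : has_sum u l -> csum u = l.
Proof.
move=> h; suff hs : has_sum u (csum u) by exact: has_sum_unique hs h.
by rewrite /csum; case: xgetP => [y _ //|/(_ l)].
Qed.

Lemma eq_has_sum u v l : u =1 v -> has_sum u l -> has_sum v l.
Proof. by move=> /funext ->. Qed.

Lemma has_sumD u v l m : has_sum u l -> has_sum v m ->
  has_sum (fun n => u n + v n) (l + m).
Proof.
move=> hu hv e e0; have e2 : 0 < e / 2 by rewrite divr_gt0.
have [N hN] := hu _ e2; have [N' hN'] := hv _ e2.
exists (maxn N N') => n; rewrite geq_max => /andP[/hN h /hN' h'].
rewrite big_split/= (splitr e) (le_lt_trans _ (ltrD h h'))//.
by rewrite (le_trans _ (le_normcD _ _))// opprD addrACA.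
Qed.

Lemma has_sumZ c u l : has_sum u l -> has_sum (fun n => c * u n) (c * l).
Proof.
move=> hu e e0; have c1 : 0 < nc c + 1 by rewrite ltr_wpDl// normc_ge0.
have [|N hN] := hu (e / (nc c + 1)); first by rewrite divr_gt0.
exists N => n /hN h; rewrite -mulr_sumr -mulrBr normcM.
rewrite (@le_lt_trans _ _ ((nc c + 1) * nc (\sum_(k < n) u k - l)))//.
  by rewrite ler_wpM2r ?normc_ge0// lerDl.
by rewrite mulrC -ltr_pdivlMr.
Qed.

Lemma has_sumN u l : has_sum u l -> has_sum (fun n => - u n) (- l).
Proof.
move=> /(has_sumZ (-1)); rewrite mulN1r; congr has_sum.
by apply/funext => n; rewrite mulN1r.
Qed.

Lemma has_sumB u v l m : has_sum u l -> has_sum v m ->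
  has_sum (fun n => u n - v n) (l - m).
Proof. by move=> hu /has_sumN; exact: has_sumD. Qed.

Lemma has_sumS u l : has_sum (fun n => u n.+1) l -> has_sum u (u 0%N + l).
Proof.
move=> hu e /hu[N hN]; exists N.+1 => -[//|n] /hN.
by rewrite big_ord_recl opprD addrACA subrr add0r.
Qed.

Lemma has_sum_conj u l : has_sum u l -> has_sum (fun n => (u n)^*) l^*.
Proof.
move=> hu e /hu[N hN]; exists N => n /hN.
by rewrite -(rmorph_sum (@conjc R)) -rmorphB normc_conj.
Qed.

Lemma has_sum_bound u l (B : R) : has_sum u l ->
  (forall n, nc (\sum_(k < n) u k) <= B) -> nc l <= B.
Proof.
move=> hu hB; apply/ler_addgt0Pr => e /hu[N /(_ N (leqnn N)) h].
rewrite -[l](subKr (\sum_(k < N) u k)).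
by rewrite (le_trans (le_normcB _ _))// lerD// ltW.
Qed.

Lemma has_sum_fin u N : (forall n, (N <= n)%N -> u n = 0) ->
  has_sum u (\sum_(k < N) u k).
Proof.
move=> u0 e e0; exists N => n Nn.
rewrite -!(big_mkord xpredT) (big_cat_nat (leq0n N) Nn)/= addrAC subrr add0r.
rewrite big_nat_cond big1 ?normc0// => k /andP[/andP[Nk _] _]; exact: u0.
Qed.

Lemma geometric_sum_le (q : R) n : 0 <= q -> q < 1 ->
  \sum_(k < n) q ^+ k <= (1 - q)^-1.
Proof.
move=> q0 q1; have q1' : 0 < 1 - q by rewrite subr_gt0.
rewrite -[leRHS]mul1r ler_pdivlMr// mulrC -opprB mulNr -subrX1 opprB.
by rewrite lerBlDr lerDl exprn_ge0.
Qed.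

Lemma geometric_bounded_sum u : geometric_bounded u -> has_sum u (csum u).
Proof.
move=> [M [q [M0 q0 q1 h]]].
have cvgP (f : nat -> R) : (forall n, `|f n| <= M * q ^+ n) ->
    exists x : R, forall e, 0 < e -> exists N, forall n, (N <= n)%N ->
    `|\sum_(k < n) f k - x| < e.
  move=> fM.
  have cg : cvgn (series (geometric M q)).
    by apply: is_cvg_geometric_series; rewrite ger0_norm.
  have cn : cvgn [normed series f].
    apply: series_le_cvg cg => // n; first exact: normr_ge0.
    by rewrite /= mulr_ge0// exprn_ge0.
  have /cvg_ex[x /cvgrPdist_lt hx] := normed_cvg cn.
  exists x => e /hx[N _ hN]; exists N => n /hN.
  by rewrite distrC /series/= big_mkord.
have [|x hx] := cvgP (fun n => complex.Re (u n)).
  by move=> n; rewrite (le_trans (le_Re_normc _)).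
have [|y hy] := cvgP (fun n => complex.Im (u n)).
  by move=> n; rewrite (le_trans (le_Im_normc _)).
suff hl : has_sum u (x +i* y) by rewrite (has_sum_csum hl).
move=> e e0; have e2 : 0 < e / 2 by rewrite divr_gt0.
have [N hN] := hx _ e2; have [N' hN'] := hy _ e2.
exists (maxn N N') => n; rewrite geq_max => /andP[/hN h1 /hN' h2].
rewrite (le_lt_trans (le_normc_ReIm _))// (splitr e) ltrD// raddfB raddf_sum//.
Qed.

Lemma geometric_bounded_partial u n M q : 0 <= M -> 0 <= q -> q < 1 ->
  (forall n, nc (u n) <= M * q ^+ n) -> nc (\sum_(k < n) u k) <= M / (1 - q).
Proof.
move=> M0 q0 q1 h; rewrite (le_trans (le_normc_sum _ _ _))//.
rewrite (@le_trans _ _ (\sum_(k < n) M * q ^+ k))//; first exact: ler_sum.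
by rewrite -mulr_sumr ler_wpM2l// geometric_sum_le.
Qed.

Lemma csum_le u M q : 0 <= M -> 0 <= q -> q < 1 ->
  (forall n, nc (u n) <= M * q ^+ n) -> nc (csum u) <= M / (1 - q).
Proof.
move=> M0 q0 q1 h; apply: (@has_sum_bound u).
  by apply: geometric_bounded_sum; exists M, q.
by move=> n; exact: geometric_bounded_partial.
Qed.

End Sums.

(** * Power series on the disc *)

Section PowerSeries.
Variable R : realType.
Local Notation C := R[i].
Local Notation nc := (@normc R).
Implicit Types (a b : nat -> C) (z w : C).

(** The coefficient sequences of the power series that converge in the open
    unit disc. *)
Definition disc_coef a := forall r : R, 0 < r -> r < 1 ->
  exists2 M : R, 0 <= M & forall n, nc (a n) * r ^+ n <= M.

Definition psum a z : C := csum (fun n => a n * z ^+ n).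

Lemma disc_coef_bound a (r : R) : disc_coef a -> 0 < r -> r < 1 ->
  exists2 M : R, 0 <= M & forall n, nc (a n) <= M * r^-1 ^+ n.
Proof.
move=> ha r0 r1; have [M M0 h] := ha r r0 r1; exists M => // n.
by rewrite exprVn ler_pdivlMr// exprn_gt0.
Qed.

Lemma disc_coef_geometric a (r : R) : disc_coef a -> 0 <= r -> r < 1 ->
  exists (M q : R), [/\ 0 <= M, 0 <= q, q < 1 &
    forall n z, nc z <= r -> nc (a n * z ^+ n) <= M * q ^+ n].
Proof.
move=> ha r0 r1; pose s := (1 + r) / 2.
have rs : r < s by rewrite /s ltr_pdivlMr// mulr_natr mulr2n; lra.
have s1 : s < 1 by rewrite /s ltr_pdivrMr// mul1r; lra.
have s0 : 0 < s by exact: le_lt_trans rs.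
have [M M0 h] := disc_coef_bound ha s0 s1.
exists M, (r / s); split => //.
- by rewrite divr_ge0// ltW.
- by rewrite ltr_pdivrMr// mul1r.
move=> n z zr; rewrite normcM normcX exprMn mulrA [leRHS]mulrAC.
by rewrite ler_pM ?exprn_ge0 ?normc_ge0// lerXn2r ?nnegrE ?normc_ge0.
Qed.

Lemma disc_coef_bounded a z : disc_coef a -> nc z < 1 ->
  geometric_bounded (fun n => a n * z ^+ n).
Proof.
move=> ha z1; have [M [q [M0 q0 q1 h]]] := disc_coef_geometric ha (normc_ge0 z) z1.
by exists M, q; split => // n; exact: h.
Qed.

Lemma psumP a z : disc_coef a -> nc z < 1 ->
  has_sum (fun n => a n * z ^+ n) (psum a z).
Proof. by move=> ha z1; apply: geometric_bounded_sum; exact: disc_coef_bounded. Qed.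

Lemma psumD a b z : disc_coef a -> disc_coef b -> nc z < 1 ->
  psum (fun n => a n + b n) z = psum a z + psum b z.
Proof.
move=> ha hb z1; apply: has_sum_csum.
apply: eq_has_sum (has_sumD (psumP ha z1) (psumP hb z1)) => n.
by rewrite mulrDl.
Qed.

Lemma psumZ c a z : disc_coef a -> nc z < 1 ->
  psum (fun n => c * a n) z = c * psum a z.
Proof.
move=> ha z1; apply: has_sum_csum.
by apply: eq_has_sum (has_sumZ c (psumP ha z1)) => n; rewrite mulrA.
Qed.

Lemma disc_coefD a b : disc_coef a -> disc_coef b ->
  disc_coef (fun n => a n + b n).
Proof.
move=> ha hb r r0 r1; have [M M0 h] := ha r r0 r1; have [N N0 k] := hb r r0 r1.
exists (M + N) => [|n]; first exact: addr_ge0.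
rewrite (le_trans _ (lerD (h n) (k n)))// -mulrDl ler_wpM2r ?le_normcD//.
by rewrite exprn_ge0// ltW.
Qed.

Lemma disc_coefZ c a : disc_coef a -> disc_coef (fun n => c * a n).
Proof.
move=> ha r r0 r1; have [M M0 h] := ha r r0 r1.
exists (nc c * M) => [|n]; first by rewrite mulr_ge0 ?normc_ge0.
by rewrite normcM -mulrA ler_wpM2l ?normc_ge0.
Qed.

Lemma disc_coefB a b : disc_coef a -> disc_coef b ->
  disc_coef (fun n => a n - b n).
Proof.
move=> ha hb; have := disc_coefD ha (disc_coefZ (-1) hb); congr disc_coef.
by apply/funext => n; rewrite mulN1r.
Qed.

Lemma psumB a b z : disc_coef a -> disc_coef b -> nc z < 1 ->
  psum (fun n => a n - b n) z = psum a z - psum b z.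
Proof.
move=> ha hb z1; rewrite -mulN1r -psumZ// -psumD//; last exact: disc_coefZ.
by congr psum; apply/funext => n; rewrite mulN1r.
Qed.

Lemma disc_coef_shift a : disc_coef a -> disc_coef (fun n => a n.+1).
Proof.
move=> ha r r0 r1; have [M M0 h] := ha r r0 r1.
exists (M / r) => [|n]; first by rewrite divr_ge0// ltW.
by rewrite ler_pdivlMr// -mulrA -exprSr.
Qed.

Lemma psum_shift a z : disc_coef a -> nc z < 1 ->
  psum a z = a 0%N + z * psum (fun n => a n.+1) z.
Proof.
move=> ha z1; apply: has_sum_csum; rewrite -[a 0%N]mulr1 -(expr0 z).
apply: (@has_sumS _ (fun n => a n * z ^+ n)).
apply: eq_has_sum (has_sumZ z (psumP (disc_coef_shift ha) z1)) => n.
by rewrite exprS mulrCA.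
Qed.

Lemma psum0 a : disc_coef a -> psum a 0 = a 0%N.
Proof. by move=> ha; rewrite psum_shift ?normc0// mul0r addr0. Qed.

(** Each of the [n.+1] first terms of the geometric series is at least [q ^+ n]. *)
Lemma natr_geometric_le (q : R) n : 0 <= q -> q < 1 ->
  n.+1%:R * q ^+ n <= (1 - q)^-1.
Proof.
move=> q0 q1; rewrite (le_trans _ (geometric_sum_le n.+1 q0 q1))//.
rewrite -[n.+1 in leLHS]card_ord -sumr_const mulr_suml ler_sum// => k _.
by rewrite mul1r ler_wiXn2l// ?ltW// -ltnS.
Qed.

Lemma disc_coef_natr a : disc_coef a -> disc_coef (fun n => n.+1%:R * a n).
Proof.
move=> ha r r0 r1; pose s := (1 + r) / 2.
have rs : r < s by rewrite /s ltr_pdivlMr// mulr_natr mulr2n; lra.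
have s1 : s < 1 by rewrite /s ltr_pdivrMr// mul1r; lra.
have s0 : 0 < s by exact: lt_trans rs.
have [M M0 h] := ha s s0 s1.
have q0 : 0 <= r / s by rewrite divr_ge0// ltW.
have q1 : r / s < 1 by rewrite ltr_pdivrMr// mul1r.
have q2 : 0 <= (1 - r / s)^-1 by rewrite invr_ge0 subr_ge0 ltW.
exists ((1 - r / s)^-1 * M) => [|n]; first by rewrite mulr_ge0.
have -> : nc (n.+1%:R * a n) * r ^+ n =
    (n.+1%:R * (r / s) ^+ n) * (nc (a n) * s ^+ n).
  rewrite normcM -[n.+1%:R in LHS](rmorph_nat (real_complex R)) normcR_ge0//.
  by rewrite expr_div_n; field; rewrite expf_neq0// gt_eqF.
apply: ler_pM => //; last exact: natr_geometric_le.
- by rewrite mulr_ge0// exprn_ge0.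
- by rewrite mulr_ge0 ?normc_ge0// exprn_ge0// ltW.
Qed.

Definition deriv_coef a n : C := n.+1%:R * a n.+1.

Lemma disc_coef_deriv a : disc_coef a -> disc_coef (deriv_coef a).
Proof.
move=> /disc_coef_shift/disc_coef_natr; congr disc_coef.
Qed.

(** Second-order Taylor remainder of the monomials, in a form that is uniform
    on the disc of radius [r] and whose coefficients are still summable. *)
Lemma monomial_remainder (r : R) z w n : 0 <= r -> nc z <= r -> nc w <= r ->
  r ^+ 2 * nc (w ^+ n - z ^+ n - n%:R * z ^+ n.-1 * (w - z)) <=
  n.+1%:R ^+ 2 * r ^+ n * nc (w - z) ^+ 2.
Proof.
move=> r0 zr wr; elim: n => [|n ih].
  rewrite !expr0 subrr !mul0r subr0 normc0 mulr0.
  by rewrite expr1n !mul1r sqr_ge0.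
set D := _ - _ - _ in ih.
have -> : w ^+ n.+1 - z ^+ n.+1 - n.+1%:R * z ^+ n.+1.-1 * (w - z) =
    w * D + n%:R * z ^+ n.-1 * (w - z) ^+ 2.
  rewrite /D; case: n {ih D} => [|n]; first by rewrite !expr0 /=; ring.
  by rewrite -!pred_Sn !exprS [n.+2%:R]mulrS; ring.
have bD : r ^+ 2 * nc (w * D) <= r * (n.+1%:R ^+ 2 * r ^+ n * nc (w - z) ^+ 2).
  rewrite normcM mulrCA; apply: ler_pM => //; first exact: normc_ge0.
  by rewrite mulr_ge0 ?normc_ge0// exprn_ge0.
have bE : r ^+ 2 * nc (n%:R * z ^+ n.-1 * (w - z) ^+ 2) <=
    n%:R * r ^+ n.+1 * nc (w - z) ^+ 2.
  case: n {ih D bD} => [|n].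
    by rewrite !mul0r normc0 mulr0.
  rewrite !normcM !normcX -[_%:R in leLHS](rmorph_nat (real_complex R)).
  rewrite normcR_ge0// -pred_Sn [r ^+ n.+2](_ : _ = r ^+ 2 * r ^+ n); last first.
    by rewrite -exprD.
  rewrite !mulrA ler_wpM2r ?exprn_ge0 ?normc_ge0//.
  rewrite ler_wpM2r ?normc_ge0// -!mulrA.
  rewrite [leRHS]mulrC [n.+1%:R * _]mulrC -!mulrA !ler_wpM2l//.
  by rewrite ler_wpM2r// lerXn2r ?nnegrE ?normc_ge0.
rewrite (le_trans (ler_wpM2l (exprn_ge0 2 r0) (le_normcD _ _)))// mulrDr.
rewrite (le_trans (lerD bD bE))//.
have -> : r * (n.+1%:R ^+ 2 * r ^+ n * nc (w - z) ^+ 2) +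
    n%:R * r ^+ n.+1 * nc (w - z) ^+ 2 =
    (n.+1%:R ^+ 2 + n%:R) * (r ^+ n.+1 * nc (w - z) ^+ 2).
  by rewrite [r ^+ n.+1]exprS; ring.
rewrite -[leRHS]mulrA ler_wpM2r//.
  by rewrite mulr_ge0 ?sqr_ge0// exprn_ge0.
have := ler0n R n; rewrite -[n.+2%:R]natr1 -[n.+1%:R]natr1; nra.
Qed.

Lemma psum_deriv a z : disc_coef a -> nc z < 1 -> cder (psum a) z (psum (deriv_coef a) z).
Proof.
move=> ha z1; pose r := (1 + nc z) / 2.
have zr : nc z < r by rewrite /r ltr_pdivlMr// mulr_natr mulr2n; lra.
have r1 : r < 1 by rewrite /r ltr_pdivrMr// mul1r; lra.
have r0 : 0 < r by apply: le_lt_trans zr; exact: normc_ge0.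
have da := disc_coef_deriv ha.
have hc : has_sum (fun n => n%:R * a n * z ^+ n.-1) (psum (deriv_coef a) z).
  rewrite -[psum _ _]add0r.
  rewrite (_ : 0 = 0%:R * a 0%N * z ^+ 0.-1); last by rewrite !mul0r.
  by apply: (@has_sumS _ (fun n => n%:R * a n * z ^+ n.-1)); exact: psumP.
have [M [q [M0 q0 q1 hM]]] :=
  disc_coef_geometric (disc_coef_natr (disc_coef_natr ha)) (ltW r0) r1.
pose K := (M / r ^+ 2) / (1 - q).
have K0 : 0 <= K by rewrite !divr_ge0// ?sqr_ge0// subr_ge0 ltW.
have main w : nc w <= r ->
    nc (psum a w - psum a z - psum (deriv_coef a) z * (w - z)) <=
    K * nc (w - z) ^+ 2.
  move=> wr; have w1 : nc w < 1 by exact: le_lt_trans r1.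
  pose u n := a n * w ^+ n - a n * z ^+ n - (w - z) * (n%:R * a n * z ^+ n.-1).
  have hu : has_sum u (psum a w - psum a z - psum (deriv_coef a) z * (w - z)).
    rewrite [_ * (w - z)]mulrC.
    by apply: has_sumB; [apply: has_sumB; exact: psumP|exact: has_sumZ].
  have ub n : nc (u n) <= (M / r ^+ 2 * nc (w - z) ^+ 2) * q ^+ n.
    have -> : u n = a n * (w ^+ n - z ^+ n - n%:R * z ^+ n.-1 * (w - z)).
      by rewrite /u; ring.
    have := hM n r%:C; rewrite (normcR_ge0 (ltW r0)) => /(_ (lexx _)) h.
    have := monomial_remainder n (ltW r0) (ltW zr) wr => /(ler_wpM2l (normc_ge0 (a n))).
    rewrite [X in X <= _]mulrCA -normcM.
    rewrite -ler_pdivlMl ?exprn_gt0// => hD; apply: (le_trans hD).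
    move: h; rewrite !normcM normcX (normcR_ge0 (ltW r0)).
    rewrite -(rmorph_nat (real_complex R)) normcR_ge0// => h.
    have -> : (r ^+ 2)^-1 * (nc (a n) * (n.+1%:R ^+ 2 * r ^+ n * nc (w - z) ^+ 2))
      = (n.+1%:R * (n.+1%:R * nc (a n)) * r ^+ n) * ((r ^+ 2)^-1 * nc (w - z) ^+ 2).
      by ring.
    rewrite (le_trans (ler_wpM2r _ h))//; last by rewrite le_eqVlt; apply/orP; left; apply/eqP; ring.
    by rewrite mulr_ge0 ?invr_ge0 ?sqr_ge0.
  rewrite -(has_sum_csum hu) (le_trans (csum_le _ q0 q1 ub))//.
    by rewrite mulr_ge0 ?divr_ge0 ?sqr_ge0.
  by rewrite /K mulrAC.
apply/cder_difference_quotient => e e0.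
exists (Num.min (r - nc z) (e / (K + 1))) => [|w].
  by rewrite lt_min subr_gt0 zr/= divr_gt0// ltr_wpDl.
rewrite eqxx lt_min => /andP[wz we]; case: eqVneq => [_|neq].
  by rewrite subrr normc0.
have neq0 : w - z != 0 by rewrite subr_eq0.
have wr : nc w <= r.
  rewrite -[w](subrK z) (le_trans (le_normcD _ _))//.
  by rewrite -lerBrDr ltW.
have n0 : 0 < nc (w - z) by rewrite normc_gt0.
have -> : (psum a w - psum a z) / (w - z) - psum (deriv_coef a) z =
    (psum a w - psum a z - psum (deriv_coef a) z * (w - z)) / (w - z).
  by rewrite [RHS]mulrBl mulfK.
rewrite normcM normcV ltr_pdivrMr// (le_lt_trans (main w wr))//.
rewrite expr2 mulrA ltr_pM2r// (le_lt_trans (y := (K + 1) * nc (w - z)))//.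
  by rewrite ler_wpM2r ?normc_ge0// lerDl.
by rewrite mulrC -ltr_pdivlMr// ltr_wpDl.
Qed.

(** Identity theorem at the origin: once the first [n] coefficients are known to
    vanish, the next one is the limit at the origin of a function that is zero
    off the origin. *)
Lemma psum_inj a b : disc_coef a -> disc_coef b ->
  (forall z, nc z < 1 -> psum a z = psum b z) -> a = b.
Proof.
move=> ha hb ab; pose d n := a n - b n.
have hd : disc_coef d by exact: disc_coefB.
have dz z : nc z < 1 -> psum d z = 0.
  by move=> z1; rewrite psumB// ab// subrr.
suff d0 n : d n = 0 by apply/funext => n; apply/eqP; rewrite -subr_eq0 -/(d n) d0.
have : disc_coef (fun k => d (n + k)%N) /\
    forall z, nc z < 1 -> psum (fun k => d (n + k)%N) z = 0.
  elim: n => [//|n [hn ih]].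
  have hS := disc_coef_shift hn.
  have E : (fun k => d (n.+1 + k)%N) = (fun k => d (n + k.+1)%N).
    by apply/funext => k; rewrite addSnnS.
  rewrite E; split=> // z z1.
  have dn : d (n + 0)%N = 0 by rewrite -(psum0 hn) ih// normc0.
  have nz y : y != 0 -> nc y < 1 -> psum (fun k => d (n + k.+1)%N) y = 0.
    move=> y0 /[dup] y1 /ih; rewrite psum_shift// dn add0r => /eqP.
    by rewrite mulf_eq0 (negbTE y0) => /eqP.
  have [->|z0] := eqVneq z 0; last exact: nz.
  apply/eqP; rewrite -normc_eq0; apply/negP => /negP p0.
  have p00 : 0 < nc (psum (fun k => d (n + k.+1)%N) 0).
    by rewrite lt_neqAle eq_sym p0 normc_ge0.
  have cc := cder_continuous (psum_deriv hS (z := 0) _).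
  have [|e e0 he] := cc _ _ p00; first by rewrite normc0.
  pose y := Num.min e 1 / 2.
  have m0 : 0 < Num.min e 1 by rewrite lt_min e0 ltr01.
  have y0 : 0 < y by rewrite divr_gt0.
  have yd : y < Num.min e 1 by rewrite ltr_pdivrMr// mulr_natr mulr2n ltrDl.
  have := he y%:C; rewrite subr0 normcR_ge0 ?ltW//.
  rewrite (lt_le_trans yd) ?ge_min ?lexx// => /(_ isT).
  rewrite nz ?sub0r ?normcN ?ltxx//.
    by rewrite -[0]/(0%:C) (inj_eq (@complexI R)) gt_eqF.
  by rewrite normcR_ge0 ?ltW// (lt_le_trans yd)// ge_min lexx orbT.
by move=> [hn /(_ 0)]; rewrite psum0// addn0; apply; rewrite normc0.
Qed.

End PowerSeries.

(** * Complex-valued integrals *)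

Section ComplexIntegral.
Variable R : realType.
Local Notation C := R[i].
Local Notation nc := (@normc R).
Context d (T : measurableType d) (mu : {measure set T -> \bar R}) (D : set T).
Hypothesis mD : measurable D.
Implicit Types (U V : T -> C).

Definition cintegrable U :=
  mu.-integrable D (fun x => (complex.Re (U x))%:E) /\
  mu.-integrable D (fun x => (complex.Im (U x))%:E).

Definition cintegral U : C :=
  (\int[mu]_(x in D) complex.Re (U x)) +i* (\int[mu]_(x in D) complex.Im (U x)).

Lemma eq_cintegral U V : (forall x, D x -> U x = V x) -> cintegral U = cintegral V.
Proof.
move=> h; congr (_ +i* _); apply: eq_Rintegral => x /set_mem Dx; by rewrite h.
Qed.

Lemma eq_cintegrable U V : (forall x, D x -> U x = V x) ->
  cintegrable U -> cintegrable V.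
Proof.
move=> h [h1 h2]; split.
  by apply: eq_integrable h1 => // x /set_mem Dx; rewrite h.
by apply: eq_integrable h2 => // x /set_mem Dx; rewrite h.
Qed.

Lemma cintegrableD U V : cintegrable U -> cintegrable V ->
  cintegrable (fun x => U x + V x).
Proof.
move=> [u1 u2] [v1 v2]; split.
  under eq_fun do rewrite raddfD EFinD; exact: integrableD.
under eq_fun do rewrite raddfD EFinD; exact: integrableD.
Qed.

Lemma cintegralD U V : cintegrable U -> cintegrable V ->
  cintegral (fun x => U x + V x) = cintegral U + cintegral V.
Proof.
move=> [u1 u2] [v1 v2]; rewrite /cintegral.
under [X in X +i* _]eq_Rintegral do rewrite raddfD.
under [X in _ +i* X]eq_Rintegral do rewrite raddfD.
by rewrite !RintegralD.
Qed.

Lemma ReM (z w : C) : complex.Re (z * w) =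
  complex.Re z * complex.Re w + (- complex.Im z) * complex.Im w.
Proof. by case: z w => a b [c e] /=; rewrite mulNr. Qed.

Lemma ImM (z w : C) : complex.Im (z * w) =
  complex.Re z * complex.Im w + complex.Im z * complex.Re w.
Proof. by case: z w => a b [c e] /=. Qed.

Lemma integrable_scale (r : R) (f : T -> R) : mu.-integrable D (EFin \o f) ->
  mu.-integrable D (EFin \o (fun x => r * f x)).
Proof.
move=> h; rewrite (_ : _ \o _ = fun x => (r%:E * (EFin \o f) x)%E).
  exact: integrableZl.
by apply/funext => x /=; rewrite EFinM.
Qed.

Lemma integrable_add (f g : T -> R) : mu.-integrable D (EFin \o f) ->
  mu.-integrable D (EFin \o g) -> mu.-integrable D (EFin \o (fun x => f x + g x)).
Proof.
move=> hf hg; rewrite (_ : _ \o _ = (fun x => (EFin \o f) x + (EFin \o g) x)%E).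
  exact: integrableD.
by apply/funext => x /=; rewrite EFinD.
Qed.

Lemma cintegrableZ c U : cintegrable U -> cintegrable (fun x => c * U x).
Proof.
move=> [u1 u2]; split; [under eq_fun do rewrite ReM|under eq_fun do rewrite ImM].
  by apply: integrable_add; exact: integrable_scale.
by apply: integrable_add; exact: integrable_scale.
Qed.

Lemma cintegralZ c U : cintegrable U ->
  cintegral (fun x => c * U x) = c * cintegral U.
Proof.
move=> [u1 u2]; rewrite /cintegral.
under [X in X +i* _]eq_Rintegral do rewrite ReM.
under [X in _ +i* X]eq_Rintegral do rewrite ImM.
rewrite !RintegralD ?RintegralZl//; do ?exact: integrable_scale.
by case: c => a b /=; rewrite mulNr.
Qed.

Lemma cintegrableN U : cintegrable U -> cintegrable (fun x => - U x).
Proof.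
by move=> /(cintegrableZ (-1)); apply: eq_cintegrable => x _; rewrite mulN1r.
Qed.

Lemma cintegralB U V : cintegrable U -> cintegrable V ->
  cintegral (fun x => U x - V x) = cintegral U - cintegral V.
Proof.
move=> hU hV; rewrite -mulN1r -cintegralZ// -cintegralD//; last exact: cintegrableZ.
by apply: eq_cintegral => x _; rewrite mulN1r.
Qed.

Lemma cintegrableB U V : cintegrable U -> cintegrable V ->
  cintegrable (fun x => U x - V x).
Proof. by move=> hU hV; apply: cintegrableD => //; exact: cintegrableN. Qed.

Lemma cintegral_sum n (U : nat -> T -> C) : (forall k, cintegrable (U k)) ->
  cintegrable (fun x => \sum_(k < n) U k x) /\
  cintegral (fun x => \sum_(k < n) U k x) = \sum_(k < n) cintegral (U k).
Proof.
move=> h; elim: n => [|n [ih1 ih2]].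
  have E : (fun x => \sum_(k < 0) U k x) = (fun x => 0 * U 0%N x).
    by apply/funext => x; rewrite big_ord0 mul0r.
  rewrite E big_ord0; split; first exact: cintegrableZ.
  by rewrite cintegralZ// mul0r.
have E : (fun x => \sum_(k < n.+1) U k x) =
    (fun x => \sum_(k < n) U k x + U n x).
  by apply/funext => x; rewrite big_ord_recr.
by rewrite E big_ord_recr/= cintegralD// ih2; split => //; exact: cintegrableD.
Qed.

Hypothesis muD : (mu D < +oo)%E.

Lemma integrable_boundedR (f : T -> R) (M : R) : measurable_fun D f ->
  (forall x, D x -> `|f x| <= M) -> mu.-integrable D (EFin \o f).
Proof.
move=> mf fM; apply: measurable_bounded_integrable => //.
exists M; split; first exact: num_real.
by move=> r Mr x Dx /=; rewrite (le_trans (fM _ Dx))// ltW.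
Qed.

Lemma integrable_cstR (r : R) : mu.-integrable D (EFin \o (fun=> r)).
Proof. exact: (@integrable_boundedR _ `|r|). Qed.

Lemma cintegrable_cst c : cintegrable (fun=> c).
Proof. by split; exact: integrable_cstR. Qed.

Lemma cintegral_cst c : cintegral (fun=> c) = c * (fine (mu D))%:C.
Proof.
rewrite /cintegral !Rintegral_cst//; case: c => a b /=; simpc.
by [].
Qed.

(** The factor 2 comes from bounding the real and imaginary parts separately. *)
Lemma cintegral_le U (M : R) : cintegrable U -> (forall x, D x -> nc (U x) <= M) ->
  nc (cintegral U) <= 2 * M * fine (mu D).
Proof.
move=> [u1 u2] h; rewrite (le_trans (le_normc_ReIm _))//=.
have bnd (f : T -> R) : mu.-integrable D (EFin \o f) ->
    (forall x, D x -> `|f x| <= M) -> `|\int[mu]_(x in D) f x| <= M * fine (mu D).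
  move=> hf fM; rewrite (le_trans (le_normr_Rintegral _ hf))//.
  rewrite -Rintegral_cst//; apply: le_Rintegral => //.
    exact: (integrable_norm hf).
  exact: integrable_cstR.
rewrite -mulrA mulr_natl mulr2n lerD//; apply: bnd => // x Dx.
  by rewrite (le_trans (le_Re_normc _))// h.
by rewrite (le_trans (le_Im_normc _))// h.
Qed.

End ComplexIntegral.

Section IntervalIntegral.
Variable R : realType.
Local Notation C := R[i].
Local Notation nc := (@normc R).
Implicit Types (F G : R -> C) (a b c : R).

Definition rcont F (t : R) := forall e : R, 0 < e ->
  exists2 d : R, 0 < d & forall s, `|s - t| < d -> nc (F s - F t) < e.

Definition cint F a b : C := cintegral lebesgue_measure `[a, b] F.

Definition iintegrable a b F := cintegrable lebesgue_measure `[a, b] F.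

Lemma rcont_integrable F a b : (forall t, a <= t <= b -> rcont F t) ->
  iintegrable a b F.
Proof.
move=> h.
have aux (f : C -> R) : (forall z w, `|f z - f w| <= nc (z - w)) ->
    lebesgue_measure.-integrable `[a, b] (EFin \o (f \o F)).
  move=> hf; apply: continuous_compact_integrable; first exact: segment_compact.
  apply: continuous_in_subspaceT => t /set_mem; rewrite /= in_itv/= => tab.
  apply: (@cvgrPdist_lt _ _ _ _ _ _ _).2 => e e0.
  have [d d0 hd] := h t tab e e0.
  exists d => //= s; rewrite /ball/= distrC => /hd.
  by rewrite distrC; exact: le_lt_trans.
split.
  apply: (aux (@complex.Re R)) => z w.
  by rewrite -raddfB le_Re_normc.
apply: (aux (@complex.Im R)) => z w.
by rewrite -raddfB le_Im_normc.
Qed.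

Lemma measurable_itvcc a b : measurable (`[a, b] : set (measurableTypeR R)).
Proof. exact: measurable_itv. Qed.

Lemma itvcc_measure a b : a <= b ->
  @lebesgue_measure R `[a, b] = (b - a)%:E.
Proof.
rewrite le_eqVlt => /predU1P[->|ab]; rewrite lebesgue_measure_itv/= lte_fin.
  by rewrite ltxx subrr.
by rewrite ab EFinB.
Qed.

Lemma itvcc_finite a b : (@lebesgue_measure R `[a, b]%classic < +oo)%E.
Proof.
have [ab|ab] := leP a b; first by rewrite itvcc_measure// ltry.
by rewrite lebesgue_measure_itv/= lte_fin (lt_gtF ab) ltry.
Qed.

Lemma cint_cst z a b : a <= b -> cint (fun=> z) a b = z * (b - a)%:C.
Proof.
move=> ab; rewrite /cint cintegral_cst//.
have -> : fine (lebesgue_measure `[a, b]%classic) = b - a => //.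
exact: (congr1 fine (itvcc_measure ab)).
Qed.

Lemma cint_le F a b (M : R) : a <= b -> iintegrable a b F ->
  (forall t, a <= t <= b -> nc (F t) <= M) -> nc (cint F a b) <= 2 * M * (b - a).
Proof.
move=> ab hF hM; rewrite /cint; have := cintegral_le (measurable_itvcc a b) (itvcc_finite a b) hF.
have -> : fine (lebesgue_measure `[a, b]%classic) = b - a.
  exact: (congr1 fine (itvcc_measure ab)).
by apply => t /=; rewrite in_itv/=; exact: hM.
Qed.

Lemma cintB F G a b : iintegrable a b F -> iintegrable a b G ->
  cint (fun t => F t - G t) a b = cint F a b - cint G a b.
Proof. by move=> hF hG; exact: cintegralB. Qed.

Lemma cint_split F a b c : a <= c -> c <= b -> iintegrable a b F ->
  cint F a b = cint F a c + cint F c b.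
Proof.
move=> ac cb [h1 h2].
have aux (f : R -> R) : lebesgue_measure.-integrable `[a, b] (EFin \o f) ->
    \int[lebesgue_measure]_(x in `[a, b]) f x =
    \int[lebesgue_measure]_(x in `[a, c]) f x +
    \int[lebesgue_measure]_(x in `[c, b]) f x.
  move=> hf; have := @Rintegral_itvB R f (BLeft a) (BRight b) c hf.
  rewrite !bnd_simp => /(_ ac cb) /eqP; rewrite subr_eq addrC => /eqP ->.
  rewrite Rintegral_itv_obnd_cbnd//; apply: integrableS hf => //.
  by apply: subset_itvr; rewrite bnd_simp.
by rewrite /cint /cintegral !aux.
Qed.

End IntervalIntegral.

(** * Boundary integrals of rectangles *)

Section Rectangle.
Variable R : realType.
Local Notation C := R[i].
Local Notation nc := (@normc R).
Implicit Types (F : C -> C) (x y a b : R).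

Lemma rcont_hline F x y : ccont F (x +i* y) -> rcont (fun u => F (u +i* y)) x.
Proof.
move=> h e /h[d d0 hd]; exists d => // s sx; apply: hd.
have -> : s +i* y - x +i* y = (s - x)%:C by apply/eqP; rewrite eq_complex /=; apply/andP; split; apply/eqP; ring.
by rewrite normc_real.
Qed.

Lemma rcont_vline F x y : ccont F (x +i* y) -> rcont (fun v => F (x +i* v)) y.
Proof.
move=> h e /h[d d0 hd]; exists d => // s sx; apply: hd.
have -> : x +i* s - x +i* y = 'i * (s - y)%:C by apply/eqP; rewrite eq_complex /=; apply/andP; split; apply/eqP; ring.
by rewrite normcM normc_i mul1r normc_real.
Qed.

(** The integral of [F] along the boundary of the rectangle with lower left
    corner [x + iy] and sides [a], [b], opposite sides being paired. *)
Definition rect F x y a b : C :=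
  cint (fun u => F (u +i* y) - F (u +i* (y + b))) x (x + a) +
  'i * cint (fun v => F ((x + a) +i* v) - F (x +i* v)) y (y + b).

Definition cont_rect F x y a b := forall u v,
  x <= u <= x + a -> y <= v <= y + b -> ccont F (u +i* v).

Lemma iintegrable_hline F x y a b v : cont_rect F x y a b -> y <= v <= y + b ->
  iintegrable x (x + a) (fun u => F (u +i* v)).
Proof.
by move=> h hv; apply: rcont_integrable => u hu; apply: rcont_hline; exact: h.
Qed.

Lemma iintegrable_vline F x y a b u : cont_rect F x y a b -> x <= u <= x + a ->
  iintegrable y (y + b) (fun v => F (u +i* v)).
Proof.
by move=> h hu; apply: rcont_integrable => v hv; apply: rcont_vline; exact: h.
Qed.

Lemma cont_rect_sub F x y a b x' y' a' b' : x <= x' -> x' + a' <= x + a ->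
  y <= y' -> y' + b' <= y + b -> cont_rect F x y a b -> cont_rect F x' y' a' b'.
Proof.
move=> h1 h2 h3 h4 h u v /andP[u1 u2] /andP[v1 v2]; apply: h.
  by rewrite (le_trans h1)// (le_trans u2).
by rewrite (le_trans h3)// (le_trans v2).
Qed.

Lemma rect_hsplit F x y a1 a2 b : 0 <= a1 -> 0 <= a2 -> 0 <= b ->
  cont_rect F x y (a1 + a2) b ->
  rect F x y (a1 + a2) b = rect F x y a1 b + rect F (x + a1) y a2 b.
Proof.
move=> a10 a20 b0 h.
have yb : y <= y + b by rewrite lerDl.
have hh v : y <= v <= y + b -> iintegrable x (x + (a1 + a2)) (fun u => F (u +i* v)).
  by move=> hv; exact: (iintegrable_hline h).
have hv u : x <= u <= x + (a1 + a2) -> iintegrable y (y + b) (fun v => F (u +i* v)).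
  by move=> hu; exact: (iintegrable_vline h).
rewrite /rect (@cint_split _ _ _ _ (x + a1)) ?lerD2l ?lerDl//; last first.
  by apply: cintegrableB => //; apply: hh; rewrite ?lexx yb.
have -> : cint (fun v => F ((x + (a1 + a2)) +i* v) - F (x +i* v)) y (y + b) =
  cint (fun v => F ((x + a1) +i* v) - F (x +i* v)) y (y + b) +
  cint (fun v => F ((x + a1 + a2) +i* v) - F ((x + a1) +i* v)) y (y + b).
  rewrite /cint -cintegralD//; first last.
  - apply: cintegrableB => //; apply: hv.
      by rewrite addrA lexx -addrA lerDl addr_ge0.
    by rewrite lerDl a10 lerD2l lerDl.
  - apply: cintegrableB => //; apply: hv.
      by rewrite lerDl a10 lerD2l lerDl.
    by rewrite lexx lerDl addr_ge0.
  by apply: eq_cintegral => v _; rewrite [x + (a1 + a2)]addrA; ring.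
rewrite ![x + (a1 + a2)]addrA; ring.
Qed.

Lemma rect_vsplit F x y a b1 b2 : 0 <= a -> 0 <= b1 -> 0 <= b2 ->
  cont_rect F x y a (b1 + b2) ->
  rect F x y a (b1 + b2) = rect F x y a b1 + rect F x (y + b1) a b2.
Proof.
move=> a0 b10 b20 h.
have xa : x <= x + a by rewrite lerDl.
have hh v : y <= v <= y + (b1 + b2) -> iintegrable x (x + a) (fun u => F (u +i* v)).
  by move=> hv; exact: (iintegrable_hline h).
have hv u : x <= u <= x + a -> iintegrable y (y + (b1 + b2)) (fun v => F (u +i* v)).
  by move=> hu; exact: (iintegrable_vline h).
rewrite /rect [in X in _ + 'i * X = _](@cint_split _ _ _ _ (y + b1)) ?lerD2l ?lerDl//; last first.
  by apply: cintegrableB => //; apply: hv; rewrite ?lexx xa.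
have -> : cint (fun u => F (u +i* y) - F (u +i* (y + (b1 + b2)))) x (x + a) =
  cint (fun u => F (u +i* y) - F (u +i* (y + b1))) x (x + a) +
  cint (fun u => F (u +i* (y + b1)) - F (u +i* (y + b1 + b2))) x (x + a).
  rewrite /cint -cintegralD//; first last.
  - apply: cintegrableB => //; apply: hh.
      by rewrite lerDl b10 lerD2l lerDl.
    by rewrite addrA lexx -addrA lerDl addr_ge0.
  - apply: cintegrableB => //; apply: hh.
      by rewrite lexx lerDl addr_ge0.
    by rewrite lerDl b10 lerD2l lerDl.
  by apply: eq_cintegral => v _; rewrite [y + (b1 + b2)]addrA; ring.
rewrite ![y + (b1 + b2)]addrA; ring.
Qed.

(** An affine function contributes nothing, so only the distance of [F] to
    such a function matters. *)
Lemma rect_affine_le F x y a b (A B z : C) (M : R) : 0 <= a -> 0 <= b -> 0 <= M ->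
  cont_rect F x y a b ->
  (forall u v, x <= u <= x + a -> y <= v <= y + b ->
     nc (F (u +i* v) - A - B * (u +i* v - z)) <= M) ->
  nc (rect F x y a b) <= 4 * M * (a + b).
Proof.
move=> a0 b0 M0 h hM.
have xa : x <= x + a by rewrite lerDl.
have yb : y <= y + b by rewrite lerDl.
pose E w := F w - A - B * (w - z).
have hh v : y <= v <= y + b -> iintegrable x (x + a) (fun u => F (u +i* v)).
  by move=> hv; exact: (iintegrable_hline h).
have hv u : x <= u <= x + a -> iintegrable y (y + b) (fun v => F (u +i* v)).
  by move=> hu; exact: (iintegrable_vline h).
pose k1 := - (B * 'i * b%:C); pose k2 := B * a%:C.
have e1 u : E (u +i* y) - E (u +i* (y + b)) =
    (F (u +i* y) - F (u +i* (y + b))) - k1.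
  have -> : u +i* (y + b) = u +i* y + 'i * b%:C by apply/eqP; rewrite eq_complex /=; apply/andP; split; apply/eqP; ring.
  by rewrite /E /k1; ring.
have e2 v : E ((x + a) +i* v) - E (x +i* v) =
    (F ((x + a) +i* v) - F (x +i* v)) - k2.
  have -> : (x + a) +i* v = x +i* v + a%:C by apply/eqP; rewrite eq_complex /=; apply/andP; split; apply/eqP; ring.
  by rewrite /E /k2; ring.
have i1 : iintegrable x (x + a) (fun u => F (u +i* y) - F (u +i* (y + b))).
  by apply: cintegrableB => //; apply: hh; rewrite ?lexx yb.
have i2 : iintegrable y (y + b) (fun v => F ((x + a) +i* v) - F (x +i* v)).
  by apply: cintegrableB => //; apply: hv; rewrite ?lexx xa.
have c1 (z' : C) (c d : R) : iintegrable c d (fun=> z').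
  by apply: cintegrable_cst => //; exact: itvcc_finite.
have E1 : (fun u => E (u +i* y) - E (u +i* (y + b))) =
    (fun u => (F (u +i* y) - F (u +i* (y + b))) - k1) by apply/funext.
have E2 : (fun v => E ((x + a) +i* v) - E (x +i* v)) =
    (fun v => (F ((x + a) +i* v) - F (x +i* v)) - k2) by apply/funext.
have -> : rect F x y a b = rect E x y a b.
  rewrite [in RHS]/rect E1 E2 (cintB i1 (c1 _ _ _)) (cintB i2 (c1 _ _ _)).
  rewrite !cint_cst// /rect.
  by rewrite ![_ + _ - _]addrAC subrr !add0r /k1 /k2; ring.
have j1 : iintegrable x (x + a) (fun u => E (u +i* y) - E (u +i* (y + b))).
  by rewrite E1; apply: cintegrableB => //; exact: c1.
have j2 : iintegrable y (y + b) (fun v => E ((x + a) +i* v) - E (x +i* v)).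
  by rewrite E2; apply: cintegrableB => //; exact: c1.
rewrite /rect (le_trans (le_normcD _ _))// normcM normc_i mul1r.
have -> : 4 * M * (a + b) =
    2 * (M + M) * (x + a - x) + 2 * (M + M) * (y + b - y) by ring.
rewrite lerD//; apply: cint_le => // t ht.
  rewrite (le_trans (le_normcB _ _))// lerD//; apply: hM => //.
    by rewrite lexx yb.
  by rewrite lexx yb.
rewrite (le_trans (le_normcB _ _))// lerD//; apply: hM => //.
  by rewrite lexx xa.
by rewrite lexx xa.
Qed.

End Rectangle.

(** * Goursat's theorem *)

Section Goursat.
Variable R : realType.
Local Notation C := R[i].
Local Notation nc := (@normc R).
Implicit Types (F : C -> C) (x y a b t : R).

Lemma cder_approx F (z l : C) (e : R) : cder F z l -> 0 < e ->
  exists2 d : R, 0 < d &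
    forall w, nc (w - z) < d -> nc (F w - F z - l * (w - z)) <= e * nc (w - z).
Proof.
move=> /cder_difference_quotient h e0; have [d d0 hd] := h e e0.
exists d => // w /hd; rewrite eqxx; case: eqVneq => [->|wz].
  by rewrite !subrr mulr0 subrr normc0 mulr0.
have wz0 : w - z != 0 by rewrite subr_eq0.
move=> /ltW; rewrite -(ler_pM2r (x := nc (w - z))) ?normc_gt0//.
by rewrite -normcM mulrBl divfK.
Qed.

Definition signed_sqrt t : R := if 0 <= t then Num.sqrt t else - Num.sqrt (- t).

Lemma signed_sqrt_mono : {homo signed_sqrt : s t / s <= t}.
Proof.
move=> s t st; rewrite /signed_sqrt; case: ifPn => s0.
  by rewrite (le_trans s0 st) ler_wsqrtr.
case: ifPn => t0; first by rewrite (@le_trans _ _ 0)// ?oppr_le0 ?sqrtr_ge0.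
by rewrite lerN2 ler_wsqrtr// lerN2.
Qed.

(** Additive in the interval, yet of the order of the square root of its length
    once the interval contains [e]. *)
Lemma signed_sqrt_gap e x a : x <= e -> e <= x + a ->
  Num.sqrt a <= signed_sqrt (x + a - e) - signed_sqrt (x - e).
Proof.
move=> xe ea; have ea' : 0 <= x + a - e by rewrite subr_ge0.
have -> : signed_sqrt (x - e) = - Num.sqrt (e - x).
  rewrite /signed_sqrt; case: ifPn => h; last by rewrite opprB.
  have -> : x = e by apply/eqP; rewrite eq_le xe -subr_ge0.
  by rewrite subrr sqrtr0 oppr0.
rewrite /signed_sqrt ea' opprK.
have ex : 0 <= e - x by rewrite subr_ge0.
rewrite -(@ler_pXn2r _ 2)// ?nnegrE ?addr_ge0 ?sqrtr_ge0// sqrrD.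
have a0 : 0 <= a by rewrite -(lerDl x) (le_trans xe).
rewrite !sqr_sqrtr//.
have := sqrtr_ge0 (x + a - e); have := sqrtr_ge0 (e - x); nra.
Qed.

(** Near an exceptional point only the continuity of [F] is available, which
    bounds the boundary integral over a small rectangle by a small multiple of
    its side, not of its area.  This additive function of rectangles is of the
    order of the side when the rectangle contains [e]. *)
Definition point_weight (e : R * R) x y a b : R :=
  (signed_sqrt (x + a - e.1) - signed_sqrt (x - e.1)) *
  (signed_sqrt (y + b - e.2) - signed_sqrt (y - e.2)).

Definition weight (E : seq (R * R)) x y a b : R :=
  a * b + \sum_(e <- E) point_weight e x y a b.

Lemma point_weight_ge0 e x y a b : 0 <= a -> 0 <= b -> 0 <= point_weight e x y a b.
Proof.
move=> a0 b0; apply: mulr_ge0; rewrite subr_ge0 signed_sqrt_mono//.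
  by rewrite lerB// lerDl.
by rewrite lerB// lerDl.
Qed.

Lemma weight_area E x y a b : 0 <= a -> 0 <= b -> a * b <= weight E x y a b.
Proof.
by move=> a0 b0; rewrite lerDl sumr_ge0// => e _; exact: point_weight_ge0.
Qed.

Lemma weight_point E e x y a b : 0 <= a -> 0 <= b -> e \in E ->
  x <= e.1 <= x + a -> y <= e.2 <= y + b ->
  Num.sqrt a * Num.sqrt b <= weight E x y a b.
Proof.
move=> a0 b0 eE /andP[x1 x2] /andP[y1 y2].
rewrite (@le_trans _ _ (point_weight e x y a b))//.
  by rewrite ler_pM ?sqrtr_ge0// signed_sqrt_gap.
rewrite (@le_trans _ _ (\sum_(e <- E) point_weight e x y a b))//; last first.
  by rewrite lerDr mulr_ge0.
rewrite (big_rem e)//= lerDl sumr_ge0// => e' _; exact: point_weight_ge0.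
Qed.

Lemma weight_quarter E x y a b : weight E x y (a + a) (b + b) =
  weight E x y a b + weight E (x + a) y a b +
  (weight E x (y + b) a b + weight E (x + a) (y + b) a b).
Proof.
rewrite /weight ![_ * _ + \sum_(_ <- _) _ + (_ + _)]addrACA -!big_split/=.
rewrite addrACA -big_split/=; congr (_ + _); first by ring.
by apply: eq_bigr => e _; rewrite /point_weight !addrA; ring.
Qed.

Lemma rect_quarter F x y a b : 0 <= a -> 0 <= b ->
  cont_rect F x y (a + a) (b + b) ->
  rect F x y (a + a) (b + b) =
  rect F x y a b + rect F (x + a) y a b +
  (rect F x (y + b) a b + rect F (x + a) (y + b) a b).
Proof.
move=> a0 b0 h; rewrite rect_hsplit ?addr_ge0// !rect_vsplit//; [by ring| |].
  by apply: cont_rect_sub h => //; rewrite ?lerDl// addrA.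
by apply: cont_rect_sub h => //; rewrite ?addrA ?lerDl.
Qed.

Section Bisection.
Variables (F : C -> C) (E : seq (R * R)) (x0 y0 a0 b0 eps : R).
Hypotheses (a0_gt0 : 0 < a0) (b0_gt0 : 0 < b0) (eps_gt0 : 0 < eps).
Hypothesis cF : cont_rect F x0 y0 a0 b0.
Hypothesis dF : forall u v, x0 <= u <= x0 + a0 -> y0 <= v <= y0 + b0 ->
  (u, v) \notin E -> exists l, cder F (u +i* v) l.

Let sa n := a0 / 2 ^+ n.
Let sb n := b0 / 2 ^+ n.
(* Integral and weight are both additive under quartering, so a bad rectangle
   has a bad quarter. *)
Let bad n (p : R * R) := eps * weight E p.1 p.2 (sa n) (sb n) <
  nc (rect F p.1 p.2 (sa n) (sb n)).
Let next n (p : R * R) :=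
  if bad n.+1 p then p else
  if bad n.+1 (p.1 + sa n.+1, p.2) then (p.1 + sa n.+1, p.2) else
  if bad n.+1 (p.1, p.2 + sb n.+1) then (p.1, p.2 + sb n.+1) else
  (p.1 + sa n.+1, p.2 + sb n.+1).
Fixpoint bisect n := if n is m.+1 then next m (bisect m) else (x0, y0).

Let pow2 n : 2 ^+ n != 0 :> R. Proof. by rewrite expf_neq0// pnatr_eq0. Qed.
Let saS n : sa n = sa n.+1 + sa n.+1.
Proof. by rewrite /sa exprS; field; rewrite pow2. Qed.
Let sbS n : sb n = sb n.+1 + sb n.+1.
Proof. by rewrite /sb exprS; field; rewrite pow2. Qed.
Let sa_gt0 n : 0 < sa n. Proof. by rewrite divr_gt0// exprn_gt0. Qed.
Let sb_gt0 n : 0 < sb n. Proof. by rewrite divr_gt0// exprn_gt0. Qed.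

Let next_le n p : [/\ p.1 <= (next n p).1, (next n p).1 + sa n.+1 <= p.1 + sa n,
  p.2 <= (next n p).2 & (next n p).2 + sb n.+1 <= p.2 + sb n].
Proof.
have := sa_gt0 n.+1; have := sb_gt0 n.+1; rewrite (saS n) (sbS n) /next => h1 h2.
by do 3 (case: ifP => _ /=; first by split; lra); split => /=; lra.
Qed.

Let next_bad n p : cont_rect F p.1 p.2 (sa n) (sb n) -> bad n p -> bad n.+1 (next n p).
Proof.
rewrite /next => cp bp; case: ifPn => // b1; case: ifPn => // b2.
case: ifPn => // b3; apply: contraTT bp => b4.
move: b1 b2 b3 b4; rewrite /bad -!leNgt/= => b1 b2 b3 b4.
rewrite (saS n) (sbS n) in cp *.
have a' := ltW (sa_gt0 n.+1); have b' := ltW (sb_gt0 n.+1).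
rewrite rect_quarter// weight_quarter !mulrDr.
by rewrite (le_trans (le_normcD _ _))// lerD//;
  rewrite (le_trans (le_normcD _ _))// lerD// -mulrDr.
Qed.

Let bisect_le n : [/\ x0 <= (bisect n).1, (bisect n).1 + sa n <= x0 + a0,
  y0 <= (bisect n).2 & (bisect n).2 + sb n <= y0 + b0].
Proof.
elim: n => [|n [h1 h2 h3 h4]]; first by rewrite /sa /sb expr0 !divr1.
have [k1 k2 k3 k4] := next_le n (bisect n); split => /=.
- exact: le_trans k1.
- exact: le_trans h2.
- exact: le_trans k3.
- exact: le_trans h4.
Qed.

Let bisect_cont n : cont_rect F (bisect n).1 (bisect n).2 (sa n) (sb n).
Proof. by have [h1 h2 h3 h4] := bisect_le n; exact: cont_rect_sub cF. Qed.

Let bisect_bad n : bad 0 (x0, y0) -> bad n (bisect n).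
Proof. by move=> h; elim: n => [//|n ih] /=; exact: next_bad. Qed.

Let nested n k : [/\ (bisect n).1 <= (bisect (n + k)).1,
  (bisect (n + k)).1 + sa (n + k) <= (bisect n).1 + sa n,
  (bisect n).2 <= (bisect (n + k)).2 &
  (bisect (n + k)).2 + sb (n + k) <= (bisect n).2 + sb n].
Proof.
elim: k => [|k [h1 h2 h3 h4]]; first by rewrite addn0.
rewrite addnS; have [k1 k2 k3 k4] := next_le (n + k) (bisect (n + k)).
split => /=.
- exact: le_trans k1.
- exact: le_trans h2.
- exact: le_trans k3.
- exact: le_trans h4.
Qed.

Let nested_point (f s : nat -> R) : (forall n, 0 < s n) ->
  (forall n k, f n <= f (n + k)%N /\ f (n + k)%N + s (n + k)%N <= f n + s n) ->
  exists t, forall n, f n <= t <= f n + s n.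
Proof.
move=> s0 h; have ub n m : f m <= f n + s n.
  have [nm|mn] := leqP n m.
    have [_] := h n (m - n)%N; rewrite subnKC// => h2.
    by rewrite (le_trans _ h2)// lerDl ltW.
  have [h1 _] := h m (n - m)%N; rewrite subnKC// in h1; last exact: ltnW.
  by rewrite (le_trans h1)// lerDl ltW.
exists (sup [set f n | n in setT]) => n; apply/andP; split.
  apply: ub_le_sup; last by exists n.
  by exists (f 0%N + s 0%N) => _ [m _ <-].
apply: ge_sup; first by exists (f 0%N); exists 0%N.
by move=> _ [m _ <-].
Qed.

Let small d : 0 < d -> exists n, sa n + sb n < d.
Proof.
move=> d0; have c0 : 0 < a0 + b0 by rewrite addr_gt0.
have h : `|(2^-1 : R)| < 1 by rewrite ger0_norm// invf_lt1// ltr1n.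
have /cvgrPdist_lt := @cvg_geometric R (a0 + b0) _ h.
move=> /(_ d d0)[n _ /(_ n (leqnn n))]; rewrite sub0r normrN /= => hn.
exists n; rewrite /sa /sb -mulrDl -exprVn (le_lt_trans _ hn)//.
exact: ler_norm.
Qed.

(** Repeated quartering yields bad rectangles shrinking to a point. If [F] is
    differentiable there, the boundary integral is small compared to the area; if
    the point is exceptional, continuity makes it small compared to the side.
    Either way the weight dominates. *)
Lemma bisection_bound :
  nc (rect F x0 y0 a0 b0) <= eps * weight E x0 y0 a0 b0.
Proof.
rewrite leNgt; apply/negP => h0.
have bad0 : bad 0 (x0, y0) by rewrite /bad /sa /sb expr0 !divr1.
(* The point common to all the rectangles. *)
have [xs hx] : exists t, forall n, (bisect n).1 <= t <= (bisect n).1 + sa n.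
  by apply: nested_point => // n k; have [] := nested n k.
have [ys hy] : exists t, forall n, (bisect n).2 <= t <= (bisect n).2 + sb n.
  by apply: nested_point => // n k; have [] := nested n k.
have xs0 : x0 <= xs <= x0 + a0.
  by have := hx 0%N; rewrite /sa expr0 divr1.
have ys0 : y0 <= ys <= y0 + b0.
  by have := hy 0%N; rewrite /sb expr0 divr1.
have near_point d u v n : sa n + sb n < d ->
    (bisect n).1 <= u <= (bisect n).1 + sa n ->
    (bisect n).2 <= v <= (bisect n).2 + sb n ->
    nc (u +i* v - xs +i* ys) <= sa n + sb n.
  move=> _ /andP[u1 u2] /andP[v1 v2].
  have /andP[x1 x2] := hx n; have /andP[y1 y2] := hy n.
  rewrite (le_trans (le_normc_ReIm _))//= lerD// ler_norml; apply/andP; split; lra.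
have ab0 : 0 < a0 + b0 by rewrite addr_gt0.
have [inE|ninE] := boolP ((xs, ys) \in E).
  pose eta := eps * (Num.sqrt a0 * Num.sqrt b0) / (4 * (a0 + b0)).
  have eta0 : 0 < eta by rewrite divr_gt0 ?mulr_gt0 ?sqrtr_gt0.
  have [d d0 hd] := cF xs0 ys0 eta0; have [n hn] := small d0.
  have := bisect_bad n bad0; rewrite /bad ltNge => /negP; apply.
  have := weight_point (ltW (sa_gt0 n)) (ltW (sb_gt0 n)) inE (hx n) (hy n).
  move=> /(ler_wpM2l (ltW eps_gt0)); apply: le_trans.
  have := @rect_affine_le R F _ _ _ _ (F (xs +i* ys)) 0 0 eta (ltW (sa_gt0 n))
    (ltW (sb_gt0 n)) (ltW eta0) (@bisect_cont n).
  have -> : eps * (Num.sqrt (sa n) * Num.sqrt (sb n)) = 4 * eta * (sa n + sb n).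
    have -> : Num.sqrt (sa n) * Num.sqrt (sb n) =
        Num.sqrt a0 * Num.sqrt b0 / 2 ^+ n.
      rewrite /sa /sb (sqrtrM _ (ltW a0_gt0)) (sqrtrM _ (ltW b0_gt0)) mulrACA.
      by rewrite -expr2 sqr_sqrtr ?invr_ge0 ?exprn_ge0.
    by rewrite /eta /sa /sb; field; rewrite pow2 gt_eqF.
  apply => u v hu hv; rewrite mul0r subr0 ltW//; apply: hd.
  exact: le_lt_trans (near_point _ _ _ _ hn hu hv) hn.
have [l hl] := dF xs0 ys0 ninE.
pose eta := eps * (a0 * b0) / (4 * (a0 + b0) ^+ 2).
have eta0 : 0 < eta by rewrite divr_gt0 ?mulr_gt0 ?exprn_gt0.
have [d d0 hd] := cder_approx hl eta0; have [n hn] := small d0.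
have := bisect_bad n bad0; rewrite /bad ltNge => /negP; apply.
have := weight_area E (bisect n).1 (bisect n).2 (ltW (sa_gt0 n)) (ltW (sb_gt0 n)).
move=> /(ler_wpM2l (ltW eps_gt0)); apply: le_trans.
have s0 : 0 <= sa n + sb n by rewrite addr_ge0 ?ltW.
have -> : eps * (sa n * sb n) = 4 * (eta * (sa n + sb n)) * (sa n + sb n).
  by rewrite /sa /sb /eta; field; rewrite pow2 gt_eqF.
apply: (@rect_affine_le R F _ _ _ _ (F (xs +i* ys)) l (xs +i* ys)).
- exact: ltW.
- exact: ltW.
- by rewrite mulr_ge0// ltW.
- exact: bisect_cont.
move=> u v hu hv; have np := near_point _ _ _ _ hn hu hv.
by rewrite (le_trans (hd _ (le_lt_trans np hn)))// ler_pM2l.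
Qed.

End Bisection.

(** Goursat's theorem, with finitely many points at which [F] is only
    assumed to be continuous. *)
Theorem goursat F (E : seq (R * R)) x y a b : 0 < a -> 0 < b -> cont_rect F x y a b ->
  (forall u v, x <= u <= x + a -> y <= v <= y + b ->
    (u, v) \notin E -> exists l, cder F (u +i* v) l) ->
  rect F x y a b = 0.
Proof.
move=> a0 b0 cF dF; apply/eqP; rewrite -normc_eq0 eq_le normc_ge0 andbT.
apply/ler_addgt0Pr => e e0; rewrite add0r.
have w0 : 0 < weight E x y a b.
  by rewrite (lt_le_trans _ (weight_area E x y (ltW a0) (ltW b0)))// mulr_gt0.
have := bisection_bound a0 b0 (divr_gt0 e0 w0) cF dF.
by rewrite divfK// gt_eqF.
Qed.

End Goursat.

(** * The complex exponential *)

Section ComplexExponential.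
Variable R : realType.
Local Notation C := R[i].
Local Notation nc := (@normc R).
Implicit Types (z w : C) (x y : R).

Definition cexp z : C := (expR (complex.Re z))%:C *
  (cos (complex.Im z) +i* sin (complex.Im z)).

Lemma cexpD z w : cexp (z + w) = cexp z * cexp w.
Proof.
case: z w => a b [c d]; apply/eqP; rewrite eq_complex /cexp/= expRD cosD sinD.
by apply/andP; split; apply/eqP; ring.
Qed.

Lemma cexp0 : cexp 0 = 1.
Proof.
apply/eqP; rewrite eq_complex /cexp/= expR0 cos0 sin0.
by apply/andP; split; apply/eqP; ring.
Qed.

Lemma normc_cexp z : nc (cexp z) = expR (complex.Re z).
Proof.
rewrite /cexp normcM normcR_ge0 ?expR_ge0// [nc (_ +i* _)]/normc.
by rewrite cos2Dsin2 sqrtr1 mulr1.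
Qed.

Lemma cexp_neq0 z : cexp z != 0.
Proof. by rewrite -normc_gt0 normc_cexp expR_gt0. Qed.

Lemma real_approx (f : R -> R) (l e : R) : is_derive (0 : R) 1 f l -> 0 < e ->
  exists2 d : R, 0 < d & forall h, `|h| < d -> `|f h - f 0 - l * h| <= e * `|h|.
Proof.
move=> [df fl] e0.
have hl : (fun h => h^-1 *: (f (h *: 1 + 0) - f 0)) @ (0 : R)^' --> l.
  by rewrite -fl; exact: df.
have [d /= d0 hd] := (@cvgrPdist_lt _ _ _ _ (dnbhs_filter 0) _ _).1 hl e e0.
exists d => // h hh; have [->|h0] := eqVneq h 0.
  by rewrite subrr mulr0 subrr normr0 mulr0.
have := hd h; rewrite /ball/= sub0r normrN => /(_ hh h0) /ltW.
rewrite addr0 [_ *: 1]mulr1 -(ler_pM2r (x := `|h|)) ?normr_gt0// -normrM.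
by rewrite mulrBl [_ *: _ * h]mulrAC mulVf// mul1r distrC.
Qed.

(** The first-order expansions of [expR], [cos] and [sin] at 0, combined. *)
Lemma cexp_deriv0 : cder cexp 0 1.
Proof.
apply/cder_difference_quotient => e e0.
pose eta := Num.min 1 (e / 8).
have eta0 : 0 < eta by rewrite lt_min ltr01 divr_gt0.
have eta1 : eta <= 1 by rewrite ge_min lexx.
have etae : eta * 8 <= e by rewrite -ler_pdivlMr// ge_min lexx orbT.
have [d1 d10 h1] := real_approx (is_derive_expR 0) eta0.
have [d2 d20 h2] := real_approx (is_derive_cos 0) eta0.
have [d3 d30 h3] := real_approx (is_derive_sin 0) eta0.
pose d := Num.min (Num.min d1 d2) (Num.min d3 (eta / 2)).
exists d => [|w]; first by rewrite /d !lt_min d10 d20 d30 divr_gt0.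
rewrite eqxx subr0 /d !lt_min => /andP[/andP[w1 w2] /andP[w3 w4]].
case: eqVneq => [_|w0]; first by rewrite subrr normc0.
have rx := le_Re_normc w; have ry := le_Im_normc w.
have := h1 _ (le_lt_trans rx w1); have := h2 _ (le_lt_trans ry w2).
have := h3 _ (le_lt_trans ry w3).
rewrite expR0 cos0 sin0 oppr0 !mul0r !mul1r !subr0 addr0.
have n0 : 0 < nc w by rewrite normc_gt0.
have -> : (cexp w - cexp 0) / w - 1 = (cexp w - 1 - w) / w.
  by rewrite cexp0 [RHS]mulrBl divff.
rewrite normcM normcV ltr_pdivrMr// => hs hc he.
rewrite (le_lt_trans (le_normc_ReIm _))//.
set x := complex.Re w in rx he *; set y := complex.Im w in ry hs hc *.
have -> : complex.Re (cexp w - 1 - w) =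
    (expR x - 1 - x) + expR x * (cos y - 1).
  by rewrite /cexp /x /y; case: (w) => a b /=; ring.
have -> : complex.Im (cexp w - 1 - w) =
    (expR x - 1) * y + expR x * (sin y - y).
  by rewrite /cexp /x /y; case: (w) => a b /=; ring.
have ex : `|expR x - 1| <= 2 * `|x|.
  rewrite -[expR x - 1](subrK x) (le_trans (ler_normD _ _))//.
  have := normr_ge0 x; nra.
have ex2 : expR x <= 2.
  have := ler_norm (expR x - 1); lra.
have ex0 := expR_ge0 x.
have a1 : `|expR x - 1 - x + expR x * (cos y - 1)| <= 3 * eta * nc w.
  rewrite (le_trans (ler_normD _ _))// normrM (ger0_norm ex0).
  have := normr_ge0 (cos y - 1); nra.
have a2 : `|(expR x - 1) * y + expR x * (sin y - y)| <= 3 * eta * nc w.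
  rewrite (le_trans (ler_normD _ _))// !normrM (ger0_norm ex0).
  have b1 : `|expR x - 1| * `|y| <= eta * nc w.
    apply: ler_pM => //; lra.
  have b2 : expR x * `|sin y - y| <= 2 * (eta * nc w).
    apply: ler_pM => //; rewrite (le_trans hs)// ler_wpM2l//; exact: ltW.
  lra.
rewrite (le_lt_trans (lerD a1 a2))//; nra.
Qed.

Lemma cexp_deriv z : cder cexp z (cexp z).
Proof.
have -> : cexp = (fun w => cexp z * cexp (w - z)).
  by apply/funext => w; rewrite -cexpD addrC subrK.
rewrite subrr cexp0 mulr1; rewrite -{2}[cexp z]mulr1; apply: cderZ.
rewrite -[1]mulr1; apply: (@cder_comp _ (fun w => w - z)).
  by have := cderB (cder_id z) (cder_cst z z); rewrite subr0.
by rewrite subrr; exact: cexp_deriv0.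
Qed.

Lemma polar z : z != 0 -> exists2 t : R, -pi <= t <= pi & z = cexp (ln (nc z) +i* t).
Proof.
move=> z0; have n0 : 0 < nc z by rewrite normc_gt0.
have lnz : expR (ln (nc z)) = nc z by rewrite lnK.
pose c := complex.Re z / nc z; pose s := complex.Im z / nc z.
have cs : c ^+ 2 + s ^+ 2 = 1.
  by rewrite /c /s !expr_div_n -mulrDl -sqr_normcE divff// sqrf_eq0 gt_eqF.
have c1 : -1 <= c <= 1.
  by apply/andP; split; have := sqr_ge0 s; nra.
have s2 : Num.sqrt (1 - c ^+ 2) = `|s|.
  by rewrite -cs addrAC subrr add0r sqrtr_sqr.
have zE : z = (nc z)%:C * (c +i* s).
  apply/eqP; rewrite eq_complex /=; apply/andP; split; apply/eqP.
    by rewrite /c /s; field; rewrite gt_eqF.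
  by rewrite /c /s; field; rewrite gt_eqF.
have [h1 h2] := acos_def c1.
have h3 : sin (acos c) = `|s| by rewrite sin_acos.
have /andP[p1 p2] := h1.
have [s0|s0] := leP 0 s.
  exists (acos c); first by rewrite p2 (le_trans _ p1)// oppr_le0 pi_ge0.
  by rewrite [LHS]zE /cexp/= lnz h2 h3 ger0_norm.
exists (- acos c); first by rewrite lerN2 p2 (le_trans _ (pi_ge0 R))// oppr_le0.
by rewrite [LHS]zE /cexp/= lnz cosN sinN h2 h3 ltr0_norm// opprK.
Qed.

Lemma cos_eq1 (u : R) : `|u| <= pi *+ 2 -> cos u = 1 -> u = 0 \/ `|u| = pi *+ 2.
Proof.
move=> u2 cu.
have cau : cos `|u| = 1 by case: (ger0P u) => _; rewrite ?cosN.
have inj0 v : 0 <= v -> v <= pi -> cos v = 1 -> v = 0.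
  move=> v0 vp cv; apply: cos_inj; rewrite ?in_itv/= ?v0 ?vp ?lexx ?pi_ge0//.
  by rewrite cos0.
have [up|up] := leP `|u| pi.
  by left; apply/normr0_eq0/inj0.
right; apply/eqP; rewrite -subr_eq0; apply/eqP.
have : pi *+ 2 - `|u| = 0.
  apply: inj0; first by rewrite subr_ge0.
    by rewrite lerBlDr mulr2n lerD2l ltW.
  by rewrite addrC cosD2pi cosN.
by move/eqP; rewrite subr_eq0 => /eqP ->; rewrite subrr.
Qed.

(** The two extra preimages occur when the argument is [pi] or [- pi]; a point of
    the disc is thus reached finitely often from the closed strip. *)
Lemma cexp_eq (s t s' t' : R) : -pi <= t <= pi -> -pi <= t' <= pi ->
  cexp (s +i* t) = cexp (s' +i* t') ->
  (s, t) \in [:: (s', t'); (s', t' + pi *+ 2); (s', t' - pi *+ 2)].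
Proof.
move=> /andP[t1 t2] /andP[u1 u2] E.
have ss : s = s'.
  by have := congr1 nc E; rewrite !normc_cexp /= => /expR_inj.
have : cexp (s +i* t) * cexp (- s' -i* t') = 1.
  rewrite E -cexpD -cexp0; congr cexp; apply/eqP.
  by rewrite eq_complex /= !subrr !eqxx.
rewrite -cexpD ss => /(congr1 (@complex.Re R)); rewrite /cexp/=.
rewrite subrr expR0 mul1r mul0r subr0 => /cos_eq1.
have h : `|t - t'| <= pi *+ 2 by rewrite ler_norml mulr2n; apply/andP; split; lra.
rewrite !inE => /(_ h) [/eqP|].
  by rewrite subr_eq0 => /eqP ->; rewrite eqxx.
case: (ger0P (t - t')) => _ /eqP.
  rewrite subr_eq addrC => /eqP ->; by rewrite eqxx orbT.
rewrite opprB subr_eq addrC -subr_eq => /eqP <-; by rewrite eqxx !orbT.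
Qed.

End ComplexExponential.

(** * Taylor series of holomorphic functions *)

Section Taylor.
Variable R : realType.
Local Notation C := R[i].
Local Notation nc := (@normc R).
Implicit Types (F f : C -> C) (z w : C) (r s t : R).

Definition holomorphic f := forall z, nc z < 1 -> exists l, cder f z l.

Lemma rcont_bounded (F : R -> C) (a b : R) : a <= b ->
  (forall t, a <= t <= b -> rcont F t) ->
  exists2 M : R, 0 <= M & forall t, a <= t <= b -> nc (F t) <= M.
Proof.
move=> ab h.
have [|c cab hc] := @EVT_max R (nc \o F) a b ab.
  apply: continuous_in_subspaceT => t /set_mem; rewrite /= in_itv/= => tab.
  apply: (@cvgrPdist_lt _ _ _ _ _ _ _).2 => e e0.
  have [d d0 hd] := h t tab e e0.
  exists d => //= s; rewrite /ball/= distrC => /hd; apply: le_lt_trans.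
  by rewrite distrC; exact: ler_normc_dist.
by exists (nc (F c)) => [|t tab]; [exact: normc_ge0|exact: hc].
Qed.

Local Notation mean F s := (cint (fun t => F (s +i* t)) (-pi) pi).

Let pi2 : (- pi : R) + (pi + pi) = pi.
Proof. by rewrite addrA addNr add0r. Qed.

Let Npi_le_pi : (- pi : R) <= pi.
Proof. by rewrite ge0_cp ?pi_ge0. Qed.

(** Moving the segment of integration changes the integral by the horizontal
    sides of a rectangle, and these cancel by periodicity. *)
Lemma mean_invariant F (E : seq (R * R)) (s0 s1 : R) : s0 < s1 ->
  (forall u v, s0 <= u <= s1 -> -pi <= v <= pi -> ccont F (u +i* v)) ->
  (forall u v, s0 <= u <= s1 -> -pi <= v <= pi -> (u, v) \notin E ->
    exists l, cder F (u +i* v) l) ->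
  (forall u, F (u -i* pi) = F (u +i* pi)) -> mean F s0 = mean F s1.
Proof.
move=> s01 cF dF per.
have s0s1 : s0 + (s1 - s0) = s1 by rewrite addrC subrK.
have cR : cont_rect F s0 (-pi) (s1 - s0) (pi + pi).
  by move=> u v; rewrite s0s1 pi2; exact: cF.
have := @goursat R F E s0 (-pi) (s1 - s0) (pi + pi).
rewrite subr_gt0 s01 addr_gt0 ?pi_gt0// s0s1 pi2 => /(_ isT isT cR dF).
rewrite /rect s0s1 pi2.
have -> : (fun u => F (u -i* pi) - F (u +i* pi)) = (fun=> 0).
  by apply/funext => u; rewrite per subrr.
rewrite cint_cst ?(ltW s01)// mul0r add0r => /eqP; rewrite mulf_eq0.
rewrite -normc_eq0 normc_i oner_eq0/= cintB.
- by rewrite subr_eq0 => /eqP ->.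
- apply: rcont_integrable => t ht; apply: rcont_vline; apply: cF => //.
  by rewrite lexx ltW.
- apply: rcont_integrable => t ht; apply: rcont_vline; apply: cF => //.
  by rewrite lexx ltW.
Qed.

Lemma cexp_per (u : R) : cexp (u -i* pi) = cexp (u +i* pi).
Proof. by rewrite /cexp/= cosN sinN sinpi oppr0. Qed.

Lemma cexp_disc s t : s < 0 -> nc (cexp (s +i* t)) < 1.
Proof. by move=> s0; rewrite normc_cexp/= -expR0 ltr_expR. Qed.

(** By invariance the mean may be computed arbitrarily far to the left. *)
Let mean_of_small F (s : R) : s < 0 ->
  (forall u v, u < 0 -> ccont F (u +i* v)) ->
  (forall s', s' < 0 -> mean F s' = mean F s) ->
  (forall e, 0 < e -> exists s', s' < 0 /\ forall t, nc (F (s' +i* t)) <= e) ->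
  mean F s = 0.
Proof.
move=> s0 cF inv small; apply/eqP; rewrite -normc_eq0 eq_le normc_ge0 andbT.
apply/ler_addgt0Pr => e e0; rewrite add0r.
have c0 : 0 < 2 * (pi + pi) :> R by rewrite mulr_gt0// addr_gt0// pi_gt0.
have [s' [s'0 hs']] := small _ (divr_gt0 e0 c0).
rewrite -(inv _ s'0).
have -> : e = 2 * (e / (2 * (pi + pi))) * (pi - - pi).
  have P0 : (pi + pi : R) != 0 by rewrite gt_eqF// addr_gt0// pi_gt0.
  by rewrite opprK; move: (pi + pi) P0 => P P0; field.
apply: cint_le; [exact: Npi_le_pi| |by move=> t _; exact: hs'].
by apply: rcont_integrable => t ht; apply: rcont_vline; exact: cF.
Qed.

(** The Cauchy integral theorem for the difference quotient of [f] at [w],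
    which is continuous at [w] but not known to be differentiable there. *)
Lemma mean_quotient f w l s : holomorphic f -> nc w < 1 -> cder f w l -> s < 0 ->
  let g z := if z == w then l else (f z - f w) / (z - w) in
  mean (fun x => g (cexp x) * cexp x) s = 0.
Proof.
move=> hf w1 fl s0 g; pose F x := g (cexp x) * cexp x.
have dg z : nc z < 1 -> z != w -> exists l', cder g z l'.
  move=> z1 zw; have [m fm] := hf z z1.
  have zw0 : z - w != 0 by rewrite subr_eq0.
  have hd := cderM (cderB fm (cder_cst (f w) z))
      (cderV (f := fun y => y - w) zw0 (cderB (cder_id z) (cder_cst w z))).
  eexists; apply: (cder_near (d := nc (z - w)) _ _ hd); first by rewrite normc_gt0.
  move=> y yz; rewrite /g; case: eqVneq => // yw.
  by move: yz; rewrite yw normcB ltxx.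
have cg z : nc z < 1 -> ccont g z.
  move=> z1; have [->|zw] := eqVneq z w; first exact/cder_difference_quotient.
  by have [l' /cder_continuous] := dg z z1 zw.
have cF u v : u < 0 -> ccont F (u +i* v).
  move=> u0; have ce := cder_continuous (cexp_deriv (u +i* v)).
  by apply: continuousMC => //; apply: continuous_compC => //; apply: cg; exact: cexp_disc.
have [E hE] : exists E : seq (R * R), forall u v, -pi <= v <= pi ->
    (u, v) \notin E -> cexp (u +i* v) != w.
  have [->|w0] := eqVneq w 0; first by exists [::] => u v _ _; exact: cexp_neq0.
  have [t ht wE] := polar w0.
  exists [:: (ln (nc w), t); (ln (nc w), t + pi *+ 2); (ln (nc w), t - pi *+ 2)].
  move=> u v hv; apply: contraNneq => E; apply: cexp_eq => //.
  by rewrite E -wE.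
have dF u v : u < 0 -> -pi <= v <= pi -> (u, v) \notin E -> exists l', cder F (u +i* v) l'.
  move=> u0 hv nE; have ne := hE _ _ hv nE.
  have [m gm] := dg _ (cexp_disc v u0) ne.
  eexists; apply: cderM; last exact: cexp_deriv.
  exact: cder_comp (cexp_deriv _) gm.
have inv s' s'' : s' < s'' -> s'' < 0 -> mean F s' = mean F s''.
  move=> h1 h2; apply: (@mean_invariant F E _ _ h1).
  - by move=> u v /andP[_ u2] _; apply: cF; exact: le_lt_trans h2.
  - by move=> u v /andP[_ u2]; apply: dF; exact: le_lt_trans h2.
  - by move=> u; rewrite /F cexp_per.
apply: (mean_of_small s0 cF).
  move=> s' s'0; have [h|h|->] := ltgtP s' s; [exact: (inv _ _ h s0)| |by []].
  exact/esym/(inv _ _ h s'0).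
move=> e e0; have [|d d0 hd] := cg 0 _ _ (@ltr01 R); first by rewrite normc0.
pose K := nc (g 0) + 1.
have K0 : 0 < K by rewrite ltr_wpDl// normc_ge0.
pose m := Num.min (Num.min d (1/2)) (e / K).
have m0 : 0 < m by rewrite !lt_min d0 !divr_gt0.
exists (ln (m / 2)).
have m1 : m / 2 < 1.
  have : m <= 1/2 by rewrite !ge_min lexx orbT.
  lra.
have md : m / 2 < d.
  have : m <= d by rewrite !ge_min lexx.
  lra.
have me : m / 2 <= e / K.
  have : m <= e / K by rewrite ge_min lexx orbT.
  lra.
have m20 : 0 < m / 2 by rewrite divr_gt0.
split; first by rewrite ln_lt0// m20.
move=> t; rewrite /F normcM.
have ncE : nc (cexp (ln (m / 2) +i* t)) = m / 2 by rewrite normc_cexp/= lnK.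
rewrite ncE; have := hd (cexp (ln (m / 2) +i* t)); rewrite subr0 ncE => /(_ md) hg.
have gK : nc (g (cexp (ln (m / 2) +i* t))) <= K.
  rewrite -[g (cexp _)](subrK (g 0)) (le_trans (le_normcD _ _))// addrC lerD2l ltW//.
rewrite (le_trans (ler_pM (normc_ge0 _) (ltW m20) gK me))//.
by rewrite mulrC divfK// gt_eqF.
Qed.

(** Moving the segment by 1 multiplies the mean by [exp (- k)], whereas invariance
    leaves it unchanged. *)
Lemma mean_power s k : s < 0 -> mean (fun x => (cexp x)^-1 ^+ k) s =
  if k == 0%N then (pi + pi)%:C else 0.
Proof.
move=> s0; case: eqP => [->|/eqP k0].
  under eq_fun do rewrite expr0.
  by rewrite cint_cst// mul1r opprK.
pose F x : C := (cexp x)^-1 ^+ k.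
have dF z : exists l, cder F z l.
  eexists; apply: cderX; apply: cderV; first exact: cexp_neq0.
  exact: cexp_deriv.
have cF z : ccont F z by have [l /cder_continuous] := dF z.
have inv s' s'' : s' < s'' -> mean F s' = mean F s''.
  move=> h; apply: (@mean_invariant F [::] _ _ h) => [u v _ _|u v _ _ _|].
  - exact: cF.
  - exact: dF.
  by move=> u; rewrite /F cexp_per.
have intF s' : iintegrable (-pi) pi (fun t => F (s' +i* t)).
  by apply: rcont_integrable => t _; exact: rcont_vline.
have E : mean F (s + 1) = ((expR 1)^-1 ^+ k)%:C * mean F s.
  rewrite /cint -cintegralZ//; last exact: intF.
  apply: eq_cintegral => t _.
  have -> : (s + 1) +i* t = 1%:C + s +i* t :> C.
    by apply/eqP; rewrite eq_complex/= add0r addrC !eqxx.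
  rewrite /F cexpD invfM exprMn; congr (_ * _).
  rewrite rmorphXn; congr (_ ^+ _); rewrite {1}/cexp/= cos0 sin0 -[1 +i* 0]/(1%:C) -rmorphM mulr1.
  by rewrite fmorphV.
have e1 : (expR 1)^-1 ^+ k < 1 :> R.
  by rewrite exprn_ilt1// ?invr_ge0 ?expR_ge0// invf_lt1 ?expR_gt0// -expR0 ltr_expR.
move: E; rewrite -(inv s (s + 1)) ?ltrDl// => /eqP.
rewrite -subr_eq0 -{1}[mean F s]mul1r -mulrBl mulf_eq0 => /orP[|/eqP//].
rewrite -[1]/(1%:C) -rmorphB -[0]/(0%:C) (inj_eq (@complexI R)) subr_eq0.
by rewrite gt_eqF.
Qed.

Definition log_half : R := ln (1 / 2).

Lemma log_half_lt0 : log_half < 0.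
Proof. by rewrite ln_lt0//; apply/andP; split; lra. Qed.

(** Cauchy's integral for the [k]-th coefficient over the circle of radius [1 / 2]:
    in the coordinates [cexp (s +i* t)], the vertical segment at [s = ln (1 / 2)]. *)
Definition taylor_coef f (k : nat) : C :=
  ((pi + pi)^-1)%:C * mean (fun x => f (cexp x) * (cexp x)^-1 ^+ k) log_half.

Lemma taylor_coef1 k : taylor_coef (fun=> 1) k = (k == 0%N)%:R.
Proof.
have p0 : (pi + pi : R) != 0 by rewrite gt_eqF// addr_gt0 ?pi_gt0.
have E : mean (fun x => 1 * (cexp x)^-1 ^+ k) log_half =
    mean (fun x => (cexp x)^-1 ^+ k) log_half.
  by apply: eq_cintegral => t _; rewrite mul1r.
rewrite /taylor_coef E (mean_power _ log_half_lt0).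
by case: (k == 0)%N; rewrite ?mulr0// -rmorphM mulVf.
Qed.

Lemma taylor_mean f s k : holomorphic f -> s < 0 ->
  mean (fun x => f (cexp x) * (cexp x)^-1 ^+ k) s = (pi + pi)%:C * taylor_coef f k.
Proof.
move=> hf s0; rewrite /taylor_coef mulrA -rmorphM divff ?mul1r; last first.
  by rewrite gt_eqF// addr_gt0 ?pi_gt0.
pose F x := f (cexp x) * (cexp x)^-1 ^+ k.
have dF u v : u < 0 -> exists l, cder F (u +i* v) l.
  move=> u0; have [m fm] := hf _ (cexp_disc v u0); eexists; apply: cderM.
    exact: cder_comp (cexp_deriv _) fm.
  apply: cderX; apply: cderV; first exact: cexp_neq0.
  exact: cexp_deriv.
have cF u v : u < 0 -> ccont F (u +i* v).
  by move=> u0; have [l /cder_continuous] := dF u v u0.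
have inv s' s'' : s' < s'' -> s'' < 0 -> mean F s' = mean F s''.
  move=> h1 h2; apply: (@mean_invariant F [::] _ _ h1).
  - by move=> u v /andP[_ u2] _; apply: cF; exact: le_lt_trans h2.
  - by move=> u v /andP[_ u2] _ _; apply: dF; exact: le_lt_trans h2.
  - by move=> u; rewrite /F cexp_per.
have inv' : mean F s = mean F log_half.
  have [h|h|->] := ltgtP s log_half; last by [].
    exact: (inv _ _ h log_half_lt0).
  exact/esym/(inv _ _ h s0).
exact: inv'.
Qed.

Lemma taylor_disc_coef f : holomorphic f -> disc_coef (taylor_coef f).
Proof.
move=> hf r r0 r1; pose s := ln r.
have s0 : s < 0 by rewrite ln_lt0// r0.
have es : expR s = r by rewrite lnK.
have [|M M0 hM] := @rcont_bounded (fun t => f (cexp (s +i* t))) _ _ Npi_le_pi.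
  move=> t _; apply: (@rcont_vline _ (fun x => f (cexp x))).
  apply: continuous_compC; first exact: cder_continuous (cexp_deriv _).
  by have [l /cder_continuous] := hf _ (cexp_disc t s0).
have p0 : 0 < pi + pi :> R by rewrite addr_gt0 ?pi_gt0.
exists (2 * M) => [|k]; first by rewrite mulr_ge0.
have := taylor_mean k hf s0 => /(congr1 nc); rewrite normcM (normcR_ge0 (ltW p0)) => E.
rewrite -(ler_pM2l p0) mulrA -E.
rewrite -ler_pdivlMr ?exprn_gt0//.
have -> : (pi + pi) * (2 * M) / r ^+ k = 2 * (M / r ^+ k) * (pi - - pi).
  rewrite opprK; move: (pi + pi) => P; field.
  by rewrite expf_neq0// gt_eqF.
apply: cint_le; [exact: Npi_le_pi| |move=> t ht].
  apply: rcont_integrable => t ht.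
  apply: (@rcont_vline _ (fun x => f (cexp x) * (cexp x)^-1 ^+ k)).
  apply: continuousMC.
    apply: continuous_compC; first exact: cder_continuous (cexp_deriv _).
    by have [l /cder_continuous] := hf _ (cexp_disc t s0).
  apply: cder_continuous; apply: cderX; apply: cderV; first exact: cexp_neq0.
  exact: cexp_deriv.
rewrite normcM normcX normcV normc_cexp/= es exprVn ler_wpM2r ?hM//.
by rewrite invr_ge0 exprn_ge0// ltW.
Qed.

(** Expansion of the Cauchy kernel [1 / (1 - w / c)] on a circle outside of
    the disc of radius [nc w]. *)
Lemma mean_cauchy f w s : holomorphic f -> nc w < expR s -> s < 0 ->
  exists (K q : R), [/\ 0 <= q, q < 1 & forall n,
    nc (mean (fun x => f (cexp x) / (1 - w / cexp x)) s -
        (pi + pi)%:C * \sum_(k < n) taylor_coef f k * w ^+ k) <= K * q ^+ n].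
Proof.
move=> hf ws s0; pose q := nc w / expR s.
have es0 := expR_gt0 s.
have q0 : 0 <= q by rewrite divr_ge0 ?normc_ge0// ltW.
have q1 : q < 1 by rewrite ltr_pdivrMr// mul1r.
have cc t : ccont (@cexp R) (s +i* t : C) by exact: cder_continuous (cexp_deriv _).
have cf t : ccont (fun x => f (cexp x)) (s +i* t).
  apply: continuous_compC => //.
  by have [l /cder_continuous] := hf _ (cexp_disc t s0).
have cV t : ccont (fun x : C => (cexp x)^-1) (s +i* t).
  by apply: continuousVC => //; exact: cexp_neq0.
have nq t : nc (w / cexp (s +i* t)) = q by rewrite normcM normcV normc_cexp.
have dq t : 1 - q <= nc (1 - w / cexp (s +i* t)).
  by rewrite -(nq t) -[1 in leLHS](normc1 R) le_normc_dist.
have d0 t : 1 - w / cexp (s +i* t) != 0.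
  by rewrite -normc_gt0 (lt_le_trans _ (dq t))// subr_gt0.
have cK t : ccont (fun x => (1 - w / cexp x)^-1) (s +i* t).
  apply: continuousVC => //; apply: continuousDC; first exact: continuous_cstC.
  have -> : (fun x : C => - (w / cexp x)) = (fun x => - w * (cexp x)^-1).
    by apply/funext => x; rewrite mulNr.
  by apply: continuousMC => //; exact: continuous_cstC.
have [|M M0 hM] := @rcont_bounded (fun t => f (cexp (s +i* t))) _ _ Npi_le_pi.
  by move=> t _; exact: (@rcont_vline _ (fun x => f (cexp x))).
pose K := 2 * (M / (1 - q)) * (pi - - pi).
exists K, q; split => // n.
have ci F : (forall t, ccont F (s +i* t)) -> iintegrable (-pi) pi (fun t => F (s +i* t)).
  by move=> h; apply: rcont_integrable => t _; exact: rcont_vline.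
have cX t k : ccont (fun x : C => (cexp x)^-1 ^+ k) (s +i* t).
  apply: cder_continuous; apply: cderX; apply: cderV; first exact: cexp_neq0.
  exact: cexp_deriv.
pose G k t := w ^+ k * (f (cexp (s +i* t)) * (cexp (s +i* t))^-1 ^+ k).
have iG k : iintegrable (-pi) pi (G k).
  apply: (ci (fun x => w ^+ k * (f (cexp x) * (cexp x)^-1 ^+ k))) => t.
  apply: continuousMC; first exact: continuous_cstC.
  exact: continuousMC.
have [iS SE] := cintegral_sum (measurable_itvcc (-pi) pi) n iG.
have -> : (pi + pi)%:C * \sum_(k < n) taylor_coef f k * w ^+ k =
    cint (fun t => \sum_(k < n) G k t) (-pi) pi.
  rewrite /cint SE mulr_sumr; apply: eq_bigr => k _.
  rewrite mulrA -(taylor_mean k hf s0) mulrC /cint -cintegralZ//.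
  by apply: (ci (fun x => f (cexp x) * (cexp x)^-1 ^+ k)) => t; exact: continuousMC.
rewrite -cintB//; last first.
  by apply: (ci (fun x => f (cexp x) / (1 - w / cexp x))) => t; exact: continuousMC.
rewrite /K.
have -> : 2 * (M / (1 - q)) * (pi - - pi) * q ^+ n =
   2 * (M / (1 - q) * q ^+ n) * (pi - - pi) by ring.
apply: cint_le; [exact: Npi_le_pi| |move=> t ht].
  apply: cintegrableB => //.
  by apply: (ci (fun x => f (cexp x) / (1 - w / cexp x))) => t; exact: continuousMC.
set c := cexp (s +i* t).
have -> : f c / (1 - w / c) - \sum_(k < n) G k t = f c / (1 - w / c) * (w / c) ^+ n.
  have -> : \sum_(k < n) G k t = f c * \sum_(k < n) (w / c) ^+ k.
    by rewrite mulr_sumr; apply: eq_bigr => k _; rewrite /G -/c exprMn; ring.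
  have := subrX1 (w / c) n => /eqP.
  rewrite -[w / c - 1]opprB mulNr -eqr_oppLR opprB => /eqP E.
  have -> : \sum_(k < n) (w / c) ^+ k = (1 - (w / c) ^+ n) / (1 - w / c).
    by rewrite E mulrAC divff ?mul1r// d0.
  by ring.
rewrite !normcM normcX nq ler_wpM2r ?exprn_ge0// ler_pM ?normc_ge0 ?hM//.
have d1 : 0 < nc (1 - w / c) by rewrite normc_gt0; exact: d0.
by rewrite normcV lef_pV2 ?posrE ?subr_gt0//; exact: dq.
Qed.

(** Comparing the expansions of the Cauchy kernel for [f] and for the constant 1
    leaves the mean of a difference quotient, which vanishes. *)
Theorem taylor_series f w : holomorphic f -> nc w < 1 -> f w = psum (taylor_coef f) w.
Proof.
move=> hf w1; pose r := (1 + nc w) / 2.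
have wr : nc w < r by rewrite /r; lra.
have r1 : r < 1 by rewrite /r; lra.
have r0 : 0 < r by exact: le_lt_trans (normc_ge0 w) wr.
pose s := ln r; have s0 : s < 0 by rewrite ln_lt0// r0.
have es : expR s = r by rewrite lnK.
have ws : nc w < expR s by rewrite es.
have [l fl] := hf w w1.
have h1 : holomorphic (fun=> 1) by move=> z _; exists 0; exact: cder_cst.
have [K [q [q0 q1 hK]]] := mean_cauchy hf ws s0.
have [K' [q' [q'0 q'1 hK']]] := mean_cauchy h1 ws s0.
have small (A x : R) : 0 <= x -> x < 1 -> forall e, 0 < e ->
    exists N, forall n, (N <= n)%N -> A * x ^+ n < e.
  move=> h0 h2 e e0; have h : `|x| < 1 by rewrite ger0_norm.
  have /cvgrPdist_lt /(_ e e0)[N _ hN] := @cvg_geometric R A _ h.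
  exists N => n /hN; rewrite sub0r normrN /=; exact: le_lt_trans (ler_norm _).
have p0 : 0 < pi + pi :> R by rewrite addr_gt0 ?pi_gt0.
have I1 : mean (fun x => 1 / (1 - w / cexp x)) s = (pi + pi)%:C.
  apply/eqP; rewrite -subr_eq0 -normc_eq0 eq_le normc_ge0 andbT.
  apply/ler_addgt0Pr => e e0; have [N hN] := small K' q' q'0 q'1 e e0.
  have := hK' N.+1; rewrite big_ord_recl big1 => [|k _]; last first.
    by rewrite taylor_coef1 mul0r.
  rewrite taylor_coef1 eqxx expr0 mul1r addr0 mulr1 => h.
  by rewrite add0r ltW// (le_lt_trans h)// hN.
have q0' : mean (fun x => f (cexp x) / (1 - w / cexp x)) s = f w * (pi + pi)%:C.
  have cne t : cexp (s +i* t) != w.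
    by apply: contraTneq ws => <-; rewrite normc_cexp/= ltxx.
  have cc t : ccont (@cexp R) (s +i* t : C) by exact: cder_continuous (cexp_deriv _).
  have cf t : ccont (fun x => f (cexp x)) (s +i* t).
    apply: continuous_compC => //.
    by have [m /cder_continuous] := hf _ (cexp_disc t s0).
  have d0 t : 1 - w / cexp (s +i* t) != 0.
    rewrite subr_eq0 eq_sym; apply: contra_neq (cne t) => E.
    by rewrite -[RHS](divfK (cexp_neq0 (s +i* t))) E mul1r.
  have cK t : ccont (fun x => (1 - w / cexp x)^-1) (s +i* t).
    apply: continuousVC => //; apply: continuousDC; first exact: continuous_cstC.
    have -> : (fun x : C => - (w / cexp x)) = (fun x => - w * (cexp x)^-1).
      by apply/funext => x; rewrite mulNr.
    apply: continuousMC => //; first exact: continuous_cstC.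
    by apply: continuousVC => //; exact: cexp_neq0.
  have ci F : (forall t, ccont F (s +i* t)) ->
      iintegrable (-pi) pi (fun t => F (s +i* t)).
    by move=> h; apply: rcont_integrable => t _; exact: rcont_vline.
  have := mean_quotient hf w1 fl s0; rewrite /= => E.
  rewrite -I1 /cint -cintegralZ//; last first.
    by apply: (ci (fun x => 1 / (1 - w / cexp x))) => t; apply: continuousMC => //; exact: continuous_cstC.
  apply/eqP; rewrite -subr_eq0 -/(cint _ _ _) -/(cint _ _ _) -cintB.
  - apply/eqP; rewrite -[RHS]E; apply: eq_cintegral => t _.
    rewrite (negbTE (cne t)) mul1r -mulrBl.
    have := cne t; have := d0 t; have := cexp_neq0 (s +i* t).
    set c := cexp _; move=> c0 h cw.
    have -> : 1 - w / c = (c - w) / c by rewrite mulrBl divff.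
    by rewrite invf_div; ring.
  - by apply: (ci (fun x => f (cexp x) / (1 - w / cexp x))) => t; exact: continuousMC.
  - apply: (ci (fun x => f w * (1 / (1 - w / cexp x)))) => t.
    apply: continuousMC; first exact: continuous_cstC.
    by apply: continuousMC => //; exact: continuous_cstC.
apply/esym/has_sum_csum => e e0.
have [N hN] := small K q q0 q1 _ (mulr_gt0 e0 p0).
exists N => n /hN; move: (hK n); rewrite q0' => /le_lt_trans h /h.
rewrite mulrC -mulrBr normcM (normcR_ge0 (ltW p0)) mulrC normcB.
by rewrite [X in X < _ -> _]mulrC [X in _ < X -> _]mulrC ltr_pM2l.
Qed.

End Taylor.

(** * Moments of the disc *)

Section PolynomialIntegral.
Variable R : realType.
Local Notation C := R[i].

Lemma integral_deriv_poly (P : {poly R}) (a b : R) : a < b ->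
  (\int[lebesgue_measure]_(x in `[a, b]) (P^`().[x])%:E = (P.[b] - P.[a])%:E)%E.
Proof.
move=> ab; rewrite EFinB; apply: (@continuous_FTC2 R _ (fun x => P.[x])) => //.
- by apply: continuous_subspaceT => x; exact: continuous_horner.
- split.
  + by move=> x _; exact: derivable_horner.
  + apply: cvg_at_right_filter; exact: continuous_horner.
  + apply: cvg_at_left_filter; exact: continuous_horner.
- by move=> x _; rewrite derivE.
Qed.

Definition re_poly (P : {poly C}) : {poly R} := \poly_(i < size P) complex.Re P`_i.

Lemma coef_re_poly P i : (re_poly P)`_i = complex.Re P`_i.
Proof.
by rewrite coef_poly; case: ltnP => // h; rewrite nth_default.
Qed.

Lemma horner_re_poly P (x : R) : (re_poly P).[x] = complex.Re P.[x%:C].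
Proof.
rewrite (@horner_coef_wide _ (size P)) ?size_poly// horner_coef raddf_sum.
apply: eq_bigr => i _; rewrite coef_re_poly -rmorphXn.
by case: (P`_i) => a b; rewrite /= mulr0 subr0.
Qed.

Lemma deriv_re_poly P : (re_poly P)^`() = re_poly P^`().
Proof.
by apply/polyP => i; rewrite coef_deriv !coef_re_poly coef_deriv raddfMn.
Qed.

(** The fundamental theorem of calculus for complex polynomials that vanish at
    both ends of a symmetric interval. *)
Lemma integral_deriv_vanishing (P : {poly C}) (s : R) : 0 < s ->
  P.[s%:C] = 0 -> P.[(- s)%:C] = 0 ->
  (\int[lebesgue_measure]_(x in `](- s)%R, s[) (complex.Re P^`().[x%:C])%:E = 0)%E.
Proof.
move=> s0 h1 h2.
have -> : (fun x : R => (complex.Re P^`().[x%:C])%:E) =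
    EFin \o (fun x : R => (re_poly P)^`().[x]).
  by apply/funext => x /=; rewrite deriv_re_poly horner_re_poly.
rewrite -(@integral_itv_bndoo _ _ _ _ true false); last first.
  apply/measurable_EFinP; apply: measurable_funTS.
  by apply: continuous_measurable_fun; exact: continuous_horner.
have h : - s < s by rewrite gt0_cp.
by rewrite [LHS](integral_deriv_poly (re_poly P) h) !horner_re_poly h1 h2 subrr.
Qed.

End PolynomialIntegral.

Section DiscMoments.
Variable R : realType.
Local Notation C := R[i].
Local Notation nc := (@normc R).
Local Notation T2 := (measurableTypeR R * measurableTypeR R)%type.
Local Notation lam := (@lebesgue_measure R).
Local Notation area := (lam \x lam)%E.
Implicit Types (U V : T2 -> C) (r : R) (w : T2).

Definition plane w : C := w.1 +i* w.2.

Definition disc r : set T2 := [set w | w.1 ^+ 2 + w.2 ^+ 2 < r ^+ 2].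

Definition cmeasurable U := measurable_fun setT (fun w => complex.Re (U w)) /\
  measurable_fun setT (fun w => complex.Im (U w)).

Lemma cmeasurable_plane : cmeasurable plane.
Proof. by split; [exact: measurable_fst|exact: measurable_snd]. Qed.

Lemma cmeasurable_cst c : cmeasurable (fun=> c).
Proof. by split; exact: measurable_cst. Qed.

Lemma cmeasurable_conj U : cmeasurable U -> cmeasurable (fun w => (U w)^*).
Proof.
move=> [h1 h2]; split.
  by apply: eq_measurable_fun h1 => w _; case: (U w).
apply: (@eq_measurable_fun _ _ _ _ _ (fun w => - complex.Im (U w))).
  by move=> w _; case: (U w).
exact: measurableT_comp.
Qed.

Lemma cmeasurableM U V : cmeasurable U -> cmeasurable V ->
  cmeasurable (fun w => U w * V w).
Proof.
move=> [u1 u2] [v1 v2]; split.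
  under eq_fun do rewrite ReM.
  apply: measurable_funD; apply: measurable_funM => //.
  exact: measurableT_comp.
under eq_fun do rewrite ImM.
by apply: measurable_funD; apply: measurable_funM.
Qed.

Lemma cmeasurableD U V : cmeasurable U -> cmeasurable V ->
  cmeasurable (fun w => U w + V w).
Proof.
move=> [u1 u2] [v1 v2]; split.
  by under eq_fun do rewrite raddfD; exact: measurable_funD.
by under eq_fun do rewrite raddfD; exact: measurable_funD.
Qed.

Lemma cmeasurableX U n : cmeasurable U -> cmeasurable (fun w => U w ^+ n).
Proof.
move=> h; elim: n => [|n ih].
  by under eq_fun do rewrite expr0; exact: cmeasurable_cst.
by under eq_fun do rewrite exprS; exact: cmeasurableM.
Qed.

Definition monomial a b w : C := plane w ^+ a * (plane w)^* ^+ b.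

Lemma cmeasurable_monomial a b : cmeasurable (monomial a b).
Proof.
apply: cmeasurableM; apply: cmeasurableX; first exact: cmeasurable_plane.
by apply: cmeasurable_conj; exact: cmeasurable_plane.
Qed.

Lemma sqr_normc_plane w : nc (plane w) ^+ 2 = w.1 ^+ 2 + w.2 ^+ 2.
Proof. by rewrite sqr_normcE. Qed.

Lemma disc_normc r w : 0 <= r -> disc r w <-> nc (plane w) < r.
Proof.
move=> r0; rewrite /disc/= -sqr_normc_plane.
by rewrite ltr_pXn2r ?nnegrE ?normc_ge0.
Qed.

Lemma measurable_disc r : measurable (disc r).
Proof.
have -> : disc r = setT `&` (fun w : T2 => w.1 ^+ 2 + w.2 ^+ 2) @^-1` `]-oo, r ^+ 2[.
  by rewrite setTI; apply/seteqP; split => w /=; rewrite in_itv.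
have m : measurable_fun setT (fun w : T2 => w.1 ^+ 2 + w.2 ^+ 2).
  apply: measurable_funD; apply: measurable_funX.
    exact: measurable_fst.
  exact: measurable_snd.
by apply: m => //; exact: measurable_itv.
Qed.

Lemma disc_sub_square r : 0 <= r -> disc r `<=` `[-r, r] `*` `[-r, r].
Proof.
move=> r0 w; rewrite /disc/= !in_itv/= => h.
split; rewrite -ler_norml -(@ler_pXn2r _ 2)// ?nnegrE// real_normK ?num_real//.
  by rewrite (le_trans _ (ltW h))// lerDl sqr_ge0.
by rewrite (le_trans _ (ltW h))// lerDr sqr_ge0.
Qed.

Lemma area_square (a b : R) : a <= b ->
  area (`[a, b]%classic `*` `[a, b]%classic) = ((b - a) ^+ 2)%:E.
Proof.
move=> ab; have m : measurable (`[a, b]%classic : set (measurableTypeR R)).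
  exact: measurable_itv.
have := @product_measure1E _ _ _ _ R lam lam _ _ m m.
move=> E; rewrite [LHS]E expr2 EFinM.
by congr (_ * _)%E; exact: itvcc_measure.
Qed.

Lemma disc_finite r : 0 <= r -> (area (disc r) < +oo)%E.
Proof.
move=> r0; have h : - r <= r by rewrite ge0_cp.
have ms : measurable (`[-r, r]%classic `*` `[-r, r]%classic : set T2).
  by apply: measurableX; exact: measurable_itv.
apply: (le_lt_trans (le_measure area _ _ (disc_sub_square r0))).
- by rewrite inE; exact: measurable_disc.
- by rewrite inE.
- have := ltry ((r - - r) ^+ 2); rewrite -(area_square h); exact.
Qed.

Lemma disc_pos r : 0 < r -> (0 < area (disc r))%E.
Proof.
move=> r0; have r20 : 0 <= r / 2 by rewrite divr_ge0// ltW.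
have ms : measurable (`[0, r/2]%classic `*` `[0, r/2]%classic : set T2).
  by apply: measurableX; exact: measurable_itv.
apply: (@lt_le_trans _ _ (area (`[0, r/2]%classic `*` `[0, r/2]%classic))).
  have : (0 < ((r / 2 - 0) ^+ 2)%:E)%E.
    by rewrite subr0 lte_fin exprn_gt0// divr_gt0.
  by rewrite -(area_square r20); exact.
apply: le_measure; rewrite ?inE//; first exact: measurable_disc.
move=> w; rewrite /disc/= !in_itv/= => -[/andP[x0 x1] /andP[y0 y1]]; nra.
Qed.

Lemma bounded_cintegrable U r (M : R) : 0 <= r -> cmeasurable U ->
  (forall w, disc r w -> nc (U w) <= M) -> cintegrable area (disc r) U.
Proof.
move=> r0 [u1 u2] hM; split.
  apply: (@integrable_boundedR _ _ _ _ _ (measurable_disc r) (disc_finite r0) _ M).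
    exact: measurable_funTS.
  by move=> w /hM; exact/le_trans/le_Re_normc.
apply: (@integrable_boundedR _ _ _ _ _ (measurable_disc r) (disc_finite r0) _ M).
  exact: measurable_funTS.
by move=> w /hM; exact/le_trans/le_Im_normc.
Qed.

Lemma monomial_cintegrable r a b : 0 <= r -> cintegrable area (disc r) (monomial a b).
Proof.
move=> r0; apply: (@bounded_cintegrable _ _ (r ^+ a * r ^+ b)) => //.
  exact: cmeasurable_monomial.
move=> w /disc_normc -/(_ r0) /ltW wr; rewrite normcM !normcX normc_conj.
by rewrite ler_pM ?exprn_ge0 ?normc_ge0// lerXn2r ?nnegrE ?normc_ge0.
Qed.

(** A section of the disc is an interval at whose ends [P] vanishes. *)
Lemma section_zero (P : {poly C}) (c r : R) :
  (forall t, c ^+ 2 + t ^+ 2 = r ^+ 2 -> P.[t%:C] = 0) ->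
  (\int[lam]_(y in [set y | (c ^+ 2 + y ^+ 2 < r ^+ 2)%R])
    (complex.Re P^`().[y%:C])%:E = 0)%E.
Proof.
move=> h; have [cr|rc] := ltP (c ^+ 2) (r ^+ 2); last first.
  have -> : [set y | c ^+ 2 + y ^+ 2 < r ^+ 2] = set0.
    apply/seteqP; split => // y /=; apply/negP; rewrite -leNgt.
    by rewrite (le_trans rc)// lerDl sqr_ge0.
  by rewrite integral_set0.
pose s := Num.sqrt (r ^+ 2 - c ^+ 2).
have d0 : 0 < r ^+ 2 - c ^+ 2 by rewrite subr_gt0.
have s0 : 0 < s by rewrite sqrtr_gt0.
have s2 : s ^+ 2 = r ^+ 2 - c ^+ 2 by rewrite sqr_sqrtr// ltW.
have -> : [set y | c ^+ 2 + y ^+ 2 < r ^+ 2] = `]- s, s[%classic.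
  apply/seteqP; split => y /=; rewrite in_itv/= -ltr_norml.
    rewrite addrC -ltrBrDr -s2 => h1.
    by rewrite -(@ltr_pXn2r _ 2)// ?nnegrE ?(ltW s0)// real_normK// num_real.
  move=> h1; rewrite addrC -ltrBrDr -s2 -(real_normK (num_real y)).
  by rewrite ltr_pXn2r// ?nnegrE ?(ltW s0).
by apply: integral_deriv_vanishing => //; apply: h; rewrite ?sqrrN s2 addrC subrK.
Qed.

Let integrable_patch (f : T2 -> R) r :
  area.-integrable (disc r) (EFin \o f) ->
  area.-integrable setT ((EFin \o f) \_ (disc r)).
Proof. by move=> h; apply: (integrable_mkcond _ (measurable_disc r)).1. Qed.

Lemma fubini_zero_y (f : T2 -> R) r : area.-integrable (disc r) (EFin \o f) ->
  (forall x, \int[lam]_(y in [set y | (x ^+ 2 + y ^+ 2 < r ^+ 2)%R]) (f (x, y))%:E = 0)%E ->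
  (\int[area]_(w in disc r) (f w)%:E = 0)%E.
Proof.
move=> hf h; rewrite integral_mkcond -(integral12_prod_meas1 (integrable_patch hf)).
apply: integral0_eq => x _; rewrite -[RHS](h x) [RHS]integral_mkcond.
by apply: eq_integral => y _; rewrite /patch /disc !mem_setE.
Qed.

Lemma fubini_zero_x (f : T2 -> R) r : area.-integrable (disc r) (EFin \o f) ->
  (forall y, \int[lam]_(x in [set x | (y ^+ 2 + x ^+ 2 < r ^+ 2)%R]) (f (x, y))%:E = 0)%E ->
  (\int[area]_(w in disc r) (f w)%:E = 0)%E.
Proof.
move=> hf h; rewrite integral_mkcond -(integral21_prod_meas1 (integrable_patch hf)).
apply: integral0_eq => y _; rewrite -[RHS](h y) [RHS]integral_mkcond.
apply: eq_integral => x _; rewrite /patch.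
have -> // : (x \in [set x | y ^+ 2 + x ^+ 2 < r ^+ 2]) = ((x, y) \in disc r).
by apply/idP/idP; rewrite !inE /disc/= addrC.
Qed.

End DiscMoments.

Section Parseval.
Variable R : realType.
Local Notation C := R[i].
Local Notation nc := (@normc R).
Local Notation T2 := (measurableTypeR R * measurableTypeR R)%type.
Local Notation lam := (@lebesgue_measure R).
Local Notation area := (lam \x lam)%E.
Implicit Types (U V : T2 -> C) (r : R) (w : T2).

(** In one real variable both [z] and its conjugate are polynomials, so the
    partial derivatives of the field below are derivatives of polynomials. *)
Lemma deriv_product_eval (Z W : {poly C}) (K dz dw t : C) a b :
  Z^`() = dz%:P -> W^`() = dw%:P ->
  ((K%:P - Z * W) * (Z ^+ a * W ^+ b))^`().[t] =
  - (dz * W.[t] + Z.[t] * dw) * (Z.[t] ^+ a * W.[t] ^+ b) +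
  (K - Z.[t] * W.[t]) * (a%:R * dz * Z.[t] ^+ a.-1 * W.[t] ^+ b +
                         b%:R * dw * Z.[t] ^+ a * W.[t] ^+ b.-1).
Proof.
move=> hZ hW; rewrite !derivM derivB derivC derivM !deriv_exp hZ hW.
rewrite !(hornerD, hornerM, hornerN, hornerMn, hornerC, horner_exp) -(mulr_natr _ a) -(mulr_natr _ b).
by ring.
Qed.

Lemma natr_pow (z : C) n : n%:R * z * z ^+ n.-1 = n%:R * z ^+ n.
Proof. by case: n => [|n]; rewrite ?mul0r// -mulrA -exprS. Qed.

Definition moment r a b : C := cintegral area (disc r) (monomial a b).

Lemma cintegral_deriv_y r U (P : R -> {poly C}) : cintegrable area (disc r) U ->
  (forall x y, U (x, y) = (P x)^`().[y%:C]) ->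
  (forall x t, x ^+ 2 + t ^+ 2 = r ^+ 2 -> (P x).[t%:C] = 0) ->
  cintegral area (disc r) U = 0.
Proof.
move=> [u1 u2] UE PE; apply/eqP; rewrite eq_complex/=; apply/andP; split; apply/eqP.
  rewrite /Rintegral (@fubini_zero_y _ (fun w => complex.Re (U w)))// => x.
  under eq_integral do rewrite UE; apply: section_zero; exact: PE.
rewrite /Rintegral (@fubini_zero_y _ (fun w => complex.Im (U w)))// => x.
have -> : (fun y => (complex.Im (U (x, y)))%:E) =
    (fun y => (complex.Re ((- 'i) *: P x)^`().[y%:C])%:E).
  apply/funext => y; rewrite derivZ hornerZ -UE.
  by case: (U _) => c d /=; congr (_%:E); ring.
by apply: section_zero => t /PE; rewrite hornerZ => ->; rewrite mulr0.
Qed.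

Lemma cintegral_deriv_x r U (P : R -> {poly C}) : cintegrable area (disc r) U ->
  (forall x y, U (x, y) = (P y)^`().[x%:C]) ->
  (forall y t, y ^+ 2 + t ^+ 2 = r ^+ 2 -> (P y).[t%:C] = 0) ->
  cintegral area (disc r) U = 0.
Proof.
move=> [u1 u2] UE PE; apply/eqP; rewrite eq_complex/=; apply/andP; split; apply/eqP.
  rewrite /Rintegral (@fubini_zero_x _ (fun w => complex.Re (U w)))// => y.
  under eq_integral do rewrite UE; apply: section_zero; exact: PE.
rewrite /Rintegral (@fubini_zero_x _ (fun w => complex.Im (U w)))// => y.
have -> : (fun x => (complex.Im (U (x, y)))%:E) =
    (fun x => (complex.Re ((- 'i) *: P y)^`().[x%:C])%:E).
  apply/funext => x; rewrite derivZ hornerZ -UE.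
  by case: (U _) => c d /=; congr (_%:E); ring.
by apply: section_zero => t /PE; rewrite hornerZ => ->; rewrite mulr0.
Qed.

(** The divergence theorem on the disc for the field
    [(r^2 - |z|^2) z^a conj(z)^b], which vanishes on the boundary circle. *)
Lemma moment_relation r a b : 0 <= r ->
  (r ^+ 2)%:C * a%:R * moment r a.-1 b = a.+1%:R * moment r a b.+1.
Proof.
move=> r0; have mi c d := monomial_cintegrable c d r0.
pose K : C := (r ^+ 2)%:C.
(* [s = 1] and [s = -1] give the partial derivatives in [x] and, up to the
   factor ['i], in [y]; the terms with [s] cancel in the sum. *)
pose U s w : C := K * a%:R * monomial a.-1 b w + s * (K * b%:R) * monomial a b.-1 w -
  a.+1%:R * monomial a b.+1 w - s * b.+1%:R * monomial a.+1 b w.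
have UE s : cintegrable area (disc r) (U s) /\ cintegral area (disc r) (U s) =
    K * a%:R * moment r a.-1 b + s * (K * b%:R) * moment r a b.-1 -
    a.+1%:R * moment r a b.+1 - s * b.+1%:R * moment r a.+1 b.
  have m := measurable_disc r.
  by split; [do ![apply: cintegrableB|apply: cintegrableD|apply: cintegrableZ] => //|
    rewrite !cintegralB ?cintegralD ?cintegralZ//; do ![apply: cintegrableB|apply: cintegrableD|apply: cintegrableZ] => //].
have [iUx EUx] := UE 1; have [iUy EUy] := UE (-1).
have zx : cintegral area (disc r) (U 1) = 0.
  pose Z (y : R) : {poly C} := 'X + ('i * y%:C)%:P.
  pose W (y : R) : {poly C} := 'X - ('i * y%:C)%:P.
  apply: (@cintegral_deriv_x r (U 1) (fun y => (K%:P - Z y * W y) * (Z y ^+ a * W y ^+ b))) => //.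
    move=> x y; rewrite (@deriv_product_eval _ _ _ 1 1); last 2 first.
    - by rewrite /Z derivD derivX derivC addr0.
    - by rewrite /W derivB derivX derivC subr0.
    have zE : (Z y).[x%:C] = plane (x, y).
      by rewrite /Z !hornerE; apply/eqP; rewrite eq_complex/=; apply/andP; split; apply/eqP; ring.
    have wE : (W y).[x%:C] = (plane (x, y))^*.
      by rewrite /W !hornerE; apply/eqP; rewrite eq_complex/=; apply/andP; split; apply/eqP; ring.
    rewrite zE wE /U /monomial; set z := plane _; set z' := z^*.
    have e1 := natr_pow z a; have e2 := natr_pow z' b.
    rewrite !exprS -[a.+1%:R]natr1 -[b.+1%:R]natr1.
    have -> : (K - z * z') * (a%:R * 1 * z ^+ a.-1 * z' ^+ b + b%:R * 1 * z ^+ a * z' ^+ b.-1) =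
      K * (a%:R * z ^+ a.-1 * z' ^+ b + b%:R * z ^+ a * z' ^+ b.-1) -
      (a%:R * z * z ^+ a.-1) * z' * z' ^+ b - (b%:R * z' * z' ^+ b.-1) * z * z ^+ a by ring.
    by rewrite e1 e2; ring.
  move=> y t yt; rewrite hornerM; apply/eqP; rewrite mulf_eq0; apply/orP; left.
  rewrite /Z /W !hornerE /K -yt; apply/eqP/eqP; rewrite eq_complex/=.
  by apply/andP; split; apply/eqP; ring.
have zy : cintegral area (disc r) (U (-1)) = 0.
  pose j : C := 'i%C.
  pose Z (x : R) : {poly C} := j *: 'X + (x%:C)%:P.
  pose W (x : R) : {poly C} := - j *: 'X + (x%:C)%:P.
  have : cintegral area (disc r) (fun w => j * U (-1) w) = 0.
    apply: (@cintegral_deriv_y r _ (fun x => (K%:P - Z x * W x) * (Z x ^+ a * W x ^+ b))).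
    - exact: cintegrableZ (measurable_disc r) _ _ iUy.
    - move=> x y; rewrite (@deriv_product_eval _ _ _ j (- j)); last 2 first.
      + by rewrite /Z derivD derivZ derivX derivC addr0 alg_polyC.
      + by rewrite /W derivD derivZ derivX derivC addr0 alg_polyC.
      have zE : (Z x).[y%:C] = plane (x, y).
        by rewrite /Z !hornerE /j; apply/eqP; rewrite eq_complex/=; apply/andP; split; apply/eqP; ring.
      have wE : (W x).[y%:C] = (plane (x, y))^*.
        by rewrite /W !hornerE /j; apply/eqP; rewrite eq_complex/=; apply/andP; split; apply/eqP; ring.
      rewrite zE wE /U /monomial; set z := plane _; set z' := z^*.
      have e1 := natr_pow z a; have e2 := natr_pow z' b.
      rewrite !exprS -[a.+1%:R]natr1 -[b.+1%:R]natr1.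
      have -> : (K - z * z') * (a%:R * j * z ^+ a.-1 * z' ^+ b + b%:R * - j * z ^+ a * z' ^+ b.-1) =
        j * (K * (a%:R * z ^+ a.-1 * z' ^+ b - b%:R * z ^+ a * z' ^+ b.-1) -
        (a%:R * z * z ^+ a.-1) * z' * z' ^+ b + (b%:R * z' * z' ^+ b.-1) * z * z ^+ a) by ring.
      by rewrite e1 e2; ring.
    - move=> x t xt; rewrite hornerM; apply/eqP; rewrite mulf_eq0; apply/orP; left.
      rewrite /Z /W !hornerE /K -xt /j; apply/eqP/eqP; rewrite eq_complex/=.
      by apply/andP; split; apply/eqP; ring.
  rewrite cintegralZ//; last exact: measurable_disc.
  by move/eqP; rewrite mulf_eq0 -normc_eq0 /j normc_i oner_eq0/= => /eqP.
move: EUx EUy; rewrite zx zy => Ex Ey.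
apply/eqP; rewrite -subr_eq0; apply/eqP.
have two : (2 : C) != 0 by rewrite pnatr_eq0.
apply: (mulfI two); rewrite mulr0 -/K.
transitivity ((K * a%:R * moment r a.-1 b + 1 * (K * b%:R) * moment r a b.-1 -
    a.+1%:R * moment r a b.+1 - 1 * b.+1%:R * moment r a.+1 b) +
  (K * a%:R * moment r a.-1 b + -1 * (K * b%:R) * moment r a b.-1 -
    a.+1%:R * moment r a b.+1 - -1 * b.+1%:R * moment r a.+1 b)); first by ring.
by rewrite -Ex -Ey addr0.
Qed.

Lemma moment_conj r a b : 0 <= r -> moment r b a = (moment r a b)^*.
Proof.
move=> r0.
have monoC w : monomial b a w = (monomial a b w)^*.
  by rewrite /monomial rmorphM !rmorphXn [RHS]mulrC; congr (_ ^+ _ * _); rewrite -[RHS]/(_^*^*) conjcK.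
have h := monomial_cintegrable a b r0.
apply/eqP; rewrite eq_complex/=; apply/andP; split; apply/eqP.
  by apply: eq_Rintegral => w _; rewrite monoC; case: (monomial a b w).
rewrite -[RHS]mulN1r -RintegralZl; [|exact: measurable_disc|by case: h].
by apply: eq_Rintegral => w _; rewrite monoC mulN1r; case: (monomial a b w).
Qed.

Lemma moment00 r : 0 <= r -> moment r 0 0 = (fine (area (disc r)))%:C.
Proof.
move=> r0; have m := measurable_disc r; have f := disc_finite r0.
rewrite -[RHS]mul1r -cintegral_cst//.
by apply: eq_cintegral => w _; rewrite /monomial !expr0 mulr1.
Qed.

(** The divergence relation lowers both exponents at once; when one of them is 0
    it kills the off-diagonal moments. The area of the disc stays symbolic. *)
Lemma momentE r a b : 0 <= r -> moment r a b =
  (a == b)%:R * (r ^+ (2 * a) / a.+1%:R * fine (area (disc r)))%:C.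
Proof.
move=> r0; elim: b a => [|b ih] a.
  case: a => [|a]; first by rewrite moment00// muln0 expr0 divr1 !mul1r.
  have := moment_relation 0 a r0; rewrite mulr0 mul0r mul1r mul0r => h.
  by rewrite moment_conj// -h conjc0.
case: a => [|a].
  by have := moment_relation 0 b r0; rewrite mulr0 mul0r mul1r mul0r => <-.
have := moment_relation a.+1 b r0; rewrite -pred_Sn ih => h.
have a2 : (a.+2%:R : C) != 0 by rewrite pnatr_eq0.
apply: (mulfI a2); rewrite -h eqSS.
have aC n : (n%:R : C) = (n%:R : R)%:C by rewrite rmorph_nat.
rewrite mulnS exprD !mulrA; case: (a == b); last by rewrite !mulr0 !mul0r.
rewrite !mulr1 !aC -!rmorphM; congr (_%:C).
by field; apply/andP; split; rewrite gt_eqF// ltr_wpDr.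
Qed.

End Parseval.

(** * Parseval's formula for the disc *)

Section ParsevalLimit.
Variable R : realType.
Local Notation C := R[i].
Local Notation nc := (@normc R).
Local Notation T2 := (measurableTypeR R * measurableTypeR R)%type.
Local Notation lam := (@lebesgue_measure R).
Local Notation area := (lam \x lam)%E.
Implicit Types (a : nat -> C) (r : R) (w : T2).

Definition partial_psum a N w : C := \sum_(k < N) a k * plane w ^+ k.

Lemma cmeasurable_partial_psum a N : cmeasurable (partial_psum a N).
Proof.
rewrite /partial_psum; elim: N => [|N ih].
  have -> : (fun w => \sum_(k < 0) a k * plane w ^+ k) = (fun=> 0).
    by apply/funext => w; rewrite big_ord0.
  exact: cmeasurable_cst.
have -> : (fun w => \sum_(k < N.+1) a k * plane w ^+ k) =
    (fun w => \sum_(k < N) a k * plane w ^+ k + a N * plane w ^+ N).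
  by apply/funext => w; rewrite big_ord_recr.
apply: cmeasurableD => //; apply: cmeasurableM; first exact: cmeasurable_cst.
by apply: cmeasurableX; exact: cmeasurable_plane.
Qed.

Lemma measurable_normc2 U (D : set T2) : cmeasurable U ->
  measurable_fun D (fun w => nc (U w) ^+ 2).
Proof.
move=> [h1 h2]; under eq_fun do rewrite sqr_normcE.
by apply: measurable_funTS; apply: measurable_funD; exact: measurable_funX.
Qed.

Definition weighted_sum a N : R := \sum_(k < N) nc (a k) ^+ 2 / k.+1%:R.

(** Distinct monomials are orthogonal on a disc. *)
Lemma integral_partial_psum a N r : 0 <= r ->
  (\int[area]_(w in disc r) (nc (partial_psum a N w) ^+ 2)%:E =
   (fine (area (disc r)) * weighted_sum (fun k => a k * (r ^+ k)%:C) N)%:E)%E.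
Proof.
move=> r0; have m := measurable_disc r.
pose U k w : C := \sum_(l < N) (a k * (a l)^*) * monomial k l w.
have iM k l : cintegrable area (disc r) (fun w => (a k * (a l)^*) * monomial k l w).
  by apply: cintegrableZ => //; exact: monomial_cintegrable.
have iU k : cintegrable area (disc r) (U k) by have [] := cintegral_sum m N (iM k).
have EU (k : 'I_N) : cintegral area (disc r) (U k) =
    (nc (a k) ^+ 2 * (r ^+ (2 * k) / k.+1%:R * fine (area (disc r))))%:C.
  have [_ ->] := cintegral_sum m N (iM k).
  have -> : \sum_(l < N) cintegral area (disc r)
      (fun w => a k * (a l)^* * monomial k l w) =
      \sum_(l < N) a k * (a l)^* * moment r k l.
    by apply: eq_bigr => l _; rewrite cintegralZ//; exact: monomial_cintegrable.
  rewrite (bigD1 k)//= big1 ?addr0 => [|l lk]; last first.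
    rewrite momentE// (_ : (k == l :> nat) = false) ?mul0r ?mulr0//.
    by apply/negbTE; rewrite eq_sym.
  by rewrite momentE// eqxx mul1r mulc_conj -rmorphM.
have [iS ES] := cintegral_sum m N iU.
have SE w : \sum_(k < N) U k w = (nc (partial_psum a N w) ^+ 2)%:C.
  rewrite -mulc_conj /partial_psum rmorph_sum mulr_suml; apply: eq_bigr => k _.
  rewrite mulr_sumr; apply: eq_bigr => l _; rewrite /monomial rmorphM rmorphXn.
  by rewrite mulrACA.
have [i1 _] := eq_cintegrable m (fun w _ => SE w) iS.
have := congr1 (@complex.Re R) ES; rewrite (eq_cintegral _ (fun w _ => SE w)) /=.
have -> : \sum_(k < N) cintegral area (disc r) (U k) =
    (fine (area (disc r)) * weighted_sum (fun k => a k * (r ^+ k)%:C) N)%:C.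
  rewrite mulr_sumr rmorph_sum; apply: eq_bigr => k _; rewrite EU; congr (_%:C).
  rewrite normcM exprMn normcR_ge0 ?exprn_ge0// -exprM [(k * 2)%N]mulnC.
  by ring.
rewrite /= => <-; rewrite /Rintegral fineK//.
exact: (integrable_fin_num m i1).
Qed.

Section DiscLimit.
Variable a : nat -> C.
Hypothesis ha : disc_coef a.

Let energy w : \bar R := (nc (psum a (plane w)) ^+ 2)%:E.

Let partial_cvg r w : 0 <= r -> r < 1 -> disc r w ->
  (fun N => nc (partial_psum a N w) ^+ 2) @ \oo --> nc (psum a (plane w)) ^+ 2.
Proof.
move=> r0 r1 /disc_normc -/(_ r0) wr.
have w1 : nc (plane w) < 1 by exact: lt_trans r1.
have h : (fun N => nc (partial_psum a N w)) @ \oo --> nc (psum a (plane w)).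
  apply/cvgrPdist_lt => e e0; have [N hN] := psumP ha w1 e0.
  exists N => // n /hN; rewrite normcB; apply: le_lt_trans.
  exact: ler_normc_dist.
by under eq_fun do rewrite expr2; rewrite expr2; exact: cvgM.
Qed.

Lemma measurable_energy r : 0 <= r -> r < 1 -> measurable_fun (disc r) energy.
Proof.
move=> r0 r1; apply/measurable_EFinP.
apply: (@measurable_fun_cvg _ _ _ _ (fun N w => nc (partial_psum a N w) ^+ 2)).
  by move=> N; apply: measurable_normc2; exact: cmeasurable_partial_psum.
by move=> w wr; exact: (partial_cvg r0 r1 wr).
Qed.

Lemma integral_energy r : 0 <= r -> r < 1 ->
  (fun N => (fine (area (disc r)) *
      weighted_sum (fun k => a k * (r ^+ k)%:C) N)%:E) @ \oo -->
  (\int[area]_(w in disc r) energy w)%E.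
Proof.
move=> r0 r1.
have [M [q [M0 q0 q1 hM]]] := disc_coef_geometric ha r0 r1.
pose B := (M / (1 - q)) ^+ 2.
have B0 : 0 <= B by exact: sqr_ge0.
have iB : area.-integrable (disc r) (EFin \o (fun=> B)).
  by apply: integrable_cstR; [exact: measurable_disc|exact: disc_finite].
have := @dominated_convergence _ _ R area (disc r) (measurable_disc r)
  (fun N w => (nc (partial_psum a N w) ^+ 2)%:E) energy (EFin \o (fun=> B)).
case.
- move=> N; apply/measurable_EFinP.
  by apply: measurable_normc2; exact: cmeasurable_partial_psum.
- exact: measurable_energy.
- apply: aeW => w wr; apply: cvg_EFin; first exact: nearW.
  exact: (partial_cvg r0 r1 wr).
- exact: iB.
- apply: aeW => w N /disc_normc -/(_ r0) /ltW wr /=.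
  rewrite lee_fin ger0_norm ?sqr_ge0// lerXn2r ?nnegrE ?normc_ge0//.
    by rewrite divr_ge0// subr_ge0 ltW.
  exact: (@geometric_bounded_partial _ (fun k => a k * plane w ^+ k) N M q M0 q0 q1
    (fun n => hM n _ wr)).
move=> _ _; apply: cvg_trans; apply: near_eq_cvg; apply: nearW => N /=.
exact: integral_partial_psum.
Qed.

Let radius (j : nat) : R := 1 - j.+1%:R^-1.

Let radius_ge0 j : 0 <= radius j.
Proof. by rewrite subr_ge0 invf_le1// ler1n. Qed.

Let radius_lt1 j : radius j < 1.
Proof. by rewrite ltrBlDr ltrDl invr_gt0. Qed.

Let radius_mono : {homo radius : i j / (i <= j)%N >-> i <= j}.
Proof. by move=> i j ij; rewrite lerB// lef_pV2 ?posrE// ler_nat. Qed.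

Lemma disc_exhaustion : \bigcup_j disc (radius j) = disc 1 :> set T2.
Proof.
apply/seteqP; split => w.
  move=> [j _ /disc_normc -/(_ (radius_ge0 j)) h].
  by apply/disc_normc => //; exact: lt_trans (radius_lt1 j).
move=> /disc_normc -/(_ ler01) w1.
have d0 : 0 < 1 - nc (plane w) by rewrite subr_gt0.
have [n hn] : exists n : nat, (1 - nc (plane w))^-1 < n.+1%:R.
  exists (Num.bound (1 - nc (plane w))^-1).
  rewrite (lt_trans (archi_boundP _)) ?invr_ge0 ?ltW//.
  by rewrite ltr_nat.
exists n => //; apply/disc_normc => //.
rewrite /radius ltrBrDr addrC -ltrBrDr -[ltRHS]invrK ltf_pV2 ?posrE// invr_gt0.
by [].
Qed.

Let disc_mono : nondecreasing_seq (fun j => disc (radius j) : set T2).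
Proof.
move=> i j ij; apply/subsetPset => w /disc_normc -/(_ (radius_ge0 i)) h.
by apply/disc_normc => //; exact: lt_le_trans h (radius_mono ij).
Qed.

Let energy_ge0 w : (0 <= energy w)%E.
Proof. by rewrite lee_fin sqr_ge0. Qed.

Lemma measurable_energy1 : measurable_fun (disc 1) energy.
Proof.
rewrite -disc_exhaustion; apply/measurable_fun_bigcup => [j|j].
  exact: measurable_disc.
exact: measurable_energy.
Qed.

Lemma integral_energy_cvg :
  (fun j => \int[area]_(w in disc (radius j)) energy w)%E @ \oo -->
  (\int[area]_(w in disc 1) energy w)%E.
Proof.
rewrite -disc_exhaustion; apply: ge0_nondecreasing_set_cvg_integral => //.
- by move=> j; exact: measurable_disc.
- by move=> j; exact: measurable_energy.
Qed.

Lemma weighted_sum_scaled_le r N : 0 <= r -> r <= 1 ->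
  weighted_sum (fun k => a k * (r ^+ k)%:C) N <= weighted_sum a N.
Proof.
move=> r0 r1; apply: ler_sum => k _; rewrite ler_wpM2r ?invr_ge0//.
rewrite lerXn2r ?nnegrE ?normc_ge0// normcM normcR_ge0 ?exprn_ge0//.
by rewrite ler_piMr ?normc_ge0// exprn_ile1.
Qed.

Lemma integral_energy_le (S : R) : (forall N, weighted_sum a N <= S) ->
  (\int[area]_(w in disc 1) energy w <= (fine (area (disc 1)) * S)%:E)%E.
Proof.
move=> hS; have S0 : 0 <= S by have := hS 0%N; rewrite /weighted_sum big_ord0.
have finA r : 0 <= r -> area (disc r) \is a fin_num.
  by move=> r0; rewrite ge0_fin_numE// disc_finite.
apply: (cvge_to_le integral_energy_cvg); apply: nearW => j.
have rj := radius_ge0 j; have rj1 := radius_lt1 j.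
apply: (cvge_to_le (integral_energy rj rj1)); apply: nearW => N.
rewrite lee_fin ler_pM ?fine_ge0//.
- by apply: sumr_ge0 => k _; rewrite divr_ge0// sqr_ge0.
- apply: fine_le; rewrite ?finA//; apply: le_measure; rewrite ?inE.
  + exact: measurable_disc.
  + exact: measurable_disc.
  + move=> w /disc_normc -/(_ rj) h; apply/disc_normc => //.
    exact: lt_trans rj1.
- by rewrite (le_trans _ (hS N))// weighted_sum_scaled_le// ltW.
Qed.

Lemma integral_energy_ge N :
  ((fine (area (disc 1)) * weighted_sum a N)%:E <=
    \int[area]_(w in disc 1) energy w)%E.
Proof.
have finA r : 0 <= r -> area (disc r) \is a fin_num.
  by move=> r0; rewrite ge0_fin_numE// disc_finite.
have step j : ((fine (area (disc (radius j))) *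
    weighted_sum (fun k => a k * (radius j ^+ k)%:C) N)%:E <=
    \int[area]_(w in disc 1) energy w)%E.
  apply: (@le_trans _ _ (\int[area]_(w in disc (radius j)) energy w)%E); last first.
    apply: ge0_subset_integral => //.
    - exact: measurable_disc.
    - exact: measurable_disc.
    - exact: measurable_energy1.
    - move=> w /disc_normc -/(_ (radius_ge0 j)) h; apply/disc_normc => //.
      exact: lt_trans (radius_lt1 j).
  apply: (cvge_to_ge (integral_energy (radius_ge0 j) (radius_lt1 j))).
  exists N => // n Nn; rewrite lee_fin ler_wpM2l ?fine_ge0//.
  rewrite /weighted_sum -(subnKC Nn) big_split_ord/= lerDl.
  by apply: sumr_ge0 => k _; rewrite divr_ge0// sqr_ge0.
have [Ifin|] := boolP ((\int[area]_(w in disc 1) energy w)%E \is a fin_num); last first.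
  rewrite ge0_fin_numE ?integral_ge0// -leNgt leye_eq => /eqP ->.
  exact: leey.
rewrite -(fineK Ifin) lee_fin.
have cA : (fun j => fine (area (disc (radius j)))) @ \oo --> fine (area (disc 1)).
  apply: fine_cvg; rewrite fineK ?finA// -disc_exhaustion.
  apply: nondecreasing_cvg_mu => //; first by move=> j; exact: measurable_disc.
  by apply: bigcup_measurable => j _; exact: measurable_disc.
have cr : radius @ \oo --> (1 : R).
  rewrite -[X in _ --> X]subr0; apply: cvgB; first exact: cvg_cst.
  exact: cvg_harmonic.
have cW : (fun j => weighted_sum (fun k => a k * (radius j ^+ k)%:C) N) @ \oo -->
    weighted_sum a N.
  have term k : (fun j => nc (a k * (radius j ^+ k)%:C) ^+ 2 / k.+1%:R) @ \oo -->
      nc (a k) ^+ 2 / k.+1%:R.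
    have -> : (fun j => nc (a k * (radius j ^+ k)%:C) ^+ 2 / k.+1%:R) =
        (fun j => (nc (a k) ^+ 2 / k.+1%:R) * ('X^(k * 2)).[radius j]).
      apply/funext => j; rewrite normcM exprMn normcR_ge0 ?exprn_ge0//.
      by rewrite hornerXn exprM mulrAC.
    rewrite -[X in _ --> X]mulr1; apply: cvgMl_tmp.
    have := cvg_comp _ _ cr (@continuous_horner R 'X^(k * 2) 1).
    by rewrite hornerXn expr1n.
  rewrite /weighted_sum; elim: (N) => [|n ih].
    under eq_fun do rewrite big_ord0.
    by rewrite big_ord0; exact: cvg_cst.
  under eq_fun do rewrite big_ord_recr.
  by rewrite big_ord_recr /=; exact: cvgD ih (term n).
apply: (cvgr_to_le (cvgM cA cW)); apply: nearW => j.
by have := step j; rewrite -{1}(fineK Ifin) lee_fin.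
Qed.

End DiscLimit.

End ParsevalLimit.

(** * Zeros and roots of holomorphic functions *)

Section HolomorphicCalculus.
Variable R : realType.
Local Notation C := R[i].
Local Notation nc := (@normc R).
Implicit Types (f g h : C -> C) (z w a b : C) (c d : nat -> C) (s : seq C).

Lemma holomorphic_psum c : disc_coef c -> holomorphic (psum c).
Proof. by move=> hc z z1; exists (psum (deriv_coef c) z); exact: psum_deriv. Qed.

Lemma eq_holomorphic f g : (forall z, nc z < 1 -> f z = g z) ->
  holomorphic f -> holomorphic g.
Proof.
move=> fg hf z z1; have [l fl] := hf z z1; exists l.
apply: (@cder_near _ f g z l (1 - nc z)) => //; first by rewrite subr_gt0.
move=> w wz; apply: fg; rewrite -[w](subrK z) (le_lt_trans (le_normcD _ _))//.
by rewrite -ltrBrDr.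
Qed.

Lemma holomorphic_cst a : holomorphic (fun=> a).
Proof. by move=> z _; exists 0; exact: cder_cst. Qed.

Lemma holomorphic_id : holomorphic (fun z : C => z).
Proof. by move=> z _; exists 1; exact: cder_id. Qed.

Lemma holomorphicD f g : holomorphic f -> holomorphic g ->
  holomorphic (fun z => f z + g z).
Proof.
by move=> hf hg z z1; have [l hl] := hf z z1; have [m hm] := hg z z1;
  exists (l + m); exact: cderD.
Qed.

Lemma holomorphicB f g : holomorphic f -> holomorphic g ->
  holomorphic (fun z => f z - g z).
Proof.
by move=> hf hg z z1; have [l hl] := hf z z1; have [m hm] := hg z z1;
  exists (l - m); exact: cderB.
Qed.

Lemma holomorphicM f g : holomorphic f -> holomorphic g ->
  holomorphic (fun z => f z * g z).
Proof.
move=> hf hg z z1; have [l hl] := hf z z1; have [m hm] := hg z z1.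
by eexists; exact: cderM hl hm.
Qed.

Lemma holomorphicX f n : holomorphic f -> holomorphic (fun z => f z ^+ n).
Proof.
by move=> hf z z1; have [l hl] := hf z z1; eexists; exact: cderX hl.
Qed.

Lemma holomorphicV f : holomorphic f -> (forall z, nc z < 1 -> f z != 0) ->
  holomorphic (fun z => (f z)^-1).
Proof.
move=> hf f0 z z1; have [l hl] := hf z z1.
by eexists; apply: cderV hl; exact: f0.
Qed.

Definition root_prod s z : C := \prod_(b <- s) (z - b).

Lemma holomorphic_root_prod s : holomorphic (root_prod s).
Proof.
elim: s => [|b s ih].
  by apply: eq_holomorphic (holomorphic_cst 1) => z _; rewrite /root_prod big_nil.
apply: eq_holomorphic (holomorphicM (holomorphicB holomorphic_id (holomorphic_cst b)) ih).
by move=> z _; rewrite /root_prod big_cons.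
Qed.

Lemma holomorphic_derive1 f z : holomorphic f -> nc z < 1 ->
  cder f z ((f^`())%classic z).
Proof. by move=> hf z1; have [l fl] := hf z z1; rewrite (cder_derive1 fl). Qed.

Lemma eq_derive1 f g : (forall z, nc z < 1 -> f z = g z) -> holomorphic f ->
  forall z, nc z < 1 -> (f^`())%classic z = (g^`())%classic z.
Proof.
move=> fg hf z z1; apply/esym/cder_derive1.
apply: (@cder_near _ f g z _ (1 - nc z)).
- by rewrite subr_gt0.
- move=> w wz; apply: fg; rewrite -[w](subrK z) (le_lt_trans (le_normcD _ _))//.
  by rewrite -ltrBrDr.
- exact: holomorphic_derive1.
Qed.

Lemma derive1_psum c z : disc_coef c -> nc z < 1 ->
  ((psum c)^`())%classic z = psum (deriv_coef c) z.
Proof. by move=> hc z1; apply: cder_derive1; exact: psum_deriv. Qed.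

Lemma holomorphic_deriv f : holomorphic f -> holomorphic (f^`())%classic.
Proof.
move=> hf; have hc := taylor_disc_coef hf.
apply: eq_holomorphic (holomorphic_psum (disc_coef_deriv hc)) => z z1.
rewrite -(derive1_psum hc z1).
have E w : nc w < 1 -> psum (taylor_coef f) w = f w.
  by move=> w1; rewrite -taylor_series.
exact: (eq_derive1 E (holomorphic_psum hc) z1).
Qed.

Lemma holomorphic_derivn f n : holomorphic f -> holomorphic (f^`(n))%classic.
Proof.
move=> hf; elim: n => [|n ih]; first by rewrite derive1n0.
by rewrite derive1nS; exact: holomorphic_deriv.
Qed.

Lemma eq_derivn f g n : (forall z, nc z < 1 -> f z = g z) -> holomorphic f ->
  forall z, nc z < 1 -> (f^`(n))%classic z = (g^`(n))%classic z.
Proof.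
move=> fg hf; elim: n => [|n ih] z z1; first by rewrite !derive1n0 fg.
by rewrite !derive1nS; exact: (eq_derive1 ih (holomorphic_derivn n hf) z1).
Qed.

Lemma derivn_psum c n z : disc_coef c -> nc z < 1 ->
  ((psum c)^`(n))%classic z = psum (fun k => ((n + k) ^_ n)%:R * c (n + k)%N) z /\
  disc_coef (fun k => ((n + k) ^_ n)%:R * c (n + k)%N).
Proof.
move=> hc; elim: n z => [|n ih] z z1.
  have E : (fun k => ((0 + k) ^_ 0)%:R * c (0 + k)%N) = c.
    by apply/funext => k; rewrite ffactn0 mul1r.
  by rewrite E derive1n0.
have [_ hn] := ih z z1.
have E : deriv_coef (fun k => ((n + k) ^_ n)%:R * c (n + k)%N) =
    (fun k => ((n.+1 + k) ^_ n.+1)%:R * c (n.+1 + k)%N).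
  apply/funext => k; rewrite /deriv_coef mulrA -natrM addnS addSn; congr (_%:R * _).
  by rewrite ffactnSr mulnC; congr (_ * _)%N; lia.
rewrite derive1nS -E; split; last exact: disc_coef_deriv.
rewrite -(derive1_psum hn z1).
have ih' w : nc w < 1 -> ((psum c)^`(n))%classic w =
    psum (fun k => ((n + k) ^_ n)%:R * c (n + k)%N) w.
  by move=> w1; have [] := ih w w1.
exact: (eq_derive1 ih' (holomorphic_derivn n (holomorphic_psum hc)) z1).
Qed.

Lemma derivn_taylor0 f n : holomorphic f ->
  (f^`(n))%classic 0 = n`!%:R * taylor_coef f n.
Proof.
move=> hf; have hc := taylor_disc_coef hf; have n0 : nc (0 : C) < 1 by rewrite normc0.
have S w : nc w < 1 -> f w = psum (taylor_coef f) w by exact: taylor_series.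
rewrite (eq_derivn n S hf n0).
by have [-> h] := derivn_psum n hc n0; rewrite psum0// addn0 ffactnn.
Qed.

Lemma taylor_coef_unique f c : disc_coef c -> holomorphic f ->
  (forall z, nc z < 1 -> f z = psum c z) -> taylor_coef f = c.
Proof.
move=> hc hf fc; apply: psum_inj => //; first exact: taylor_disc_coef.
by move=> z z1; rewrite -(taylor_series hf z1) fc.
Qed.

Lemma taylor_psum c : disc_coef c -> taylor_coef (psum c) = c.
Proof. by move=> hc; apply: taylor_coef_unique => //; exact: holomorphic_psum. Qed.

Lemma eq_taylor f g : holomorphic f -> (forall z, nc z < 1 -> f z = g z) ->
  taylor_coef f = taylor_coef g.
Proof.
move=> hf fg; have hg := eq_holomorphic fg hf.
apply: taylor_coef_unique => //; first exact: taylor_disc_coef.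
by move=> z z1; rewrite (fg z z1) (taylor_series hg z1).
Qed.

(** Synthetic division of a power series by [z - a]; [B] lists the successive
    Horner tails at [a]. *)
Lemma holomorphic_divide f a : holomorphic f -> nc a < 1 -> f a = 0 ->
  exists2 g, holomorphic g & forall z, nc z < 1 -> f z = (z - a) * g z.
Proof.
move=> hf a1 fa.
have [c hc fc] : exists2 c, disc_coef c & forall z, nc z < 1 -> f z = psum c z.
  by exists (taylor_coef f); [exact: taylor_disc_coef|move=> z; exact: (taylor_series hf)].
pose B n := psum (fun i => c (n + i)%N) a.
have hcn n : disc_coef (fun i => c (n + i)%N).
  elim: n => [//|n ih].
  have -> : (fun i => c (n.+1 + i)%N) = (fun i => c (n + i.+1)%N).
    by apply/funext => i; rewrite addSnnS.
  exact: disc_coef_shift ih.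
have BS n : B n = c n + a * B n.+1.
  rewrite /B (psum_shift (hcn n) a1) addn0; congr (_ + _ * psum _ _).
  by apply/funext => i; rewrite addSnnS.
have hB : disc_coef B.
  move=> r r0 r1; pose s := Num.max r ((1 + nc a) / 2).
  have as' : nc a < s by rewrite lt_max; apply/orP; right; lra.
  have s1 : s < 1 by rewrite gt_max r1/=; lra.
  have rs : r <= s by rewrite le_max lexx.
  have s0 : 0 < s by exact: lt_le_trans rs.
  have [M M0 hM] := disc_coef_bound hc s0 s1.
  have q0 : 0 <= nc a / s by rewrite divr_ge0 ?normc_ge0// ltW.
  have q1 : nc a / s < 1 by rewrite ltr_pdivrMr// mul1r.
  exists (M / (1 - nc a / s)) => [|n].
    by rewrite divr_ge0// subr_ge0 ltW.
  have hn i : nc (c (n + i)%N * a ^+ i) <= (M * s^-1 ^+ n) * (nc a / s) ^+ i.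
    rewrite normcM normcX exprMn [_ * s^-1 ^+ i]mulrC mulrA -[M * _ * _]mulrA -exprD.
    by rewrite ler_wpM2r ?exprn_ge0 ?normc_ge0.
  have M'0 : 0 <= M * s^-1 ^+ n by rewrite mulr_ge0// exprn_ge0// invr_ge0 ltW.
  have := csum_le M'0 q0 q1 hn; rewrite -[csum _]/(B n) => hb.
  rewrite (le_trans (ler_wpM2r (exprn_ge0 n (ltW r0)) hb))//.
  have -> : M * s^-1 ^+ n / (1 - nc a / s) * r ^+ n = M / (1 - nc a / s) * (s^-1 * r) ^+ n.
    by rewrite exprMn mulrA; congr (_ * _); rewrite mulrAC.
  rewrite ler_piMr//.
    by rewrite divr_ge0// subr_ge0 ltW.
  rewrite exprn_ile1// ?(mulr_ge0, invr_ge0) ?(ltW r0) ?(ltW s0)//.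
  by rewrite mulrC ler_pdivrMr// mul1r.
have B0 : B 0%N = 0 by rewrite -fa (fc _ a1).
exists (psum (fun n => B n.+1)); first exact/holomorphic_psum/disc_coef_shift.
move=> z z1; rewrite mulrBl.
have -> : z * psum (fun n => B n.+1) z = psum B z.
  by rewrite [RHS]psum_shift// B0 add0r.
have -> : a * psum (fun n => B n.+1) z = psum B z - psum c z.
  rewrite -psumZ//; last exact: disc_coef_shift.
  rewrite -psumB//; congr psum; apply/funext => n.
  by rewrite (BS n) addrC addKr.
by rewrite subKr (fc _ z1).
Qed.

(** Leibniz' rule, in which the factor [z - a] has a single nonzero derivative. *)
Lemma derivn_linear_factor f g a n z : holomorphic g ->
  (forall z, nc z < 1 -> f z = (z - a) * g z) -> nc z < 1 ->
  (f^`(n))%classic z =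
    (z - a) * (g^`(n))%classic z + n%:R * (g^`(n.-1))%classic z.
Proof.
move=> hg fg; elim: n z => [|n ih] z z1.
  by rewrite !derive1n0 fg// mul0r addr0.
pose F w := (w - a) * (g^`(n))%classic w + n%:R * (g^`(n.-1))%classic w.
have hl : holomorphic (fun w => w - a).
  exact: holomorphicB holomorphic_id (holomorphic_cst a).
have hF : holomorphic F.
  apply: holomorphicD; apply: holomorphicM => //; try exact: holomorphic_derivn.
  exact: holomorphic_cst.
have E w : nc w < 1 -> F w = (f^`(n))%classic w by move=> w1; rewrite ih.
rewrite derive1nS -(eq_derive1 E hF z1).
have d1 := cderM (cderB (cder_id z) (cder_cst a z))
  (holomorphic_derive1 (holomorphic_derivn n hg) z1).
have d2 := cderZ n%:R (holomorphic_derive1 (holomorphic_derivn n.-1 hg) z1).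
rewrite (cder_derive1 (cderD d1 d2)) -!derive1nS -pred_Sn -[n.+1%:R]natr1.
clear ih F hF E d1 d2.
case: n => [|n]; rewrite -?pred_Sn;
  set u := (_^`(_))%classic z; set v := (_^`(_))%classic z; move: u v => u v; ring.
Qed.

Definition vanishes f a m := forall k, (k < m)%N -> (f^`(k))%classic a = 0.

Lemma vanishes_factor_same f g a m : holomorphic g -> nc a < 1 ->
  (forall z, nc z < 1 -> f z = (z - a) * g z) ->
  vanishes f a m.+1 <-> vanishes g a m.
Proof.
move=> hg a1 fg; split=> h k km.
  have := h k.+1; rewrite ltnS => /(_ km).
  rewrite (derivn_linear_factor k.+1 hg fg a1) subrr mul0r add0r => /eqP.
  by rewrite mulf_eq0 pnatr_eq0/= => /eqP.
rewrite (derivn_linear_factor k hg fg a1) subrr mul0r add0r.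
by case: k km => [|k] km; [rewrite mul0r|rewrite h ?mulr0].
Qed.

Lemma vanishes_factor_other f g a b m : holomorphic g -> nc a < 1 -> a != b ->
  (forall z, nc z < 1 -> f z = (z - b) * g z) ->
  vanishes f a m <-> vanishes g a m.
Proof.
move=> hg a1 ab fg; have ab0 : a - b != 0 by rewrite subr_eq0.
split=> h k; last first.
  move=> km; rewrite (derivn_linear_factor k hg fg a1) (h k km) mulr0 add0r.
  by rewrite h ?mulr0// (leq_ltn_trans (leq_pred k)).
elim: k => [|k ih] km.
  have := h _ km; rewrite (derivn_linear_factor 0 hg fg a1) mul0r addr0 => /eqP.
  by rewrite mulf_eq0 (negbTE ab0) => /eqP.
have := h _ km; rewrite (derivn_linear_factor k.+1 hg fg a1) -pred_Sn.
rewrite (ih (ltnW km)) mulr0 addr0 => /eqP.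
by rewrite mulf_eq0 (negbTE ab0) => /eqP.
Qed.

(** Linear factors are split off one by one: each lowers the order of vanishing at
    its own root by one and leaves the other orders unchanged. *)
Lemma vanishes_factorization f s : holomorphic f -> (forall b, b \in s -> nc b < 1) ->
  (forall a, nc a < 1 -> vanishes f a (count_mem a s)) <->
  (exists2 g, holomorphic g & forall z, nc z < 1 -> f z = root_prod s z * g z).
Proof.
elim: s f => [|b s ih] f hf hs.
  split=> [_|_ a _ //]; exists f => // z _; by rewrite /root_prod big_nil mul1r.
have b1 : nc b < 1 by apply: hs; rewrite mem_head.
have hs' a : a \in s -> nc a < 1 by move=> h; apply: hs; rewrite in_cons h orbT.
split=> [h|[g hg fg]].
  have fb : f b = 0 by have := h b b1 0%N; rewrite /= eqxx => /(_ isT).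
  have [g hg fg] := holomorphic_divide hf b1 fb.
  have /(ih g hg hs')[g' hg' gg'] : forall a, nc a < 1 -> vanishes g a (count_mem a s).
    move=> a a1; have := h a a1; rewrite /=; have [<-|ba] := eqVneq b a.
      by move=> /(vanishes_factor_same _ hg b1 fg).
    by rewrite add0n => /(vanishes_factor_other _ hg a1 _ fg); apply; rewrite eq_sym.
  exists g' => // z z1.
  by rewrite fg// gg'// /root_prod big_cons mulrA.
pose g' z := root_prod s z * g z.
have hg' : holomorphic g' by apply: holomorphicM => //; exact: holomorphic_root_prod.
have fg' z : nc z < 1 -> f z = (z - b) * g' z.
  by move=> z1; rewrite fg// /root_prod big_cons mulrA.
have h : forall a, nc a < 1 -> vanishes g' a (count_mem a s).
  by apply/(ih g' hg' hs'); exists g.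
move=> a a1; have := h a a1; rewrite /=; have [<-|ba] := eqVneq b a.
  by move=> /(vanishes_factor_same _ hg' b1 fg').
by rewrite add0n => /(vanishes_factor_other _ hg' a1 _ fg'); apply; rewrite eq_sym.
Qed.

Lemma taylor_coefX f g n : holomorphic g ->
  (forall z, nc z < 1 -> f z = z ^+ n * g z) ->
  (forall k, (k < n)%N -> taylor_coef f k = 0) /\ taylor_coef f n = g 0.
Proof.
elim: n f => [|n ih] f hg fg.
  have hf : holomorphic f by apply: eq_holomorphic hg => z z1; rewrite fg// expr0 mul1r.
  have n0 : nc (0 : C) < 1 by rewrite normc0.
  split=> //; rewrite -(psum0 (taylor_disc_coef hf)) -taylor_series// fg//.
  by rewrite expr0 mul1r.
pose f' z := z ^+ n * g z.
have hf' : holomorphic f' by apply: holomorphicM => //; exact: holomorphicX holomorphic_id.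
have [h1 h2] := ih f' hg (fun z _ => erefl).
pose c k := if k is m.+1 then taylor_coef f' m else 0.
have hc : disc_coef c.
  move=> r r0 r1; have [M M0 hM] := taylor_disc_coef hf' r0 r1.
  exists M => // -[|k]; first by rewrite /c normc0 mul0r.
  rewrite /c exprSr mulrA (le_trans _ (hM k))// ler_piMr ?(ltW r1)//.
  by rewrite mulr_ge0 ?normc_ge0// exprn_ge0// ltW.
have hf : holomorphic f.
  apply: eq_holomorphic (holomorphicM holomorphic_id hf') => z z1.
  by rewrite fg// /f' exprS mulrA.
have E : taylor_coef f = c.
  apply: taylor_coef_unique => // z z1.
  by rewrite psum_shift// add0r -[psum _ z]taylor_series// fg// /f' exprS mulrA.
by rewrite E; split=> // -[|k] //=; rewrite ltnS; exact: h1.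
Qed.

Lemma holomorphic_constant f : holomorphic f ->
  (forall z, nc z < 1 -> (f^`())%classic z = 0) ->
  forall z, nc z < 1 -> f z = f 0.
Proof.
move=> hf f0; have hc := taylor_disc_coef hf.
have n0 : nc (0 : C) < 1 by rewrite normc0.
have E : deriv_coef (taylor_coef f) = (fun=> 0).
  apply: psum_inj; first exact: disc_coef_deriv.
    by move=> r r0 r1; exists 0 => // n; rewrite normc0 mul0r.
  move=> z z1; rewrite -(derive1_psum hc z1).
  have S w : nc w < 1 -> f w = psum (taylor_coef f) w by exact: taylor_series.
  rewrite -(eq_derive1 S hf z1) f0//.
  apply/esym/has_sum_csum => e e0; exists 0 => n _.
  by rewrite big1 ?subr0 ?normc0// => k _; rewrite mul0r.
have E2 n : taylor_coef f n.+1 = 0.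
  have := congr1 (fun u => u n) E; rewrite /deriv_coef => /eqP.
  by rewrite mulf_eq0 pnatr_eq0 => /eqP.
move=> z z1; rewrite (taylor_series hf z1) psum_shift// [RHS](taylor_series hf n0) psum0//.
have -> : (fun n => taylor_coef f n.+1) = (fun n => 0 * taylor_coef f n).
  by apply/funext => n; rewrite E2 mul0r.
by rewrite psumZ// mul0r mulr0 addr0.
Qed.

Lemma holomorphic_primitive f : holomorphic f ->
  exists2 F, holomorphic F & forall z, nc z < 1 -> cder F z (f z).
Proof.
move=> hf; pose c n := if n is m.+1 then taylor_coef f m / m.+1%:R else 0.
have hc : disc_coef c.
  move=> r r0 r1; have [M M0 hM] := taylor_disc_coef hf r0 r1.
  exists M => // -[|k]; first by rewrite /c normc0 mul0r.
  rewrite /c normcM normcV -(rmorph_nat (real_complex R)) normcR_ge0//.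
  rewrite exprSr mulrA; apply: (le_trans _ (hM k)).
  have h1 : nc (taylor_coef f k) / k.+1%:R <= nc (taylor_coef f k).
    by rewrite ler_piMr ?normc_ge0// invf_le1// ler1n.
  apply: (le_trans (ler_wpM2r (ltW r0) (ler_wpM2r (exprn_ge0 k (ltW r0)) h1))).
  by rewrite ler_piMr ?(ltW r1)// mulr_ge0 ?normc_ge0// exprn_ge0// ltW.
exists (psum c); first exact: holomorphic_psum.
move=> z z1; have := psum_deriv hc z1; rewrite (taylor_series hf z1).
congr cder; congr psum; apply/funext => n.
by rewrite /deriv_coef /c mulrCA divff ?mulr1// pnatr_eq0.
Qed.

(** The exponential of a primitive of [f^`() / (k f)] has a [k]-th power whose
    quotient by [f] is constant. *)
Lemma holomorphic_root f k : holomorphic f -> (forall z, nc z < 1 -> f z != 0) ->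
  (0 < k)%N -> exists2 h, holomorphic h & forall z, nc z < 1 -> h z ^+ k = f z.
Proof.
move=> hf f0 k0; have k0' : (k%:R : C) != 0 by rewrite pnatr_eq0 -lt0n.
have n0 : nc (0 : C) < 1 by rewrite normc0.
have hd := holomorphic_deriv hf.
have hq : holomorphic (fun z => (f^`())%classic z * (k%:R * f z)^-1).
  apply: holomorphicM => //; apply: holomorphicV.
    by apply: holomorphicM => //; exact: holomorphic_cst.
  by move=> z z1; rewrite mulf_neq0// f0.
have [L hL dL] := holomorphic_primitive hq.
pose E z := cexp (L z).
have dE z : nc z < 1 -> cder E z (E z * ((f^`())%classic z * (k%:R * f z)^-1)).
  by move=> z1; exact: cder_comp (dL z z1) (cexp_deriv _).
have hE : holomorphic E by move=> z z1; eexists; exact: dE.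
pose W z := E z ^+ k * (f z)^-1.
have hW : holomorphic W by apply: holomorphicM; [exact: holomorphicX|exact: holomorphicV].
have W' z : nc z < 1 -> (W^`())%classic z = 0.
  move=> z1; apply: cder_derive1.
  have fz := f0 z z1.
  have := cderM (cderX k (dE z z1)) (cderV fz (holomorphic_derive1 hf z1)).
  congr cder.
  have -> : k%:R * E z ^+ k.-1 * (E z * ((f^`())%classic z / (k%:R * f z))) =
      E z ^+ k * (f^`())%classic z / f z.
    have -> : E z ^+ k = E z * E z ^+ k.-1 by rewrite -exprS prednK.
    move: (E z ^+ k.-1) (E z) (f z) (f0 z z1) ((f^`())%classic z) => e w y y0 v.
    by field; rewrite y0 k0'.
  move: (E z ^+ k) (f z) fz ((f^`())%classic z) => e y y0 v.
  by field; rewrite y0.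
have WE z : nc z < 1 -> W z = W 0 by exact: holomorphic_constant.
have W0 : W 0 != 0.
  by rewrite mulf_neq0 ?invr_eq0 ?f0// expf_neq0// cexp_neq0.
pose rho := k.-root ((W 0)^-1).
exists (fun z => rho * E z); first by apply: holomorphicM => //; exact: holomorphic_cst.
move=> z z1; rewrite exprMn rootCK// -(WE z z1) /W invfM invrK.
by rewrite mulrC mulrA divff ?mul1r// expf_neq0// cexp_neq0.
Qed.

End HolomorphicCalculus.

(** * The inner product of coefficient sequences *)

(* The order of the scopes decides which of the two convertible conjugations
   [^*] denotes; from here on it is that of [ring_scope] in every position. *)
Local Open Scope ring_scope.

Section BergmanPairing.
Variable R : realType.
Local Notation C := R[i].
Local Notation nc := (@normc R).
Implicit Types (a b e h u v : nat -> C) (t : C).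

Lemma geometric_disc_coef u : geometric_bounded u -> disc_coef u.
Proof.
move=> [M [q [M0 q0 q1 h]]] r r0 r1; exists M => // n.
rewrite (le_trans (ler_wpM2r (exprn_ge0 n (ltW r0)) (h n)))//.
rewrite -mulrA -exprMn ler_piMr// exprn_ile1 ?mulr_ge0 ?(ltW r0)//.
by rewrite mulr_ile1// ltW.
Qed.

Lemma geometric_bounded_le u v : (forall n, nc (v n) <= nc (u n)) ->
  geometric_bounded u -> geometric_bounded v.
Proof.
move=> vu [M [q [M0 q0 q1 h]]]; exists M, q; split=> // n.
exact: le_trans (vu n) (h n).
Qed.

Lemma geometric_boundedM h u : disc_coef h -> geometric_bounded u ->
  geometric_bounded (fun n => h n * u n).
Proof.
move=> hh [M [q [M0 q0 q1 hu]]]; pose r := (1 + q) / 2.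
have qr : q < r by rewrite /r ltr_pdivlMr// mulr_natr mulr2n; lra.
have r1 : r < 1 by rewrite /r ltr_pdivrMr// mul1r; lra.
have r0 : 0 < r by exact: le_lt_trans qr.
have [N N0 hN] := disc_coef_bound hh r0 r1.
exists (N * M), (r^-1 * q); split.
- exact: mulr_ge0.
- by rewrite mulr_ge0 ?invr_ge0// ltW.
- by rewrite mulrC ltr_pdivrMr// mul1r.
- move=> n; rewrite normcM exprMn mulrACA ler_pM ?normc_ge0//.
Qed.

Lemma geometric_boundedD u v : geometric_bounded u -> geometric_bounded v ->
  geometric_bounded (fun n => u n + v n).
Proof.
move=> [M [q [M0 q0 q1 hu]]] [N [r [N0 r0 r1 hv]]].
exists (M + N), (Num.max q r); split.
- exact: addr_ge0.
- by rewrite le_max q0.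
- by rewrite gt_max q1.
move=> n; rewrite (le_trans (le_normcD _ _))// mulrDl lerD//.
  by rewrite (le_trans (hu n))// ler_wpM2l// lerXn2r ?nnegrE ?le_max ?q0 ?lexx.
by rewrite (le_trans (hv n))// ler_wpM2l// lerXn2r ?nnegrE ?le_max ?q0 ?r0 ?lexx ?orbT.
Qed.

Lemma geometric_boundedZ t u : geometric_bounded u ->
  geometric_bounded (fun n => t * u n).
Proof.
move=> [M [q [M0 q0 q1 hu]]]; exists (nc t * M), q; split=> //.
  by rewrite mulr_ge0 ?normc_ge0.
by move=> n; rewrite normcM -mulrA ler_wpM2l ?normc_ge0.
Qed.

Lemma geometric_boundedB u v : geometric_bounded u -> geometric_bounded v ->
  geometric_bounded (fun n => u n - v n).
Proof.
move=> hu hv; have := geometric_boundedD hu (geometric_boundedZ (-1) hv).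
by apply: geometric_bounded_le => n; rewrite mulN1r.
Qed.

Lemma geometric_bounded_unshift u : geometric_bounded (fun n => u n.+1) ->
  geometric_bounded u.
Proof.
move=> [M [q [M0 q0 q1 hu]]]; pose r := Num.max q (1 / 2).
have r0 : 0 < r by rewrite lt_max; apply/orP; right; rewrite divr_gt0.
have r1 : r < 1 by rewrite gt_max q1/= ltr_pdivrMr// mul1r ltr1n.
exists (nc (u 0%N) + M / r), r; split=> //; try exact: ltW.
  by rewrite addr_ge0 ?normc_ge0// divr_ge0// ltW.
move=> [|n].
  by rewrite expr0 mulr1 lerDl divr_ge0// ltW.
rewrite (le_trans (hu n))// mulrDl (@le_trans _ _ (M / r * r ^+ n.+1))//.
  rewrite exprS mulrA divfK ?gt_eqF// ler_wpM2l// lerXn2r ?nnegrE ?(ltW r0)//.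
  by rewrite le_max lexx.
by rewrite lerDr mulr_ge0 ?normc_ge0// exprn_ge0// ltW.
Qed.

Lemma geometric_bounded_fin u N : (forall n, (N <= n)%N -> u n = 0) ->
  geometric_bounded u.
Proof.
elim: N u => [|N ih] u u0.
  exists 0, 0; split=> // n; by rewrite u0// normc0 mul0r.
by apply: geometric_bounded_unshift; apply: ih => n Nn; rewrite u0.
Qed.

(** The inner product of the Bergman space [A^2] on the coefficient side. One
    argument is the sequence of a function holomorphic beyond the closed disc,
    so that the series converges for every [h]. *)
Definition pair h e : C := csum (fun n => h n * (e n)^* / n.+1%:R).

Lemma normc_natr n : nc (n%:R : C) = n%:R.
Proof. by rewrite -(rmorph_nat (real_complex R)) normcR_ge0. Qed.

Lemma pair_has_sum h e : disc_coef h -> geometric_bounded e ->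
  has_sum (fun n => h n * (e n)^* / n.+1%:R) (pair h e).
Proof.
move=> hh he; apply: geometric_bounded_sum.
apply: geometric_bounded_le (geometric_boundedM hh he) => n.
rewrite !normcM normc_conj normcV normc_natr ler_piMr ?mulr_ge0 ?normc_ge0//.
by rewrite invf_le1// ler1n.
Qed.

Lemma pair_linear t h g e : disc_coef h -> disc_coef g -> geometric_bounded e ->
  pair (fun n => t * h n + g n) e = t * pair h e + pair g e.
Proof.
move=> hh hg he; apply: has_sum_csum.
apply: eq_has_sum (has_sumD (has_sumZ t (pair_has_sum hh he)) (pair_has_sum hg he)) => n.
by rewrite !mulrDl !mulrA.
Qed.

Lemma pair_antilinear t h e f : disc_coef h -> geometric_bounded e ->
  geometric_bounded f ->
  pair h (fun n => t * e n + f n) = t^* * pair h e + pair h f.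
Proof.
move=> hh he hf; apply: has_sum_csum.
apply: eq_has_sum (has_sumD (has_sumZ t^* (pair_has_sum hh he)) (pair_has_sum hh hf)) => n.
by rewrite rmorphD rmorphM mulrDr mulrDl !mulrA; congr (_ / _ + _); rewrite mulrAC mulrC mulrA.
Qed.

Lemma pairBr h e f : disc_coef h -> geometric_bounded e -> geometric_bounded f ->
  pair h (fun n => e n - f n) = pair h e - pair h f.
Proof.
move=> hh he hf; have := pair_antilinear (-1) hh hf he.
rewrite rmorphN1 mulN1r addrC => <-; congr (pair h _); apply/funext => n.
by rewrite mulN1r addrC.
Qed.

Lemma pair_conj e f : geometric_bounded e -> geometric_bounded f ->
  pair e f = (pair f e)^*.
Proof.
move=> he hf; apply: has_sum_csum.
apply: eq_has_sum (has_sum_conj (pair_has_sum (geometric_disc_coef hf) he)) => n.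
rewrite -[LHS]/((f n * (e n)^* / n.+1%:R)^*%R).
by rewrite !rmorphM fmorphV rmorph_nat /= conjCK [_^* * _]mulrC.
Qed.

Lemma pair_dirac h m : disc_coef h ->
  pair h (fun n => (n == m)%:R) = h m / m.+1%:R.
Proof.
move=> hh; apply: has_sum_csum.
have E : \sum_(k < m.+1) h k * ((k == m :> nat)%:R : C)^* / k.+1%:R = h m / m.+1%:R.
  rewrite (bigD1 ord_max)//= eqxx rmorph1 mulr1 big1 ?addr0// => k km.
  by rewrite -val_eqE/= in km; rewrite (negbTE km) rmorph0 mulr0 mul0r.
rewrite -E; apply: has_sum_fin => n mn.
by rewrite gtn_eqF// rmorph0 mulr0 mul0r.
Qed.

Definition energy_norm a : R := complex.Re (pair a a).

Lemma weighted_sumE a N :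
  \sum_(k < N) a k * (a k)^* / k.+1%:R = (weighted_sum a N)%:C.
Proof.
rewrite /weighted_sum rmorph_sum; apply: eq_bigr => k _.
by rewrite mulc_conj [RHS](rmorphM (real_complex R)) fmorphV rmorph_nat.
Qed.

Lemma weighted_sum_homo a M N : (M <= N)%N -> weighted_sum a M <= weighted_sum a N.
Proof.
move=> MN; rewrite /weighted_sum -!(big_mkord xpredT (fun k => nc (a k) ^+ 2 / k.+1%:R)).
rewrite (big_cat_nat (leq0n M) MN)/= lerDl sumr_ge0// => k _.
by rewrite divr_ge0// sqr_ge0.
Qed.

Lemma weighted_sum_limit a (e : R) : geometric_bounded a -> 0 < e ->
  exists N, forall n, (N <= n)%N -> `|weighted_sum a n - energy_norm a| < e.
Proof.
move=> ha e0; have [N hN] := pair_has_sum (geometric_disc_coef ha) ha e0.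
exists N => n /hN; rewrite weighted_sumE; apply: le_lt_trans.
have -> : weighted_sum a n - energy_norm a =
    complex.Re ((weighted_sum a n)%:C - pair a a) by rewrite raddfB.
exact: le_Re_normc.
Qed.

Lemma weighted_sum_le a n : geometric_bounded a -> weighted_sum a n <= energy_norm a.
Proof.
move=> ha; apply/ler_addgt0Pr => e e0; have [N hN] := weighted_sum_limit ha e0.
have := hN (maxn n N) (leq_maxr _ _); rewrite ltr_distl => /andP[_ h].
by rewrite (le_trans (weighted_sum_homo a (leq_maxl n N)))// ltW.
Qed.

Lemma energy_norm_ge0 a : geometric_bounded a -> 0 <= energy_norm a.
Proof. by move=> ha; have := weighted_sum_le 0 ha; rewrite /weighted_sum big_ord0. Qed.

Lemma pair_self a : geometric_bounded a -> pair a a = (energy_norm a)%:C.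
Proof.
move=> ha; have := pair_conj ha ha; rewrite /energy_norm; case: (pair a a) => x y /=.
by move=> [] h; congr (_ +i* _); lra.
Qed.

Lemma weighted_sum0_eq0 a : (forall n, weighted_sum a n <= 0) -> forall n, a n = 0.
Proof.
move=> h n; have := h n.+1; rewrite /weighted_sum big_ord_recr/= => hn.
have h0 : 0 <= \sum_(i < n) nc (a i) ^+ 2 / i.+1%:R.
  by rewrite sumr_ge0// => k _; rewrite divr_ge0// sqr_ge0.
have : nc (a n) ^+ 2 / n.+1%:R <= 0 by rewrite (le_trans _ hn)// lerDr.
rewrite pmulr_lle0 ?invr_gt0// => h1.
by apply/eqP; rewrite -normc_eq0 -sqrf_eq0 eq_le h1 sqr_ge0.
Qed.

Lemma energy_norm_eq0 a : geometric_bounded a -> energy_norm a = 0 ->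
  forall n, a n = 0.
Proof.
by move=> ha a0; apply: weighted_sum0_eq0 => n; rewrite -a0 weighted_sum_le.
Qed.

Lemma sqr_normc_sub (w : R) (x y t : C) :
  nc (x - t * y) ^+ 2 * w = nc x ^+ 2 * w -
    2 * complex.Re (t^* * (x * y^*) * w%:C) + nc t ^+ 2 * (nc y ^+ 2 * w).
Proof.
by move: x y t => [x1 y1] [x2 y2] [x3 y3]; rewrite !sqr_normcE /=; ring.
Qed.

(** Expansion of the squared norm of [h - t v], where the squared norm of [h]
    is only known through a bound of its partial sums. *)
Lemma weighted_sum_sub_le h v t (S : R) N : disc_coef h -> geometric_bounded v ->
  (forall n, weighted_sum h n <= S) ->
  weighted_sum (fun n => h n - t * v n) N <=
    S - 2 * complex.Re (t^* * pair h v) + nc t ^+ 2 * energy_norm v.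
Proof.
move=> hh hv hS; apply/ler_addgt0Pr => e e0.
have d0 : 0 < e / 2 by rewrite divr_gt0.
have [M hM] := has_sumZ t^* (pair_has_sum hh hv) d0.
set n := maxn N M; rewrite (le_trans (weighted_sum_homo _ (leq_maxl N M)))// -/n.
have := hM n (leq_maxr _ _); set T := \sum_(k < n) _ => hT.
have hR : `|complex.Re T - complex.Re (t^* * pair h v)| < e / 2.
  by rewrite -raddfB (le_lt_trans (le_Re_normc _)).
have E : weighted_sum (fun n => h n - t * v n) n =
    weighted_sum h n - 2 * complex.Re T + nc t ^+ 2 * weighted_sum v n.
  rewrite /weighted_sum /T mulr_sumr raddf_sum mulr_sumr -sumrB -big_split/=.
  apply: eq_bigr => k _; rewrite mulrA.
  have -> : t^* * (h k * (v k)^*) / k.+1%:R = (t^* * (h k * (v k)^*)) * ((k.+1%:R)^-1)%:C.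
    by rewrite fmorphV rmorph_nat.
  exact: sqr_normc_sub.
have hT2 : - complex.Re T <= - complex.Re (t^* * pair h v) + e / 2.
  by move: hR; rewrite ltr_distl => /andP[h1 _]; lra.
have hv2 := ler_wpM2l (sqr_ge0 (nc t)) (weighted_sum_le n hv).
by rewrite E; have := hS n; lra.
Qed.

End BergmanPairing.

(** * Evaluation kernels *)

Section EvaluationKernels.
Variable R : realType.
Local Notation C := R[i].
Local Notation nc := (@normc R).
Implicit Types (a b z w : C) (h u v : nat -> C).

(** The coefficients of the element of [A^2] that represents the functional
    [f |-> f^`(j) b]: pairing [h] with it cancels the weight [n.+1] and leaves
    the series of the [j]-th derivative. *)
Definition kernel b j n : C := n.+1%:R * (n ^_ j)%:R * b^* ^+ (n - j).

Lemma has_sum_shiftn j u l : (forall n, (n < j)%N -> u n = 0) ->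
  has_sum (fun n => u (j + n)%N) l -> has_sum u l.
Proof.
elim: j u => [//|j ih] u u0 h.
rewrite -[l]add0r -(u0 0%N)//; apply: has_sumS; apply: ih => [n nj|].
  exact: u0.
exact: h.
Qed.

Lemma geometric_bounded_unshiftn j u :
  geometric_bounded (fun n => u (j + n)%N) -> geometric_bounded u.
Proof.
elim: j u => [//|j ih] u h.
by apply: geometric_bounded_unshift; apply: ih.
Qed.

Lemma disc_coef_cst a : disc_coef (fun=> a).
Proof.
move=> r r0 r1; exists (nc a) => [|n]; first exact: normc_ge0.
by rewrite ler_piMr ?normc_ge0// exprn_ile1// ltW.
Qed.

Lemma geometric_bounded_power b : nc b < 1 -> geometric_bounded (fun n => b ^+ n).
Proof.
move=> b1; exists 1, (nc b); split; rewrite ?normc_ge0// => n.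
by rewrite mul1r normcX.
Qed.

Lemma geometric_kernel b j : nc b < 1 -> geometric_bounded (kernel b j).
Proof.
move=> b1; apply: (@geometric_bounded_unshiftn j).
have n0 : nc (0 : C) < 1 by rewrite normc0.
have [_ hd] := derivn_psum j (disc_coef_natr (disc_coef_cst 1)) n0.
have hb : nc b^* < 1 by rewrite normc_conj.
have := geometric_boundedM hd (geometric_bounded_power hb).
apply: geometric_bounded_le => n.
by rewrite /kernel addnC addnK mulr1 [_.+1%:R * _]mulrC.
Qed.

Lemma pair_kernel h b j : disc_coef h -> nc b < 1 ->
  pair h (kernel b j) = ((psum h)^`(j))%classic b.
Proof.
move=> hh b1; have [-> hd] := derivn_psum j hh b1.
apply: has_sum_csum; apply: (@has_sum_shiftn j) => [n nj|].
  by rewrite /kernel ffact_small// mulr0 mul0r rmorph0 mulr0 mul0r.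
apply: eq_has_sum (psumP hd b1) => n.
have n0 : ((j + n).+1%:R : C) != 0 by rewrite pnatr_eq0.
rewrite /kernel !rmorphM rmorphXn !rmorph_nat /= conjCK addKn.
move: ((j + n).+1%:R : C) n0 (((j + n) ^_ j)%:R : C) (h (j + n)%N) (b ^+ n).
by move=> x x0 y z t; field.
Qed.

Lemma disc_coef_binomial m : disc_coef (fun k => 'C(k + m, m)%:R : C).
Proof.
have n0 : nc (0 : C) < 1 by rewrite normc0.
have [_ hd] := derivn_psum m (disc_coef_cst 1) n0.
move=> r r0 r1; have [M M0 hM] := hd r r0 r1; exists M => // n.
rewrite (le_trans _ (hM n))// ler_wpM2r ?exprn_ge0 ?(ltW r0)//.
rewrite mulr1 !normc_natr ler_nat addnC -bin_ffact leq_pmulr// fact_gt0//.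
Qed.

(** Multiplying by [1 - z] is a backward difference of the coefficients, which
    by Pascal's rule lowers [m] by one. *)
Lemma psum_binomial m z : nc z < 1 ->
  psum (fun k => 'C(k + m, m)%:R) z * (1 - z) ^+ m.+1 = 1.
Proof.
move=> z1.
have H (u : nat -> C) : disc_coef u ->
    psum u z * (1 - z) = u 0%N + z * psum (fun k => u k.+1 - u k) z.
  move=> hu; rewrite psumB//; last exact: disc_coef_shift.
  by rewrite mulrBr mulr1 {1}(psum_shift hu z1) mulrBr addrA [psum u z * z]mulrC.
elim: m => [|m ih].
  rewrite expr1 H; last exact: disc_coef_binomial.
  have -> : (fun k => 'C(k.+1 + 0, 0)%:R - 'C(k + 0, 0)%:R) = (fun k : nat => 0 * 1 : C).
    by apply/funext => k; rewrite !bin0 subrr mul0r.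
  rewrite (psumZ 0 (disc_coef_cst 1) z1).
  by rewrite mul0r mulr0 addr0 bin0.
rewrite exprS mulrA H; last exact: disc_coef_binomial.
rewrite -[RHS]ih (psum_shift (disc_coef_binomial m) z1) !add0n !binn.
congr ((_ + _ * _) * _); congr psum; apply/funext => k.
by rewrite [(k.+1 + m.+1)%N]addSn binS natrD addrAC subrr add0r addSnnS.
Qed.

Lemma psum_kernel b j w : nc b < 1 -> nc w < 1 ->
  psum (kernel b j) w = j.+1`!%:R * w ^+ j / (1 - b^* * w) ^+ (j + 2).
Proof.
move=> b1 w1; pose z := b^* * w.
have z1 : nc z < 1.
  rewrite normcM normc_conj (le_lt_trans _ b1)// ler_piMr ?normc_ge0//.
  exact: ltW.
have E := psum_binomial j.+1 z1.
have z0 : 1 - z != 0.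
  by rewrite subr_eq0 eq_sym; apply/eqP => h; move: z1; rewrite h normc1 ltxx.
have -> : (1 - b^* * w) ^- (j + 2) = psum (fun k => 'C(k + j.+1, j.+1)%:R) z.
  apply: (mulIf (x := (1 - z) ^+ j.+2)); first by rewrite expf_neq0.
  by rewrite E addn2 mulVf// expf_neq0.
apply: has_sum_csum; apply: (@has_sum_shiftn j) => [n nj|].
  by rewrite /kernel ffact_small// mulr0 !mul0r.
apply: eq_has_sum (has_sumZ (j.+1`!%:R * w ^+ j)
  (psumP (@disc_coef_binomial j.+1) z1)) => n.
have F : j.+1`!%:R * 'C(n + j.+1, j.+1)%:R = (j + n).+1%:R * ((j + n) ^_ j)%:R :> C.
  by rewrite -!natrM mulnC bin_ffact addnS addnC ffactSS.
rewrite /kernel addKn -F exprMn exprD.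
move: ('C(_, _)%:R : C) (j.+1`!%:R : C) (w ^+ j) (w ^+ n) (b^* ^+ n) => p1 p2 p3 p4 p5.
by ring.
Qed.

End EvaluationKernels.

(** * The extremal sequence of a zero list *)

Section ExtremalSequence.
Variable R : realType.
Local Notation C := R[i].
Local Notation nc := (@normc R).
Implicit Types (b z w : C) (h e u v : nat -> C) (s : seq C).

Lemma pair0 h : pair h (fun=> 0) = 0.
Proof.
apply: has_sum_csum => e e0; exists 0%N => n _.
by rewrite big1 ?subr0 ?normc0// => k _; rewrite rmorph0 mulr0 mul0r.
Qed.

(** Gram-Schmidt, one vector at a time. The third property of [e] says that [e]
    lies in the span of the [v i]; it is what lets a vector that depends on the
    earlier ones be skipped. *)
Lemma orthogonal_projection (T : eqType) (s : seq T) (v : T -> nat -> C)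
    (P : (nat -> C) -> Prop) (v0 : nat -> C) :
  P (fun=> 0) -> (forall t u v, P u -> P v -> P (fun n => t * u n + v n)) ->
  (forall i, i \in s -> geometric_bounded (v i) /\ P (v i)) ->
  geometric_bounded v0 ->
  exists e, [/\ geometric_bounded e, P e,
    forall h, disc_coef h -> (forall i, i \in s -> pair h (v i) = 0) -> pair h e = 0 &
    forall i, i \in s -> pair (fun n => v0 n - e n) (v i) = 0].
Proof.
move=> P0 Plin; elim: s v0 => [|i0 s ih] v0 hv g0.
  exists (fun=> 0); split=> //.
    by apply: (@geometric_bounded_fin _ _ 0).
  move=> h _ _; exact: pair0.
have hs i : i \in s -> geometric_bounded (v i) /\ P (v i).
  by move=> si; apply: hv; rewrite in_cons si orbT.
have [gi Pi] := hv i0 (mem_head _ _).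
have [e [ge Pe he oe]] := ih v0 hs g0.
have [f [gf Pf hf of_]] := ih (v i0) hs gi.
pose r n := v i0 n - f n.
have gr : geometric_bounded r by exact: geometric_boundedB.
have dr := geometric_disc_coef gr.
have gd := geometric_boundedB g0 ge; have dd := geometric_disc_coef gd.
have Pr : P r.
  have := Plin (-1) f (v i0) Pf Pi; congr P; apply/funext => n.
  by rewrite mulN1r addrC.
have split_i h : disc_coef h -> pair h (v i0) = pair h r + pair h f.
  move=> hh; rewrite pairBr// subrK//.
(* [v i0] already lies in the span of the earlier vectors. *)
have [r0|rn0] := eqVneq (energy_norm r) 0.
  exists e; split=> //.
    by move=> h hh hi; apply: he => // i si; apply: hi; rewrite in_cons si orbT.
  move=> i; rewrite in_cons => /orP[/eqP ->|]; last exact: oe.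
  rewrite (split_i _ dd) (hf _ dd oe) addr0.
  have r0' : r = (fun=> 0) by apply/funext => n; exact: energy_norm_eq0.
  by rewrite r0' pair0.
(* Otherwise remove from the defect its component along [r], the part of
   [v i0] orthogonal to the earlier vectors. *)
pose t := pair (fun n => v0 n - e n) r / pair r r.
pose e' n := t * r n + e n.
have ge' : geometric_bounded e' by apply: geometric_boundedD => //; exact: geometric_boundedZ.
have diff u : geometric_bounded u -> pair (fun n => v0 n - e' n) u =
    pair (fun n => v0 n - e n) u - t * pair r u.
  move=> gu; have := pair_linear (- t) dr dd gu; rewrite mulNr addrC => <-.
  by congr (pair _ u); apply/funext => n; rewrite /e' opprD mulNr addrCA.
have dd' := geometric_disc_coef (geometric_boundedB g0 ge').
exists e'; split=> //; first exact: Plin.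
  move=> h hh hi.
  have hsi i : i \in s -> pair h (v i) = 0 by move=> si; apply: hi; rewrite in_cons si orbT.
  rewrite pair_antilinear// (he h)// addr0.
  by have := hi i0 (mem_head _ _); rewrite split_i// (hf h)// addr0 => ->; rewrite mulr0.
have oe' i : i \in s -> pair (fun n => v0 n - e' n) (v i) = 0.
  by move=> si; have [gvi _] := hs i si; rewrite diff// oe// of_// mulr0 subr0.
move=> i; rewrite in_cons => /orP[/eqP ->|]; last exact: oe'.
rewrite split_i// (hf _ dd' oe') addr0 diff// /t divfK ?subrr//.
by rewrite pair_self// fmorph_eq0.
Qed.

(** The sequences of the holomorphic functions whose zeros include [s], with
    multiplicity. *)
Definition multiple s h := disc_coef h /\
  exists2 g, holomorphic g & forall z, nc z < 1 -> psum h z = root_prod s z * g z.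

(** Pairing with the kernels evaluates the derivatives at the points of [s]. *)
Lemma multiple_pairP s h : (forall b, b \in s -> nc b < 1) -> disc_coef h ->
  multiple s h <->
  (forall b j, (j < count_mem b s)%N -> pair h (kernel b j) = 0).
Proof.
move=> hs hh; have hf := holomorphic_psum hh.
have K := vanishes_factorization hf hs.
split=> [[_ hg] b j jb|hp].
  have b1 : nc b < 1.
    by apply: hs; rewrite -has_pred1 has_count (leq_ltn_trans _ jb).
  by rewrite pair_kernel//; exact: (K.2 hg).
split=> //; apply/K => b b1 j jb.
by rewrite -pair_kernel//; exact: hp.
Qed.

Lemma geometric_dirac m : geometric_bounded (fun n => (n == m)%:R : C).
Proof.
by apply: (@geometric_bounded_fin _ _ m.+1) => n mn; rewrite gtn_eqF.
Qed.

(** Subtracting from the [m]-th unit sequence its projection on the span of the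
    evaluation kernels yields a multiple of [s] whose inner product with a
    multiple [h] of [s] is the same as that of the unit sequence. The predicate
    [P] carries over to the projection any linear description of the kernels. *)
Lemma extremal_sequence s m (P : (nat -> C) -> Prop) :
  (forall b, b \in s -> nc b < 1) ->
  P (fun=> 0) -> (forall t u v, P u -> P v -> P (fun n => t * u n + v n)) ->
  (forall b j, (j < count_mem b s)%N -> P (kernel b j)) ->
  exists2 e, P e & let L := fun n => (n == m)%:R - e n in
    [/\ geometric_bounded L, multiple s L &
        forall h, multiple s h -> pair h L = h m / m.+1%:R].
Proof.
move=> hs P0 Plin PK.
have memC b j : (j < count_mem b s)%N -> b \in s.
  by move=> jb; rewrite -has_pred1 has_count (leq_ltn_trans _ jb).
pose T := [seq (b, j) | b <- s, j <- iota 0 (count_mem b s)].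
have memT b j : ((b, j) \in T) = (j < count_mem b s)%N.
  apply/allpairsPdep/idP => [[b' [j' [_ + [-> ->]]]]|jb]; first by rewrite mem_iota.
  by exists b, j; rewrite mem_iota (memC _ _ jb).
have [|e [ge Pe he oe]] := @orthogonal_projection _ T (fun i => kernel i.1 i.2) P
    (fun n => (n == m)%:R) P0 Plin _ (geometric_dirac m).
  move=> [b j]; rewrite memT => jb; split; last exact: PK.
  by apply: geometric_kernel; apply: hs; exact: memC jb.
exists e => //=; set L := fun n => _.
have gL : geometric_bounded L by exact: geometric_boundedB (geometric_dirac m) ge.
split=> //.
  apply/(multiple_pairP hs (geometric_disc_coef gL)) => b j jb.
  by apply: (oe (b, j)); rewrite memT.
move=> h hh; have [dh _] := hh; rewrite pairBr//; last exact: geometric_dirac.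
rewrite pair_dirac// he ?subr0// => -[b j]; rewrite memT => jb.
exact: (multiple_pairP hs dh).1.
Qed.

End ExtremalSequence.

(** * Absence of further zeros *)

Section ZeroFree.
Variable R : realType.
Local Notation C := R[i].
Local Notation nc := (@normc R).
Implicit Types (a b z w t : C) (h e u v y : nat -> C) (s : seq C).

(** The coefficients of [z * f z]. *)
Definition pad u n : C := if n is k.+1 then u k else 0.

Lemma geometric_pad u : geometric_bounded u -> geometric_bounded (pad u).
Proof. by move=> hu; apply: geometric_bounded_unshift; exact: hu. Qed.

Lemma psum_pad u z : geometric_bounded u -> nc z < 1 -> psum (pad u) z = z * psum u z.
Proof.
move=> /geometric_pad/geometric_disc_coef hu z1.
by rewrite (psum_shift hu z1) /= add0r.
Qed.

(** Division of a power series by [1 - t z], whose zero lies outside the closed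
    disc. *)
Lemma geometric_recursion t v : geometric_bounded v -> nc t < 1 ->
  exists2 y, geometric_bounded y & forall n, y n = t * pad y n + v n.
Proof.
move=> [M [q [M0 q0 q1 hv]]] t1.
pose y := fix y n := if n is k.+1 then t * y k + v n else v 0%N.
have yE n : y n = t * pad y n + v n by case: n => [|n] //=; rewrite mulr0 add0r.
exists y => //.
pose r := Num.max q ((1 + nc t) / 2).
have r1 : r < 1 by rewrite gt_max q1/= ltr_pdivrMr// mul1r; lra.
have tr : nc t < r.
  by rewrite lt_max; apply/orP; right; rewrite ltr_pdivlMr// mulr_natr mulr2n; lra.
have r0 : 0 < r by exact: le_lt_trans (normc_ge0 t) tr.
have qr : q <= r by rewrite le_max lexx.
have d0 : 0 < r - nc t by rewrite subr_gt0.
pose A := M * r / (r - nc t).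
have A0 : 0 <= A by rewrite divr_ge0 ?mulr_ge0// ltW.
exists A, r; split=> //; first exact: ltW.
have hv' n : nc (v n) <= M * r ^+ n.
  by rewrite (le_trans (hv n))// ler_wpM2l// lerXn2r// nnegrE// ltW.
have AE : nc t * A + M * r = A * r.
  by rewrite /A; field; rewrite gt_eqF.
elim=> [|n ih].
  rewrite /= (le_trans (hv' 0%N))// !expr0 !mulr1 /A ler_pdivlMr//.
  by rewrite ler_wpM2l// lerBlDr lerDl normc_ge0.
rewrite yE /= (le_trans (le_normcD _ _))// normcM exprS mulrA -AE mulrDl lerD//.
  by rewrite -mulrA ler_wpM2l ?normc_ge0.
by rewrite (le_trans (hv' _))// exprS mulrA.
Qed.

(** Synthetic division again: dividing out a zero keeps the geometric decay. *)
Lemma geometric_divide u a : geometric_bounded u -> nc a < 1 -> psum u a = 0 ->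
  exists2 v, geometric_bounded v & forall n, u n = pad v n - a * v n.
Proof.
move=> hu a1 ua; have [M [q [M0 q0 q1 h]]] := hu.
pose v n := psum (fun i => u (n.+1 + i)%N) a.
have gs n : geometric_bounded (fun i => u (n + i)%N).
  exists (M * q ^+ n), q; split=> //; first by rewrite mulr_ge0// exprn_ge0.
  by move=> i; rewrite -mulrA -exprD.
have vE n : psum (fun i => u (n + i)%N) a = u n + a * v n.
  rewrite (psum_shift (geometric_disc_coef (gs n)) a1) /= addn0 /v.
  by congr (_ + _ * psum _ _); apply/funext => i; rewrite addSnnS.
exists v.
  exists (M * q / (1 - q)), q; split=> //.
    by rewrite divr_ge0 ?mulr_ge0// subr_ge0 ltW.
  move=> n; rewrite [M * q / _]mulrAC -[_ * q * _]mulrA -exprS mulrAC.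
  apply: csum_le => // [|i]; first by rewrite mulr_ge0// exprn_ge0.
  rewrite normcM normcX -mulrA -exprD (le_trans _ (h _))// ler_piMr ?normc_ge0//.
  by rewrite exprn_ile1 ?normc_ge0// ltW.
move=> [|n] /=; rewrite -/(v _).
  have := vE 0%N; rewrite -[psum _ a]/(psum u a) ua => /eqP.
  by rewrite eq_sym addr_eq0 sub0r => /eqP.
have E : v n = u n.+1 + a * v n.+1 := vE n.+1.
by rewrite E addrK.
Qed.

Section NormComparison.
Variables (a : C) (y : nat -> C).
Let x := nc a ^+ 2.
Let al := 2 - x.
Hypothesis a1 : nc a < 1.
Hypothesis gy : geometric_bounded y.

(** The coefficients of [(a - z) (2 - |a|^2 - a^* z) y] and of
    [(1 - a^* z)^2 y]. *)
Definition dilated n : C := a * al%:C * y n - 2 * pad y n + a^* * pad (pad y) n.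
Definition reduced n : C := y n - 2 * a^* * pad y n + a^* ^+ 2 * pad (pad y) n.

Let comparison_algebra (y2 y1 y0 : C) :
  nc (a * al%:C * y2 - 2 * y1 + a^* * y0) ^+ 2 -
    al * nc (y2 - 2 * a^* * y1 + a^* ^+ 2 * y0) ^+ 2 =
  (1 - x) ^+ 2 * (4 * nc y1 ^+ 2 - al * nc y2 ^+ 2 + x * nc y0 ^+ 2 -
    4 * complex.Re (a * y1 * y0^*)).
Proof.
rewrite /al /x !sqr_normcE; move: a y2 y1 y0 => [? ?] [? ?] [? ?] [? ?] /=.
by ring.
Qed.

Let boundary n := nc (y n) ^+ 2 / n.+1%:R.

(** The two sides differ by a nonnegative multiple of
    [|(k + 1) y (k + 1) - a^* (k + 2) y k|^2]. *)
Let comparison_step k :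
  (1 - x) ^+ 2 * (x * (boundary k.+1 - boundary k) -
    al * (boundary k.+2 - boundary k.+1)) <=
  (nc (dilated k.+2) ^+ 2 - al * nc (reduced k.+2) ^+ 2) / k.+3%:R.
Proof.
rewrite /dilated /reduced /= comparison_algebra -subr_ge0.
have K0 : (0 : R) < k.+1%:R by [].
have E2 : k.+2%:R = k.+1%:R + 1 :> R by rewrite natr1.
have E3 : k.+3%:R = k.+1%:R + 2 :> R by rewrite -natrD addn2.
have S : nc (k.+1%:R * y k.+1 - a^* * k.+2%:R * y k) ^+ 2 =
    k.+1%:R ^+ 2 * nc (y k.+1) ^+ 2 + k.+2%:R ^+ 2 * x * nc (y k) ^+ 2 -
    2 * k.+1%:R * k.+2%:R * complex.Re (a * y k.+1 * (y k)^*).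
  rewrite -(rmorph_nat (real_complex R) k.+1) -(rmorph_nat (real_complex R) k.+2).
  rewrite /x !sqr_normcE.
  by move: k.+1%:R k.+2%:R a (y k.+1) (y k) => ? ? [? ?] [? ?] [? ?] /=; ring.
suff -> : (1 - x) ^+ 2 * (4 * nc (y k.+1) ^+ 2 - al * nc (y k.+2) ^+ 2 +
      x * nc (y k) ^+ 2 - 4 * complex.Re (a * y k.+1 * (y k)^*)) / k.+3%:R -
    (1 - x) ^+ 2 * (x * (boundary k.+1 - boundary k) -
      al * (boundary k.+2 - boundary k.+1)) =
    (1 - x) ^+ 2 * (2 * nc (k.+1%:R * y k.+1 - a^* * k.+2%:R * y k) ^+ 2 /
      (k.+1%:R * k.+2%:R * k.+3%:R)).
  apply: mulr_ge0; first exact: sqr_ge0.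
  apply: divr_ge0; last by apply: mulr_ge0; first apply: mulr_ge0.
  by apply: mulr_ge0 => //; exact: sqr_ge0.
rewrite S /boundary /al E2 E3.
move: K0 (complex.Re _) (nc (y k) ^+ 2) (nc (y k.+1) ^+ 2) (nc (y k.+2) ^+ 2) x.
move: (k.+1%:R : R) => K K0 c P0 P1 P2 X; field.
by rewrite !gt_eqF ?ltr_wpDr//.
Qed.

Let comparison_sum n :
  (1 - x) ^+ 2 * (x * boundary n - al * boundary n.+1) <=
  weighted_sum dilated n.+2 - al * weighted_sum reduced n.+2.
Proof.
elim: n => [|n ih].
  rewrite /weighted_sum !big_ord_recr !big_ord0/= !add0r.
  have := comparison_algebra (y 0%N) 0 0.
  have := comparison_algebra (y 1%N) (y 0%N) 0.
  rewrite /dilated /reduced /boundary /= !(rmorph0, mulr0, normc0, expr0n)/=.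
  rewrite !(addr0, subr0) !divr1 => h1 h2.
  have alE : al = 2 - x by [].
  move: h1 h2; move: (nc _ ^+ 2) (nc (_ - _ * y 0) ^+ 2) (nc (_ * _ * y 0%N) ^+ 2) => U V W.
  move: (nc _ ^+ 2) (nc (y 1%N) ^+ 2) => P Q h1 h2.
  have -> : V = al * U + (1 - x) ^+ 2 * (4 * P - al * Q) by rewrite -h1 addrC subrK.
  have -> : W = al * P + (1 - x) ^+ 2 * (0 - al * P) by rewrite -h2 addrC subrK.
  by rewrite alE le_eqVlt; apply/orP; left; apply/eqP; field.
have := comparison_step n.
have -> : weighted_sum dilated n.+3 =
    weighted_sum dilated n.+2 + nc (dilated n.+2) ^+ 2 / n.+3%:R.
  by rewrite /weighted_sum big_ord_recr.
have -> : weighted_sum reduced n.+3 =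
    weighted_sum reduced n.+2 + nc (reduced n.+2) ^+ 2 / n.+3%:R.
  by rewrite /weighted_sum big_ord_recr.
move: ih; set A := weighted_sum _ _; set B := weighted_sum _ _.
move: (boundary n.+2) (boundary n.+1) (boundary n) A B => b2 b1 b0 A B.
move: (nc (dilated _) ^+ 2) (nc (reduced _) ^+ 2) ((1 - x) ^+ 2) => U V c.
move: (n.+3%:R^-1 : R) => w ih hn.
have := lerD ih hn; congr (_ <= _); ring.
Qed.

(** The partial sums differ by a sum of squares and a boundary term that tends
    to zero. *)
Lemma norm_comparison : geometric_bounded dilated -> geometric_bounded reduced ->
  al * energy_norm reduced <= energy_norm dilated.
Proof.
move=> gd gr; apply/ler_addgt0Pr => e e0.
have x1 : x < 1 by rewrite expr_lt1// normc_ge0.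
have x0 : 0 <= x by exact: sqr_ge0.
have al0 : 0 < al by rewrite /al; lra.
have e2 : 0 < e / 2 / al by rewrite !divr_gt0.
have [N hN] := weighted_sum_limit gr e2.
have [N' hN'] : exists N, forall n, (N <= n)%N -> al * boundary n <= e / 2.
  have [M [q [M0 q0 q1 hM]]] := gy.
  have B n : boundary n <= M ^+ 2 / n.+1%:R.
    rewrite ler_pM2r ?invr_gt0// lerXn2r ?nnegrE ?normc_ge0// (le_trans (hM n))//.
    by rewrite ler_piMr// exprn_ile1// ltW.
  exists (Num.bound (al * M ^+ 2 / (e / 2))) => n hn.
  rewrite (le_trans (ler_wpM2l (ltW al0) (B n)))// mulrA ler_pdivrMr//.
  rewrite [X in _ <= X]mulrC -ler_pdivrMr ?divr_gt0//.
  rewrite ltW// (lt_le_trans (archi_boundP _))//.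
    by rewrite divr_ge0 ?mulr_ge0 ?sqr_ge0// ltW// divr_gt0.
  by rewrite ler_nat leqW.
pose n := maxn N N'.
have h1 := hN n.+2 (leqW (leqW (leq_maxl N N'))).
have h2 := hN' n.+1 (leqW (leq_maxr N N')).
have h3 := comparison_sum n.
have h4 := weighted_sum_le n.+2 gd.
have b0 : 0 <= boundary n by rewrite divr_ge0// sqr_ge0.
have b1 : 0 <= al * boundary n.+1 by rewrite mulr_ge0 ?(ltW al0)// divr_ge0// sqr_ge0.
have h5 : energy_norm reduced <= weighted_sum reduced n.+2 + e / 2 / al.
  by move: h1; rewrite ltr_distl => /andP[h _]; lra.
have h6 : al * energy_norm reduced <= al * weighted_sum reduced n.+2 + e / 2.
  have := ler_wpM2l (ltW al0) h5; rewrite mulrDr [al * (_ / al)]mulrC divfK//.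
  by rewrite gt_eqF.
have h7 : - (al * boundary n.+1) <=
    (1 - x) ^+ 2 * (x * boundary n - al * boundary n.+1).
  have c0 : 0 <= (1 - x) ^+ 2 <= 1.
    by rewrite sqr_ge0/= expr_le1//; lra.
  have /andP[c0' c1] := c0.
  have d0 : 0 <= x * boundary n by rewrite mulr_ge0.
  move: ((1 - x) ^+ 2) c0' c1 (x * boundary n) d0 (al * boundary n.+1) b1 => c c0' c1 p p0 q' q0.
  by nra.
by lra.
Qed.

End NormComparison.
End ZeroFree.

Section ExtremalZeroFree.
Variable R : realType.
Local Notation C := R[i].
Local Notation nc := (@normc R).
Implicit Types (a b z w t : C) (h u : nat -> C) (s : seq C).

Lemma root_prod_origin s : exists2 q, holomorphic q &
  q 0 != 0 /\ forall z : C, root_prod s z = z ^+ count_mem 0 s * q z.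
Proof.
elim: s => [|b s [q hq [q0 sq]]].
  exists (fun=> 1); first exact: holomorphic_cst.
  by split=> [|z]; rewrite ?oner_neq0// /root_prod big_nil expr0 mulr1.
have cons z : root_prod (b :: s) z = (z - b) * root_prod s z by rewrite /root_prod big_cons.
have [b0|bn0] := eqVneq b 0.
  exists q => //; split=> // z; rewrite cons sq b0 subr0 /= eqxx add1n exprS mulrA.
  by [].
exists (fun z => (z - b) * q z).
  by apply: holomorphicM => //; exact: holomorphicB (@holomorphic_id R) (holomorphic_cst b).
split=> [|z]; first by rewrite sub0r mulf_neq0// oppr_eq0.
by rewrite cons sq /= (negbTE bn0) add0n mulrCA.
Qed.

(** Beyond the forced zeros, the [m]-th coefficient of a multiple of [s], where
    [m] is the multiplicity of the origin in [s], is up to a fixed nonzero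
    factor the value of the cofactor at the origin. *)
Lemma multiple_leading_coef s : exists2 k : C, k != 0 &
  forall h g, disc_coef h -> holomorphic g ->
    (forall z, nc z < 1 -> psum h z = root_prod s z * g z) ->
    h (count_mem 0 s) = k * g 0.
Proof.
have [q hq [q0 sq]] := root_prod_origin s; exists (q 0) => // h g hh hg e.
have hqg := holomorphicM hq hg.
have e' z : nc z < 1 -> psum h z = z ^+ count_mem 0 s * (q z * g z).
  by move=> z1; rewrite e// sq mulrA.
by have [_] := taylor_coefX hqg e'; rewrite taylor_psum.
Qed.

(** At the point [a] itself, differentiate both sides once. *)
Lemma holomorphic_cancel f g a : holomorphic f -> holomorphic g ->
  (forall z, nc z < 1 -> (z - a) * f z = (z - a) * g z) ->
  forall z, nc z < 1 -> f z = g z.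
Proof.
move=> hf hg e z z1; have [za|za] := eqVneq z a; last first.
  by apply: (mulfI _ (e z z1)); rewrite subr_eq0.
pose F w := (w - a) * f w.
have hl : holomorphic (fun w => w - a) by exact: holomorphicB (@holomorphic_id R) (holomorphic_cst a).
have hF : (F^`(1))%classic z = (z - a) * (f^`(1))%classic z + 1%:R * (f^`(0))%classic z.
  exact: derivn_linear_factor.
have hG : (F^`(1))%classic z = (z - a) * (g^`(1))%classic z + 1%:R * (g^`(0))%classic z.
  exact: (derivn_linear_factor 1 hg e z1).
move: hG; rewrite hF !derive1n0 za subrr.
by move: ((f^`(1))%classic a) ((g^`(1))%classic a) => u v; rewrite !mul0r !add0r !mul1r.
Qed.

Section Extremal.
Variables (s : seq C) (L : nat -> C) (l : C -> C).
Let m := count_mem 0 s.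
Hypothesis hs : forall b, b \in s -> nc b < 1.
Hypothesis gL : geometric_bounded L.
Hypothesis hl : holomorphic l.
Hypothesis Ll : forall z, nc z < 1 -> psum L z = root_prod s z * l z.
Hypothesis extL : forall h, multiple s h -> pair h L = h m / m.+1%:R.

(** Extremality tested on [L] itself identifies the norm with the leading
    coefficient. It cannot vanish: the product of the linear factors of [s] pairs
    nontrivially with [L]. *)
Lemma extremal_energy : 0 < energy_norm L /\ L m = (energy_norm L * m.+1%:R)%:C.
Proof.
have m0 : (m.+1%:R : C) != 0 by rewrite pnatr_eq0.
have mL : multiple s L by split; [exact: geometric_disc_coef|exists l].
have E := extL mL.
split; last first.
  by rewrite (rmorphM (real_complex R)) rmorph_nat /= -pair_self// E divfK.
rewrite lt_neqAle energy_norm_ge0// andbT eq_sym; apply/eqP => L0.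
have [k k0 hk] := multiple_leading_coef s.
have h1 := @holomorphic_root_prod R s.
have d1 := taylor_disc_coef h1.
have e1 z : nc z < 1 -> psum (taylor_coef (root_prod s)) z = root_prod s z * 1.
  by move=> z1; rewrite -taylor_series// mulr1.
have m1 : multiple s (taylor_coef (root_prod s)).
  by split=> //; exists (fun=> 1) => //; exact: holomorphic_cst.
have := extL m1; rewrite (hk _ _ d1 (holomorphic_cst 1) e1) mulr1.
have -> : L = (fun=> 0) by apply/funext => n; exact: energy_norm_eq0.
rewrite pair0 => /esym/eqP; rewrite mulf_eq0 (negbTE k0) invr_eq0.
by rewrite (negbTE m0).
Qed.

(** If [L] had a further zero [a], replacing the factor [a - z] by a suitable
    multiple of [(1 - a^* z)^2 / (2 - |a|^2 - a^* z)] would give a multiple [u]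
    of [s] with a smaller ratio of the norm to the [m]-th coefficient, against
    the extremality of [L]. *)
Lemma extremal_zero_free z : nc z < 1 -> l z != 0.
Proof.
move=> a1; apply/eqP => la; move: z a1 la => a a1 la.
have [E0 Lm] := extremal_energy.
have m0 : (m.+1%:R : C) != 0 by rewrite pnatr_eq0.
have [k k0 hk] := multiple_leading_coef s.
have dL := geometric_disc_coef gL.
have Lm' := hk _ _ dL hl Ll; rewrite -/m in Lm'.
have Lm0 : L m != 0.
  by rewrite Lm fmorph_eq0 mulf_neq0 ?pnatr_eq0// gt_eqF.
have a0 : a != 0.
  by apply: contraNneq Lm0 => a0; move: la; rewrite a0 Lm' => ->; rewrite mulr0.
have [l1 hl1 ll1] := holomorphic_divide hl a1 la.
have La : psum L a = 0 by rewrite Ll// la mulr0.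
have [B gB LB] := geometric_divide gL a1 La.
have dB := geometric_disc_coef gB.
have psumL z : nc z < 1 -> psum L z = (z - a) * psum B z.
  move=> z1; have -> : L = (fun n => pad B n - a * B n) by apply/funext.
  rewrite psumB//; last exact: disc_coefZ.
    by rewrite psumZ// psum_pad// mulrBl.
  exact/geometric_disc_coef/geometric_pad.
have BE z : nc z < 1 -> psum B z = root_prod s z * l1 z.
  have hr : holomorphic (fun z => root_prod s z * l1 z).
    by apply: holomorphicM => //; exact: holomorphic_root_prod.
  apply: (holomorphic_cancel (holomorphic_psum dB) hr (a := a)) => w w1.
  by rewrite -psumL// Ll// ll1// mulrCA.
set x := nc a ^+ 2; pose al := 2 - x.
have x1 : x < 1 by rewrite expr_lt1// normc_ge0.
have x0 : 0 < x by rewrite exprn_gt0// normc_gt0.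
have al1 : 1 < al by rewrite /al; lra.
have alC0 : al%:C != 0 by rewrite fmorph_eq0 gt_eqF// (lt_trans ltr01).
have ta : nc (a^* / al%:C) < 1.
  rewrite normcM normcV normc_conj normcR_ge0; last by rewrite ltW// (lt_trans ltr01).
  by rewrite ltr_pdivrMr ?(lt_trans ltr01)// mul1r (lt_trans a1).
have gv : geometric_bounded (fun n => (- al%:C^-1) * B n) by exact: geometric_boundedZ.
have [y gy yE] := geometric_recursion gv ta.
have gp := geometric_pad gy; have gpp := geometric_pad gp.
have BY n : B n = a^* * pad y n - al%:C * y n.
  rewrite [X in _ - _ * X]yE; move: (al%:C) alC0 (pad y n) (B n) (a^*) => c c0 p b b'.
  by field.
have dil : dilated a y = L.
  apply/funext => n; rewrite /dilated LB -/x -/al.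
  have aa : a * a^* = 2 - al%:C.
    by rewrite mulc_conj /al rmorphB rmorph_nat opprB addrC subrK.
  case: n => [|n] /=; rewrite !BY /=.
    by clear aa; move: (al%:C) (y 0%N) (a^*) => c b b'; ring.
  have -> : a * (a^* * y n - al%:C * y n.+1) =
      (a * a^*) * y n - a * al%:C * y n.+1.
    by clear aa; move: (al%:C) (y n) (y n.+1) (a^*) => c p p' b'; ring.
  by rewrite aa; move: (al%:C) (y n) (y n.+1) (pad y n) (a^*) => c p p' p'' b'; ring.
have gd : geometric_bounded (dilated a y) by rewrite dil.
have gu : geometric_bounded (reduced a y).
  apply: geometric_boundedD; last exact: geometric_boundedZ.
  by apply: geometric_boundedB => //; exact: geometric_boundedZ.
have := norm_comparison a1 gy gd gu; rewrite dil -/x -/al.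
set u := reduced a y => cmp.
have du := geometric_disc_coef gu.
have den z : nc z < 1 -> al%:C - a^* * z != 0.
  move=> z1; rewrite subr_eq0; apply/eqP => /(congr1 nc).
  rewrite normcR_ge0 ?(ltW (lt_trans ltr01 al1))// normcM normc_conj => h.
  have : nc a * nc z < 1 by rewrite mulr_ilt1 ?normc_ge0.
  by rewrite -h ltNge (ltW al1).
pose g z := (1 - a^* * z) ^+ 2 * (- l1 z * (al%:C - a^* * z)^-1).
have haz : holomorphic (fun z => a^* * z).
  by apply: holomorphicM (@holomorphic_id R); exact: holomorphic_cst.
have hg : holomorphic g.
  apply: holomorphicM; first by apply: holomorphicX; apply: holomorphicB => //; exact: holomorphic_cst.
  apply: holomorphicM; last first.
    by apply: holomorphicV => //; apply: holomorphicB => //; exact: holomorphic_cst.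
  apply: eq_holomorphic (holomorphicM (holomorphic_cst (-1)) hl1) => z _.
  by rewrite mulN1r.
have dy := geometric_disc_coef gy.
have yS z : nc z < 1 -> psum B z = (a^* * z - al%:C) * psum y z.
  move=> z1; have -> : B = (fun n => a^* * pad y n - al%:C * y n) by apply/funext.
  have dp := geometric_disc_coef gp.
  by rewrite psumB ?psumZ ?psum_pad//; [ring|exact: disc_coefZ|exact: disc_coefZ].
have uS z : nc z < 1 -> psum u z = (1 - a^* * z) ^+ 2 * psum y z.
  move=> z1; rewrite /u /reduced.
  have dp := geometric_disc_coef gp; have dpp := geometric_disc_coef gpp.
  rewrite psumD//; [|exact: disc_coefB (disc_coefZ _ _)|exact: disc_coefZ].
  rewrite psumB//; last exact: disc_coefZ.
  by rewrite !psumZ// !psum_pad//; ring.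
have ug z : nc z < 1 -> psum u z = root_prod s z * g z.
  move=> z1; have := yS z z1; rewrite BE// => h.
  have -> : root_prod s z * g z = (1 - a^* * z) ^+ 2 *
      (- (root_prod s z * l1 z) * (al%:C - a^* * z)^-1) by rewrite /g; ring.
  rewrite h uS//; congr (_ * _); have := den z z1.
  by move: (psum y z) (a^* * z) => Y w w0; field.
have mu : multiple s u by split=> //; exists g.
have um : u m * (a * al%:C) = L m.
  have um' : u m = k * g 0 := hk _ _ du hg ug.
  rewrite Lm' um' /g ll1 ?normc0// mulr0 sub0r !subr0 expr1n mul1r.
  by move: (l1 0) (al%:C) alC0 => w c c0; field.
have pu : pair u L = (energy_norm L)%:C / (a * al%:C).
  have c0 : a * al%:C != 0 by rewrite mulf_neq0.
  rewrite extL// -[u m](mulfK c0) um Lm (rmorphM (real_complex R)) rmorph_nat /=.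
  move: (a * al%:C) c0 (energy_norm L)%:C (m.+1%:R : C) m0 => c c0 E n n0.
  by field; rewrite c0.
(* Cauchy-Schwarz for [u] and [L], as the positivity of the norm of
   [u - pair u L / |L|^2 * L]. *)
have := weighted_sum_sub_le (a * al%:C)^-1 0 du gL (fun n => weighted_sum_le n gu).
rewrite {1}/weighted_sum big_ord0 pu mulrCA.
have -> : ((a * al%:C)^-1)^* / (a * al%:C) = ((x * al ^+ 2)^-1)%:C.
  rewrite mulrC mulc_conj normcV normcM normcR_ge0 ?(ltW (lt_trans ltr01 al1))//.
  by rewrite exprVn exprMn.
rewrite -(rmorphM (real_complex R)) /= normcV normcM normcR_ge0 ?(ltW (lt_trans ltr01 al1))//.
rewrite exprVn exprMn -/x => h.
have X0 : 0 < x * al ^+ 2 by rewrite mulr_gt0// exprn_gt0// (lt_trans ltr01).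
have h1 : energy_norm L / (x * al ^+ 2) <= energy_norm u.
  move: h; rewrite [_^-1 * _]mulrC; lra.
have h2 : energy_norm L <= energy_norm u * (x * al ^+ 2) by rewrite -ler_pdivrMr.
have h3 : energy_norm L <= energy_norm L * (x * al).
  rewrite (le_trans h2)//.
  have -> : energy_norm u * (x * al ^+ 2) = (al * energy_norm u) * (x * al) by ring.
  by rewrite ler_wpM2r// mulr_ge0 ?(ltW x0)// ltW// (lt_trans ltr01).
have h4 : x * al < 1.
  rewrite -subr_gt0 (_ : 1 - x * al = (1 - x) ^+ 2); last by rewrite /al; ring.
  by rewrite exprn_gt0// subr_gt0.
by move: h3; rewrite leNgt gtr_pMr ?h4.
Qed.

End Extremal.
End ExtremalZeroFree.

(** * The power of the canonical divisor *)

Section BergmanNorm.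
Variable R : realType.
Local Notation C := R[i].
Local Notation nc := (@normc R).
Local Notation lam := (@lebesgue_measure R).
Local Notation area := (lam \x lam)%E.
Local Notation disc_area := (fine (area (disc 1))).
Implicit Types (f : C -> C) (h : nat -> C) (k : nat).

Lemma disc_area_gt0 : 0 < disc_area.
Proof. by apply: fine_gt0; rewrite disc_pos ?disc_finite. Qed.

Lemma derivable_holomorphic f :
  (forall z, unit_disc z -> derivable f z 1) <-> holomorphic f.
Proof.
split=> h z z1; first by apply/derivable_cder; apply: h; apply/unit_discE.
by apply/derivable_cder; apply: h; apply/unit_discE.
Qed.

Lemma unit_disc_plane :
  [set w | @unit_disc R (w.1 +i* w.2)] = disc 1 :> set (measurableTypeR R * measurableTypeR R).
Proof.
apply/seteqP; split=> w /=; first by move/unit_discE => h; apply/disc_normc.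
by move=> /disc_normc h; apply/unit_discE; exact: h.
Qed.

(** For an even exponent, the norm of [f] in [A^p] is determined by that of
    [f ^+ (p / 2)] in [A^2]. *)
Lemma bergman_norm1P f k : (0 < k)%N -> holomorphic f ->
  bergman_norm (k.*2)%:R f = 1%E <->
  (\int[area]_(w in disc 1)
     (nc (psum (taylor_coef (fun z => (f z ^+ k)%R)) (plane w)) ^+ 2)%:E = (pi : R)%:E)%E.
Proof.
move=> k0 hf; have hfk := holomorphicX k hf; have hd := taylor_disc_coef hfk.
set h := taylor_coef _ in hd *; set I := (\int[area]_(w in _) _)%E.
have I0 : (0 <= I)%E by apply: integral_ge0 => w _; rewrite lee_fin sqr_ge0.
have p0 : (0 : R) < k.*2%:R by rewrite ltr0n double_gt0.
have -> : bergman_norm (k.*2)%:R f = poweR ((pi^-1)%:E * I) (k.*2%:R^-1).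
  rewrite /bergman_norm unit_disc_plane; congr poweR.
  have I0' w : disc 1 w -> (0 <= (nc (psum h (plane w)) ^+ 2)%:E)%E.
    by move=> _; rewrite lee_fin sqr_ge0.
  have := ge0_integral_mscale (lam \x lam)%E (measurable_disc 1)
    (NngNum (invpi_ge0 R)) (measurable_energy1 hd) I0'.
  rewrite -[X in (_ = X * _)%E]/((pi^-1)%:E) => <-.
  apply: eq_integral => w; rewrite inE => /disc_normc -/(_ ler01) w1.
  rewrite powR_mulrn ?normc_ge0// -muln2 exprM -(normcX (f _)).
  by congr (nc _ ^+ 2)%:E; rewrite -[RHS](taylor_series hfk w1).
have pi0 := pi_gt0 R.
split=> [e|->]; last first.
  by rewrite -EFinM mulVf ?gt_eqF// poweR1r.
have : ((pi^-1)%:E * I = 1)%E.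
  have X0 : (0 <= (pi^-1)%:E * I)%E by rewrite mule_ge0// lee_fin invr_ge0 ltW.
  have : poweR ((pi^-1)%:E * I) (k.*2%:R^-1 * k.*2%:R) = 1%E.
    by rewrite poweRrM e poweR1r.
  by rewrite mulVf ?lt0r_neq0// poweRe1.
move=> /(congr1 (fun X => pi%:E * X)%E).
by rewrite muleA -EFinM mulfV ?gt_eqF// mul1e mule1.
Qed.

Lemma weighted_sum_unit h : disc_coef h ->
  (\int[area]_(w in disc 1) (nc (psum h (plane w)) ^+ 2)%:E = (pi : R)%:E)%E ->
  forall N, weighted_sum h N <= pi / disc_area.
Proof.
move=> hh e N; rewrite ler_pdivlMr ?disc_area_gt0// mulrC -lee_fin -e.
exact: integral_energy_ge.
Qed.

Lemma integral_energy_geometric h : geometric_bounded h ->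
  (\int[area]_(w in disc 1) (nc (psum h (plane w)) ^+ 2)%:E =
   (disc_area * energy_norm h)%:E)%E.
Proof.
move=> gh; have dh := geometric_disc_coef gh; apply/eqP; rewrite eq_le; apply/andP; split.
  by apply: integral_energy_le => // N; exact: weighted_sum_le.
apply/lee_addgt0Pr => e e0; have A0 := disc_area_gt0.
have [N hN] := weighted_sum_limit gh (divr_gt0 e0 A0).
have := hN N (leqnn N); rewrite ltr_distl => /andP[h1 _].
apply: (@le_trans _ _ ((disc_area * weighted_sum h N)%:E + e%:E)%E); last first.
  by rewrite leeD2r//; exact: integral_energy_ge.
rewrite -EFinD lee_fin -lerBlDr -ler_pdivrMl// mulrBr mulKf ?gt_eqF//.
by rewrite mulrC ltW.
Qed.

End BergmanNorm.

Section CanonicalDivisorPower.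
Variable R : realType.
Local Notation C := R[i].
Local Notation nc := (@normc R).
Local Notation area := (@lebesgue_measure R \x @lebesgue_measure R)%E.
Local Notation disc_area := (fine (area (disc 1))).
Implicit Types (f g : C -> C) (e h u v : nat -> C) (s : seq C) (k m : nat).

Lemma root_prod_power s k z : root_prod (flatten (nseq k s)) z = root_prod s z ^+ k.
Proof.
elim: k => [|k ih]; first by rewrite /root_prod big_nil expr0.
by rewrite /= {1}/root_prod big_cat exprS -/(root_prod _ _) -/(root_prod _ _) ih.
Qed.

Lemma count_power (T : eqType) (s : seq T) a k :
  count_mem a (flatten (nseq k s)) = (k * count_mem a s)%N.
Proof. by elim: k => [|k ih] //=; rewrite count_cat ih mulSn. Qed.

Lemma taylor_coef_scale c f n : holomorphic f ->
  taylor_coef (fun z => c * f z) n = c * taylor_coef f n.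
Proof.
move=> hf; have hd := taylor_disc_coef hf.
have hc : holomorphic (fun z => c * f z) := holomorphicM (holomorphic_cst c) hf.
have E : taylor_coef (fun z => c * f z) = (fun n => c * taylor_coef f n).
  apply: taylor_coef_unique => //; first exact: disc_coefZ.
  by move=> z z1; rewrite psumZ// (taylor_series hf z1).
by rewrite E.
Qed.

(** Both coefficients are the first ones that the zeros at the origin allow. *)
Lemma taylor_coef_power s f g k : holomorphic g ->
  (forall z, nc z < 1 -> f z = root_prod s z * g z) ->
  taylor_coef (fun z => f z ^+ k) (k * count_mem 0 s) =
  taylor_coef f (count_mem 0 s) ^+ k.
Proof.
move=> hg fg; have [q hq [q0 sq]] := root_prod_origin s.
have hqg := holomorphicM hq hg.
have e1 z : nc z < 1 -> f z = z ^+ count_mem 0 s * (q z * g z).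
  by move=> z1; rewrite fg// sq mulrA.
have e2 z : nc z < 1 -> f z ^+ k = z ^+ (k * count_mem 0 s) * (q z * g z) ^+ k.
  by move=> z1; rewrite e1// exprMn mulnC exprM.
have [_ ->] := taylor_coefX hqg e1.
by have [_ ->] := taylor_coefX (holomorphicX k hqg) e2.
Qed.

Lemma energy_normZ c u : geometric_bounded u ->
  energy_norm (fun n => c * u n) = nc c ^+ 2 * energy_norm u.
Proof.
move=> gu; have du := geometric_disc_coef gu.
have E : pair (fun n => c * u n) (fun n => c * u n) = (nc c ^+ 2 * energy_norm u)%:C.
  rewrite (rmorphM (real_complex R)) /= -mulc_conj -pair_self//.
  apply: has_sum_csum; apply: eq_has_sum (has_sumZ (c * c^*) (pair_has_sum du gu)) => n.
  by rewrite rmorphM /=; move: (c^*) (u n)^* => c' u'; ring.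
by rewrite /energy_norm E.
Qed.

Lemma psum_dirac m z : nc z < 1 -> psum (fun n => (n == m)%:R) z = z ^+ m.
Proof.
move=> z1; apply: has_sum_csum.
have E : \sum_(k < m.+1) (k == m :> nat)%:R * z ^+ k = z ^+ m.
  rewrite (bigD1 ord_max)//= eqxx mul1r big1 ?addr0// => k km.
  by rewrite -val_eqE/= in km; rewrite (negbTE km) mul0r.
by rewrite -E; apply: has_sum_fin => n mn; rewrite gtn_eqF// mul0r.
Qed.

(** The extremal sequence [L] of the zero set counted [k] times has no other
    zeros, so it is the [k]-th power of a competitor of [G]. The competitor
    bounds the leading coefficient of [G ^+ k] from below by that of the
    rescaled [L]; as both have the same norm, they coincide. *)
Lemma canonical_divisor_power s k G (P : (nat -> C) -> Prop) : (0 < k)%N ->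
  (forall b, b \in s -> nc b < 1) ->
  canonical_divisor (k.*2)%:R (fun a => count_mem a s) G ->
  P (fun=> 0) -> (forall t u v, P u -> P v -> P (fun n => t * u n + v n)) ->
  (forall b j, nc b < 1 -> (j < k * count_mem b s)%N -> P (kernel b j)) ->
  exists (t : C) e, P e /\ forall w, nc w < 1 ->
    G w ^+ k = t * (w ^+ (k * count_mem 0 s) - psum e w).
Proof.
move=> k0 hs [[[dG _] vG] nG G0 Gmax] P0 Plin PK.
have hG : holomorphic G by exact/derivable_holomorphic.
set m0 := count_mem 0 s in G0 Gmax *; set m := (k * m0)%N.
pose sk := flatten (nseq k s).
have cnt b : count_mem b sk = (k * count_mem b s)%N by exact: count_power.
have hsk b : b \in sk -> nc b < 1.
  by move=> /flattenP[x /nseqP[-> _]]; exact: hs.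
have [|e Pe] := @extremal_sequence _ sk m P hsk P0 Plin.
  move=> b j; rewrite cnt => jb; apply: PK => //; apply: hs.
  rewrite -has_pred1 has_count; move: jb; case: (count_mem b s) => //.
  by rewrite muln0.
set L := fun n => (n == m)%:R - e n; rewrite /= => -[gL [dL [l hl Ll]] extL].
have mE : m = count_mem 0 sk by rewrite cnt.
rewrite mE in extL.
have [E0 Lm] := extremal_energy gL hl Ll extL.
have l0 := extremal_zero_free gL hl Ll extL.
have [r hr rl] := holomorphic_root hl l0 k0.
pose F1 z := root_prod s z * r z.
have hF1 : holomorphic F1 by apply: holomorphicM => //; exact: holomorphic_root_prod.
have F1k z : nc z < 1 -> F1 z ^+ k = psum L z.
  by move=> z1; rewrite exprMn rl// Ll// root_prod_power.
have [v vE] : exists x, taylor_coef F1 m0 = x by exists (taylor_coef F1 m0).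
have Lv : L m = v ^+ k.
  rewrite -vE -(taylor_coef_power k hr (fun z _ => erefl (F1 z))).
  by rewrite (eq_taylor (holomorphicX k hF1) F1k) taylor_psum.
have Lm0 : L m = (energy_norm L * m.+1%:R)%:C by rewrite mE.
have v0 : v != 0.
  apply: contraTneq isT => v0; move: Lv; rewrite Lm0 v0 expr0n gtn_eqF//.
  by move=> /eqP; rewrite fmorph_eq0 mulf_eq0 pnatr_eq0 orbF gt_eqF.
have nv : nc v ^+ k = energy_norm L * m.+1%:R.
  by rewrite -normcX -Lv Lm0 normcR_ge0// mulr_ge0// ltW.
have A0 := disc_area_gt0 R; have pi0 := pi_gt0 R.
pose S := pi / disc_area : R; have S0 : 0 < S by exact: divr_gt0.
(* The scaling for which the [k]-th power of [rho * F1] has the norm of [G ^+ k]. *)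
pose rho := (S / energy_norm L) `^ (k.*2)%:R^-1.
have rho0 : 0 < rho by rewrite powR_gt0// divr_gt0.
have rhok : rho ^+ k ^+ 2 * energy_norm L = S.
  rewrite -exprM muln2 -powR_mulrn ?ltW// -powRrM mulVf ?pnatr_eq0 -?lt0n ?double_gt0//.
  by rewrite powRr1 ?divr_ge0 ?ltW// divfK// gt_eqF.
have v1 : 0 < nc v by rewrite normc_gt0.
(* The unimodular factor makes the leading coefficient of the competitor
   positive. *)
pose tau : C := rho%:C * (v^* / (nc v)%:C).
have ntau : nc tau = rho.
  rewrite !normcM normcV normc_conj !normcR_ge0 ?normc_ge0 ?(ltW rho0)//.
  by rewrite divff ?mulr1// gt_eqF.
have tauv : tau * v = (rho * nc v)%:C.
  rewrite (rmorphM (real_complex R)) /= -[LHS]mulrA; congr (_ * _).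
  rewrite mulrAC [_^* * v]mulrC mulc_conj expr2 (rmorphM (real_complex R)) /= mulfK//.
  by rewrite fmorph_eq0 gt_eqF.
pose F z := tau * F1 z.
have hF : holomorphic F by apply: holomorphicM => //; exact: holomorphic_cst.
have Fm : taylor_coef F m0 = (rho * nc v)%:C by rewrite taylor_coef_scale// vE tauv.
have Fk : taylor_coef (fun z => F z ^+ k) = (fun n => tau ^+ k * L n).
  have e2 z : nc z < 1 -> F z ^+ k = psum (fun n => tau ^+ k * L n) z.
    by move=> z1; rewrite exprMn F1k// psumZ.
  by rewrite (eq_taylor (holomorphicX k hF) e2) taylor_psum//; exact: disc_coefZ.
have nF : bergman_norm (k.*2)%:R F = 1%E.
  apply/(bergman_norm1P k0 hF); rewrite Fk integral_energy_geometric; last first.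
    exact: geometric_boundedZ.
  rewrite energy_normZ// normcX ntau rhok /S mulrC divfK// gt_eqF//.
have zF : zero_subspace (k.*2)%:R (fun a => count_mem a s) F.
  split; first by split; [exact/derivable_holomorphic|rewrite nF ltry].
  have : exists2 g, holomorphic g & forall z, nc z < 1 -> F z = root_prod s z * g z.
    exists (fun z => tau * r z); first by apply: holomorphicM => //; exact: holomorphic_cst.
    by move=> z _; rewrite /F /F1 mulrCA.
  move=> /(vanishes_factorization hF hs) h a /unit_discE a1; exact: h.
have fact0 : (0 : C) < m0`!%:R by rewrite ltr0n fact_gt0.
have F0 : 0 < (F^`(m0))%classic 0.
  by rewrite derivn_taylor0// Fm mulr_gt0// ltcR mulr_gt0.
have := Gmax F zF nF F0; rewrite !derivn_taylor0// Fm ler_pM2l// => rv.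
move: G0; rewrite derivn_taylor0// pmulr_rgt0// => G0.
have [ga gE] : exists x, taylor_coef G m0 = x by exists (taylor_coef G m0).
rewrite gE in rv G0.
have gaE := ge0_real (ltW G0).
have rv' : rho * nc v <= nc ga by rewrite gaE lecR in rv.
have [g hg Gg] : exists2 g, holomorphic g & forall z, nc z < 1 -> G z = root_prod s z * g z.
  by apply/(vanishes_factorization hG hs) => a /unit_discE a1; exact: vG.
set h := taylor_coef (fun z => G z ^+ k).
have hGk := holomorphicX k hG; have dh : disc_coef h by exact: taylor_disc_coef.
have psh z : nc z < 1 -> psum h z = G z ^+ k.
  by move=> z1; rewrite -(taylor_series hGk z1).
have mh : multiple sk h.
  split=> //; exists (fun z => g z ^+ k); first exact: holomorphicX.
  by move=> z z1; rewrite psh// Gg// exprMn root_prod_power.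
have hm : h m = (nc ga ^+ k)%:C.
  rewrite /h /m (taylor_coef_power k hg Gg) gE {1}gaE.
  by rewrite rmorphXn.
have wh := weighted_sum_unit dh ((bergman_norm1P k0 hG).1 nG).
have phL : pair h L = (nc ga ^+ k / m.+1%:R)%:C.
  by rewrite (extL _ mh) -mE hm [RHS](rmorphM (real_complex R)) fmorphV rmorph_nat.
pose t := rho ^+ k.
have t0 : 0 <= t by rewrite exprn_ge0// ltW.
have hL n : h n = t%:C * L n.
  apply/eqP; rewrite -subr_eq0; apply/eqP.
  apply: (weighted_sum0_eq0 (a := fun n => h n - t%:C * L n)) => N.
  rewrite (le_trans (weighted_sum_sub_le t%:C N dh gL wh))//.
  have -> : (t%:C)^* * pair h L = (t * (nc ga ^+ k / m.+1%:R))%:C.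
    by rewrite phL conj_Creal ?(rmorphM (real_complex R))// complex_real.
  rewrite /= normcR_ge0// -/S -rhok -/t.
  have : t * (t * energy_norm L) <= t * (nc ga ^+ k / m.+1%:R).
    rewrite ler_wpM2l// ler_pdivlMr// -mulrA -nv -exprMn.
    by rewrite lerXn2r ?nnegrE ?normc_ge0// mulr_ge0 ?normc_ge0// ltW.
  by rewrite mulrA -expr2; move: (t ^+ 2 * _) (t * _) => p q; lra.
exists t%:C, e; split=> // w w1.
have ge : geometric_bounded e.
  have := geometric_boundedB (@geometric_dirac R m) gL; congr geometric_bounded.
  by apply/funext => n; rewrite subKr.
rewrite -psh//; have -> : h = (fun n => t%:C * L n) by apply/funext.
rewrite psumZ//; congr (_ * _); rewrite psumB ?psum_dirac//.
  exact/geometric_disc_coef/geometric_dirac.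
exact: geometric_disc_coef.
Qed.

End CanonicalDivisorPower.

(** * Partial fractions *)

Section PoleExpansion.
Variable R : realType.
Local Notation C := R[i].
Local Notation nc := (@normc R).
Implicit Types (a b w x : C) (j n D : nat).

(** Substituting [b^* w = 1 - x] with [x = 1 - b^* w] and expanding turns the
    kernel [w ^+ j / x ^+ (j + 2)] into a combination of pure poles. *)
Lemma pole_expansion b j D : b != 0 -> (j < D)%N -> exists c : nat -> C,
  forall w, 1 - b^* * w != 0 ->
    w ^+ j / (1 - b^* * w) ^+ (j + 2) =
    \sum_(i < D) c i / (1 - b^* * w) ^+ (i + 2).
Proof.
move=> b0 jD; have b0' : b^* != 0 by rewrite conjC_eq0.
exists (fun i => b^* ^- j * ((-1) ^+ (j - i) * 'C(j, i)%:R)) => w x0.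
have wE : w = (- (1 - b^* * w) + 1) / b^*.
  by rewrite opprB subrK mulrC mulKf.
move: (1 - b^* * w) x0 wE => x x0 ->.
rewrite exprMn exprDn exprVn mulrAC.
rewrite [LHS]mulrC mulr_suml mulr_sumr.
rewrite (big_ord_widen D (fun i => b^* ^- j *
  ((- x) ^+ (j - i) * 1 ^+ i *+ 'C(j, i) / x ^+ (j + 2)))) // big_mkcond /=.
apply: eq_bigr => i _; rewrite ltnS; case: leqP => ij; last first.
  by rewrite bin_small// !mulr0 mul0r.
rewrite -!mulrA; congr (_ * _).
rewrite expr1n mulr1 exprNn -mulr_natr -!mulrA; congr (_ * _); rewrite mulrC -!mulrA.
have -> : x ^+ (j + 2) = x ^+ (j - i) * x ^+ (i + 2).
  by rewrite -exprD addnA subnK.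
have x1 : x ^+ (j - i) != 0 by rewrite expf_neq0.
have x2 : x ^+ (i + 2) != 0 by rewrite expf_neq0.
move: (x ^+ (j - i)) (x ^+ (i + 2)) x1 x2 ('C(j, i)%:R : C) => p q p0 q0 c.
by congr (c * _); rewrite invfM mulrAC mulVf// mul1r.
Qed.

End PoleExpansion.

Section ZeroList.
Variables (R : realType) (N : nat) (z : 'I_N.+1 -> R[i]) (d : 'I_N.+1 -> nat).

Definition zero_list : seq R[i] :=
  flatten [seq nseq (d n) (z n) | n <- enum 'I_N.+1].

Lemma count_zero_list a : count_mem a zero_list = multiplicity z d a.
Proof.
rewrite count_flatten sumnE big_map big_map big_enum /= /multiplicity [RHS]big_mkcond /=.
apply: eq_bigr => n _; rewrite count_nseq /=.
by case: eqP => _; rewrite ?mul1n ?mul0n.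
Qed.

Lemma zero_list_mem a : a \in zero_list -> exists n, a = z n.
Proof. by move=> /flattenP[x /mapP[n _ ->] /nseqP[-> _]]; exists n. Qed.

Lemma multiplicity_inj n : injective z -> multiplicity z d (z n) = d n.
Proof.
move=> inj; rewrite /multiplicity (big_pred1 n)// => i /=.
by rewrite (inj_eq inj).
Qed.

Lemma multiplicity_notin a : (forall n, z n != a) -> multiplicity z d a = 0%N.
Proof. by move=> h; rewrite /multiplicity big_pred0// => i; rewrite (negbTE (h i)). Qed.

End ZeroList.

Theorem theorem5p1 (R : realType) (p : nat) (p_gt0 : (0 < p)%N)
    (p_even : ~~ odd p) (N : nat) (z : 'I_N.+1 -> R[i]) (d : 'I_N.+1 -> nat)
    (z_inj : injective z) (z_disc : forall n, unit_disc (z n))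
    (d_gt0 : forall n, (0 < d n)%N) (G : R[i] -> R[i])
    (HG : canonical_divisor (p%:R : R) (multiplicity z d) G) :
  ((forall n, z n != 0) ->
    exists (c0 : R[i]) (c : 'I_N.+1 -> nat -> R[i]),
      forall w, unit_disc w ->
        G w ^+ p./2 =
          c0 + \sum_(n < N.+1) \sum_(j < p./2 * d n)
                 c n j / (1 - (z n)^* * w) ^+ (j + 2))
  /\
  (z ord0 = 0 ->
    exists (c0 : R[i]) (c : 'I_N.+1 -> nat -> R[i]),
      forall w, unit_disc w ->
        G w ^+ p./2 =
          c0 * w ^+ (p./2 * d ord0)
          + \sum_(j < p./2 * d ord0) c ord0 j * w ^+ j
          + \sum_(n < N.+1 | n != ord0) \sum_(j < p./2 * d n)
              c n j / (1 - (z n)^* * w) ^+ (j + 2)).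
Proof.
have pE : p = p./2.*2 by rewrite -[LHS]odd_double_half (negbTE p_even).
have k0 : (0 < p./2)%N by rewrite -double_gt0 -pE.
rewrite pE in HG; move: (p./2) k0 HG => k k0 HG {p pE p_gt0 p_even}.
have z1 n : Normc.normc (z n) < 1 by apply/unit_discE; exact: z_disc.
pose s := zero_list z d.
have E : multiplicity z d = (fun a => count_mem a s).
  by apply/funext => a; rewrite count_zero_list.
pose phi n j w : R[i] :=
  if z n == 0 then w ^+ j else ((1 - (z n)^* * w) ^+ (j + 2))^-1.
(* The span of the kernels: a zero at the origin contributes powers of [w], the
   others contribute poles. *)
pose P (e : nat -> R[i]) := disc_coef e /\
  exists c : 'I_N.+1 -> nat -> R[i], forall w, Normc.normc w < 1 ->
    psum e w = \sum_(n < N.+1) \sum_(j < k * d n) c n j * phi n j w.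
have hs b : b \in s -> Normc.normc b < 1.
  by move=> /zero_list_mem[n ->].
have P0 : P (fun=> 0).
  split; first exact: disc_coef_cst.
  exists (fun _ _ => 0) => w w1; rewrite big1 => [|n _].
    apply: has_sum_csum => e e0; exists 0%N => n _.
    by rewrite big1 ?subr0 ?normc0// => i _; rewrite mul0r.
  by rewrite big1// => j _; rewrite mul0r.
have Plin t u v : P u -> P v -> P (fun n => t * u n + v n).
  move=> [du [c uc]] [dv [c' vc]]; split.
    exact: disc_coefD (disc_coefZ _ du) dv.
  exists (fun n j => t * c n j + c' n j) => w w1.
  rewrite psumD ?psumZ//; last exact: disc_coefZ.
  rewrite uc// vc// mulr_sumr -big_split; apply: eq_bigr => n _.
  rewrite mulr_sumr -big_split; apply: eq_bigr => j _.
  by rewrite /= mulrDl mulrA.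
have Pterm e n (c : nat -> R[i]) : disc_coef e ->
    (forall w, Normc.normc w < 1 ->
      psum e w = \sum_(j < k * d n) c j * phi n j w) -> P e.
  move=> de ec; split=> //; exists (fun n' j => if n' == n then c j else 0) => w w1.
  rewrite (bigD1 n)//= eqxx ec// [X in _ = _ + X]big1 ?addr0// => i /negbTE ->.
  by rewrite big1// => j _; rewrite mul0r.
have PK b j : Normc.normc b < 1 -> (j < k * count_mem b s)%N -> P (kernel b j).
  move=> b1 jb.
  have [n bn] : exists n, b = z n.
    apply: (@zero_list_mem _ _ _ d); rewrite -has_pred1 has_count.
    by move: jb; rewrite -/s; case: (count_mem b s) => //; rewrite muln0.
  move: jb; rewrite count_zero_list bn multiplicity_inj// => jd.
  have dK := geometric_disc_coef (geometric_kernel j (z1 n)).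
  have [zn|zn] := eqVneq (z n) 0.
    apply: (Pterm _ n (fun i => (i == j)%:R * j.+1`!%:R)) => // w w1.
    rewrite (bigD1 (Ordinal jd))//= eqxx mul1r /phi zn eqxx big1 ?addr0.
      by rewrite psum_kernel ?normc0// conjC0 mul0r subr0 expr1n divr1.
    by move=> i ij; rewrite -val_eqE /= in ij; rewrite (negbTE ij) !mul0r.
  have [c hc] := pole_expansion zn jd.
  apply: (Pterm _ n (fun i => j.+1`!%:R * c i)) => // w w1.
  rewrite psum_kernel// -mulrA hc; last first.
    rewrite subr_eq0 eq_sym; apply/eqP => h.
    have : Normc.normc ((z n)^* * w) < 1.
      by rewrite normcM normc_conj mulr_ilt1 ?normc_ge0.
    by rewrite h normc1 ltxx.
  by rewrite mulr_sumr; apply: eq_bigr => i _; rewrite /phi (negbTE zn) mulrA.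
rewrite E in HG.
have [t [e [[de [c ec]] Gk]]] := canonical_divisor_power k0 hs HG P0 Plin PK.
have GE w : unit_disc w -> G w ^+ k = t * w ^+ (k * multiplicity z d 0) +
    \sum_(n < N.+1) \sum_(j < k * d n) (- t * c n j) * phi n j w.
  move=> /unit_discE w1; rewrite Gk// ec// count_zero_list mulrBr; congr (_ + _).
  rewrite -mulNr mulr_sumr; apply: eq_bigr => n _; rewrite mulr_sumr.
  by apply: eq_bigr => j _; rewrite mulrA.
split=> [zn0|z00]; exists t, (fun n j => - t * c n j) => w w1; rewrite GE//.
  rewrite multiplicity_notin// muln0 expr0 mulr1; congr (_ + _).
  apply: eq_bigr => n _; apply: eq_bigr => j _.
  by rewrite /phi (negbTE (zn0 n)).
rewrite -{1}z00 multiplicity_inj// (bigD1 ord0)//= addrA; congr (_ + _ + _).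
  by apply: eq_bigr => j _; rewrite /phi z00 eqxx.
apply: eq_bigr => n n0; apply: eq_bigr => j _.
by rewrite /phi -z00 (inj_eq z_inj) (negbTE n0).
Qed.
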